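(* Let $(T,X)$ be a topologically mixing countable Markov shift, let $\phi:X\to\mathbb{R}$ be a locally Hölder continuous potential (with respect to a fixed $\theta\in(0,1)$), and let $m$ be a Gibbs measure for $\phi$. Then there exists a constant $b>0$ such that for every $T$-invariant Borel probability measure $\mu$ on $X$ with $-\mu(\phi)<\infty$ and $H_\mu(\xi)<\infty$, every $f\in\mathcal{L}$ and every integer $n\ge1$, $$|m(f)-\mu(f)|\leq b\,\|f\|_{\mathcal{L}}\left(\theta^{n}+\Bigl(2\theta^{n}\sum_{k\geq n}\mathrm{var}_k(\phi)+P_{GS}(\phi)-\bigl(\mu(\phi)+H_\mu(\xi\,|\,\xi_0^{n-1})\bigr)\Bigr)^{\frac12}\right).$$ Moreover, if $\mathrm{var}_\ell(\phi)=0$ for some integer $\ell\ge1$, then for every $n\ge3\ell$ (and all such $\mu$ and $f$) also $$|m(f)-\mu(f)|\leq b\,\|f\|_{\mathcal{L}}\left(\theta^{\lfloor\frac{n-\ell}{2}\rfloor}+\Bigl(P_{GS}(\phi)-\bigl(\mu(\phi)+\tfrac1nH_\mu(\xi_0^{n-1})\bigr)+\tfrac{\ell}{n-\ell}H_\mu(\xi)\Bigr)^{\frac12}\right).$$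
   Context: Let $S$ be a countable set of states and $A=(t_{ij})_{i,j\in S}$ a matrix with entries in $\{0,1\}$ (the transition matrix). The countable Markov shift is $X=\{x=(x_0,x_1,\dots)\in S^{\mathbb{N}_0}: t_{x_ix_{i+1}}=1 \text{ for all } i\ge 0\}$ with the left shift $T:X\to X$, assumed topologically mixing. Cylinders are $[a_0,\dots,a_{n-1}]=\{x\in X: x_i=a_i,\ 0\le i<n\}$. Fix $\theta\in(0,1)$ and the metric $d(x,y)=\theta^{\min\{i:x_i\ne y_i\}}$ for $x\neq y$, $d(x,x)=0$. For $\phi:X\to\mathbb{R}$ put $\phi_n=\phi+\phi\circ T+\dots+\phi\circ T^{n-1}$ and $\mathrm{var}_n(\phi)=\sup\{\phi(x)-\phi(y): x,y\in X,\ x_i=y_i \text{ for } i<n\}$. $\phi$ is locally Hölder continuous if there is $A_\phi>0$ with $\mathrm{var}_n(\phi)\le A_\phi\theta^n$ for all $n\ge1$. A $T$-invariant Borel probability measure $m$ on $X$ is a Gibbs measure for $\phi$ if there are constants $C,P$ such that for every cylinder $[a_0,\dots,a_{n-1}]$ and every $x\in[a_0,\dots,a_{n-1}]$, $\frac1C\le \frac{m([a_0,\dots,a_{n-1}])}{e^{\phi_n(x)-nP}}\le C$. The Gurevich-Sarig pressure is $P_{GS}(\phi)=\lim_{n\to\infty}\frac1n\log\sum_{x\in X,\,T^nx=x}e^{\phi_n(x)}1_{[s]}(x)$ for any $s\in S$ (the limit exists and is independent of $s$; it is finite when a Gibbs measure exists). For a measure $\mu$, $\mu(g)=\int g\,d\mu$.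 Let $\xi=\{[s]\}_{s\in S}$ be the partition of $X$ into principal cylinders and $\xi_0^{n-1}=\bigvee_{j=0}^{n-1}T^{-j}\xi$. For a countable partition $\eta$, $H_\mu(\eta)=-\sum_{Q\in\eta}\mu(Q)\log\mu(Q)$, and $H_\mu(\xi\,|\,\eta)$ denotes the conditional entropy of $\xi$ given $\eta$. For continuous $f:X\to\mathbb{R}$ let $\|f\|_\theta=\sup\{|f(x)-f(y)|/d(x,y): x\neq y,\ x_0=y_0\}$ and $\|f\|_{\mathcal{L}}=\|f\|_\theta+\|f\|_\infty$; $\mathcal{L}$ is the Banach space of those $f$ with $\|f\|_{\mathcal{L}}<\infty$. *)

(* Defs.v *)
From HB Require Import structures.
From mathcomp Require Import all_boot all_order all_algebra.
From mathcomp Require Import all_classical all_reals all_analysis.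

Set Implicit Arguments.
Unset Strict Implicit.
Unset Printing Implicit Defensive.
Import Order.TTheory GRing.Theory Num.Theory.
Import numFieldNormedType.Exports.
Local Open Scope classical_set_scope.
Local Open Scope ring_scope.

Definition admissible (S : countType) (t : rel S) : set (nat -> S) :=
  [set x | forall i, t (x i) (x i.+1)].

(* The one-sided Markov shift with transition matrix t. The parameters theta
   and ne do not occur in the points: theta selects the metric put on them,
   and ne (the shift is nonempty) supplies the base point that the library
   requires of a measurable type. *)
Record markov_shift (R : realType) (theta : {itv R & `]0, 1[})
    (S : countType) (t : rel S) (ne : admissible t !=set0) := MarkovShift {
  coords :> nat -> S ;
  coordsP : admissible t coords }.

Section metric.
Context (R : realType) (theta : {itv R & `]0, 1[}) (S : countType) (t : rel S)
  (ne : admissible t !=set0).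
Local Notation X := (markov_shift theta ne).

HB.instance Definition _ := gen_eqMixin X.
HB.instance Definition _ := gen_choiceMixin X.
HB.instance Definition _ :=
  isPointed.Build X (MarkovShift theta ne (projT2 (cid ne))).

Definition shift_dist (x y : X) : R :=
  if pselect (exists i, x i != y i) is left xy
  then theta%:num ^+ ex_minn xy else 0.

Lemma coords_inj (x y : X) : coords x =1 coords y -> x = y.
Proof.
case: x y => [x px] [y py] /= /funext xy; case: _ / xy py => py.
by rewrite (Prop_irrelevance px py).
Qed.

Let dxx x : shift_dist x x = 0.
Proof. by rewrite /shift_dist; case: pselect => // h; exfalso; case: h => i; rewrite eqxx. Qed.

Let theta_gt0 : 0 < theta%:num.
Proof. by []. Qed.

Let theta_le1 : theta%:num <= 1.
Proof. by []. Qed.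

Let d_ge0 x y : 0 <= shift_dist x y.
Proof. by rewrite /shift_dist; case: pselect => // h; rewrite exprn_ge0// ltW. Qed.

Let d_pos x y : shift_dist x y = 0 -> x = y.
Proof.
rewrite /shift_dist; case: pselect => [h|h _].
  by move=> /eqP; rewrite expf_eq0 gt_eqF// andbF.
apply: coords_inj => i; apply/eqP/negPn/negP => xyi; apply: h; by exists i.
Qed.

Let d_le (x y : X) i : x i != y i -> theta%:num ^+ i <= shift_dist x y.
Proof.
move=> xyi; rewrite /shift_dist; case: pselect => [h|[]]; last by exists i.
case: ex_minnP => k _ /(_ _ xyi) ki.
by apply: ler_wiXn2l => //; exact: ltW.
Qed.

Let d_sym_le x y : shift_dist x y <= shift_dist y x.
Proof.
rewrite {1}/shift_dist; case: pselect => [h|_]; last exact: d_ge0.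
by case: ex_minnP => k xyk _; apply: d_le; rewrite eq_sym.
Qed.

Let d_sym x y : shift_dist x y = shift_dist y x.
Proof. by apply/eqP; rewrite eq_le !d_sym_le. Qed.

Let d_triangle y x z : shift_dist x z <= shift_dist x y + shift_dist y z.
Proof.
rewrite {1}/shift_dist; case: pselect => [h|_]; last by rewrite addr_ge0.
case: ex_minnP => k xzk _; have [xyk|xyk] := eqVneq (x k) (y k).
  by rewrite -[leLHS]add0r lerD// d_le// -xyk.
by rewrite -[leLHS]addr0 lerD// d_le.
Qed.

HB.instance Definition _ := isMetric.Build R X dxx d_pos d_sym d_triangle.

Let borelC (A : set X) : <<s @open X >> A -> <<s @open X >> (~` A).
Proof. by move=> sA; rewrite -setTD; exact: sigma_algebraCD. Qed.

HB.instance Definition _ := @isMeasurable.Build (sigma_display (@open X)) X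
  <<s @open X >> (@sigma_algebra0 _ setT (@open X)) borelC
  (@sigma_algebra_bigcup _ setT (@open X)).

End metric.

Section dynamics.
Context (R : realType) (theta : {itv R & `]0, 1[}) (S : countType) (t : rel S)
  (ne : admissible t !=set0).
Local Notation X := (markov_shift theta ne).

Definition left_shift (x : X) : X :=
  MarkovShift theta ne (coords := fun i => x i.+1) (fun i => coordsP x i.+1).

Definition topologically_mixing := forall U V : set X,
  open U -> open V -> U !=set0 -> V !=set0 ->
  exists N, forall n, (N <= n)%N -> U `&` (iter n left_shift @^-1` V) !=set0.

Definition cylinder n (a : n.-tuple S) : set X :=
  [set x : X | forall i : 'I_n, x i = tnth a i].

Definition birkhoff (phi : X -> R) n (x : X) : R :=
  \sum_(i < n) phi (iter i left_shift x).

Local Open Scope ereal_scope.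

Definition cyl_variation (phi : X -> R) n : \bar R :=
  ereal_sup [set z | exists x y : X,
    (forall i, (i < n)%N -> x i = y i) /\ z = (phi x - phi y)%:E].

Definition locally_Holder (phi : X -> R) :=
  exists A : R, (0 < A)%R /\
    forall n, (1 <= n)%N -> cyl_variation phi n <= (A * theta%:num ^+ n)%:E.

Definition shift_invariant (mu : set X -> \bar R) :=
  forall B, measurable B -> mu (left_shift @^-1` B) = mu B.

Definition gibbs (phi : X -> R) (m : probability X R) :=
  shift_invariant m /\
  exists C P : R, (0 < C)%R /\
    forall n (a : n.-tuple S) x, (1 <= n)%N -> cylinder a x ->
      (C^-1 <= fine (m (cylinder a)) / expR (birkhoff phi n x - n%:R * P)
            <= C)%R.

(* With the library conventions lne 0 = -oo and lne +oo = +oo. *)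
Definition pressure (phi : X -> R) (s : S) : \bar R :=
  limn (fun n => (n%:R^-1)%:E *
    lne (\esum_(x in [set x | iter n left_shift x = x])
           (expR (birkhoff phi n x) * \1_(cylinder [tuple s]) x)%:E)).

Definition principal : set (set X) := [set cylinder [tuple s] | s in setT].

Definition partition_join (xi eta : set (set X)) : set (set X) :=
  [set A `&` B | A in xi & B in eta].

Definition iterated_join (xi : set (set X)) n : set (set X) :=
  \big[partition_join/[set setT]]_(j < n) [set iter j left_shift @^-1` B | B in xi].

(* Since 0 * -oo = 0 in the extended reals, null atoms contribute 0 to the two
   sums below. All terms are nonnegative when mu is a probability measure. *)
Definition entropy (mu : set X -> \bar R) (eta : set (set X)) : \bar R :=
  \esum_(Q in eta) - (mu Q * lne (mu Q)).

Definition cond_entropy (mu : set X -> \bar R) (xi eta : set (set X)) :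
    \bar R :=
  \esum_(Q in eta) \esum_(P in xi)
    - (mu (P `&` Q) * lne (mu (P `&` Q) / mu Q)).

(* The maximum with 0 only matters when no pair (x, y) is available: it
   replaces ereal_sup set0 = -oo by 0. *)
Definition theta_norm (f : X -> R) : \bar R :=
  maxe 0 (ereal_sup [set z | exists x y : X,
    [/\ x <> y, x 0%N = y 0%N & z = (`|f x - f y| / mdist x y)%:E]]).

Definition sup_norm (f : X -> R) : \bar R :=
  ereal_sup [set `|f x|%:E | x in setT].

Definition L_norm (f : X -> R) : \bar R := theta_norm f + sup_norm f.

Definition in_L (f : X -> R) := continuous f /\ L_norm f < +oo.

End dynamics.

Arguments principal {R} theta {S t} ne.
Arguments topologically_mixing {R} theta {S t} ne.

(* Main.v *)
Require Import Defs.
From HB Require Import structures.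
From mathcomp Require Import all_boot all_order all_algebra.
From mathcomp Require Import all_classical all_reals all_analysis.
From mathcomp Require Import measurable_realfun ring lra zify.

Set Implicit Arguments.
Unset Strict Implicit.
Unset Printing Implicit Defensive.
Import Order.TTheory GRing.Theory Num.Theory.
Import numFieldNormedType.Exports.
Local Open Scope classical_set_scope.
Local Open Scope ring_scope.
Local Open Scope ereal_scope.

(** The partition xi_0^{n-1} refines xi, so the conditional entropy in the first
    inequality vanishes and what is needed is a lower bound on P - mu(phi).
    Unless X is a point, mixing and the Gibbs property force the mass of
    n-cylinders to 0 uniformly; for some n the Gibbs inequality then gives
    phi_n - n P <= -1 everywhere, so that P - mu(phi) >= 1/n. The same bounds
    identify the Gurevich-Sarig pressure with the Gibbs constant P.

    For the second inequality, let phi depend on the first r coordinates. From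
    the values m[z] one reads off a superharmonic function h of r letters,
    bounded above and below, and a relative entropy argument shows that h is
    harmonic. The transition probabilities g(s v) = e^{phi(s v) - P} h(s v)/h(v)
    form a Markov chain prepending letters, whose transfer operator contracts
    Lipschitz functions (Doeblin minorization). For an invariant mu let D_j be
    the relative entropy of mu on words of length j + 1 with respect to the law
    of such a word whose last j letters follow mu and whose first one is drawn
    from g. Then D_j = H_j - H_{j+1} + P - mu(phi), where H_j is the entropy of
    words of length j, and Pinsker's inequality along the iterates of the
    transfer operator gives |m(f) - mu(f)| <= B |f| (theta^j + D_j^{1/2});
    for m itself the D_j are summable. Averaging D_j over (n - l)/2 <= j < n
    provides an index with D_j at most twice the quantity under the root. *)

(** The alphabet is countable and X need not be compact; two facts about m stand in for compactness.
    First, the Gibbs bounds make the mass of a concatenation comparable to the product of the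
    masses, so a finite set of letters contains a predecessor of every admissible word; together
    with mixing this gives the minorization. Second, since m is invariant, the mean under m of ln
    ([tail_density] / h) grows with each added letter by a relative entropy plus the defect of g
    from total mass 1. This logarithm is bounded, so no defect can persist and the relative
    entropies of m become arbitrarily small at long words. The numbers m(f) and mu(f) are compared
    through one value of a high iterate of the transfer operator, which does not depend on mu. The
    index of the iterate grows while the word length j stays fixed; the errors can be added up
    because the oscillations of the iterates are summable. The integer r is the least l at which the
    variation vanishes, so that one constant serves every l. *)

Section countable_sums.
Context (R : realType) (T : countType).

(** Carries sums over a countable type to series, where sums can be exchanged with integrals by
    [integral_nneseries]; integers that encode no element contribute 0. *)
Lemma esum_nneseries (a : T -> \bar R) : (forall t, 0 <= a t) ->
  \esum_(t in setT) a t =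
  \sum_(n <oo) (if @pickle_inv T n is Some t then a t else 0).
Proof.
move=> a0; rewrite nneseries_esumT; last by move=> n; case: pickle_inv.
set b := fun n => if _ is Some t then a t else 0.
have bK t : b (pickle t) = a t by rewrite /b pickleK_inv.
transitivity (\esum_(t in [set: T]) b (pickle t)); first exact: eq_esum.
rewrite -(esum_image setT pickle b); last first.
  by move=> x y _ _; exact: (pcan_inj (@pickleK_inv T)).
rewrite esum_mkcond; apply: eq_esum => n _; case: ifPn => //.
rewrite notin_setE/= => nP; rewrite /b; case E: pickle_inv => [t|//].
exfalso; apply: nP; exists t => //; have := @pickle_invK T n.
by rewrite /oapp E.
Qed.

Lemma esumZl (T' : choiceType) (A : set T') (c : R) (a : T' -> \bar R) : (0 <= c)%R ->
  (forall t, A t -> 0 <= a t) ->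
  \esum_(t in A) (c%:E * a t) = c%:E * \esum_(t in A) a t.
Proof.
move=> c0 a0; have H (d : R) (b : T' -> \bar R) : (0 <= d)%R -> (forall t, A t -> 0 <= b
  t) ->
    \esum_(t in A) (d%:E * b t) <= d%:E * \esum_(t in A) b t.
  move=> d0 b0; apply: ge_ereal_sup => _ [X [finX XA] <-].
  rewrite fsbig_finite//= big_seq -ge0_sume_distrr; last first.
    by move=> i; rewrite in_fset_set// inE => /XA/b0.
  rewrite -big_seq lee_wpmul2l//; apply: ereal_sup_ubound; exists X => //.
  by rewrite fsbig_finite.
apply/eqP; rewrite eq_le H//=.
have [->|cn0] := eqVneq c 0%R.
  by rewrite mul0e esum_ge0// => t At; rewrite mul0e.
have {cn0}c0 : (0 < c)%R by rewrite lt_neqAle eq_sym cn0.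
(* The converse inequality is the first one for the scalar [c^-1]. *)
rewrite -lee_pdivlMl//; apply: le_trans (H _ _ _ _).
- by apply: le_esum => t At; rewrite muleA -EFinM mulVf ?gt_eqF// mul1e.
- by rewrite invr_ge0 ltW.
- by move=> t At; apply: mule_ge0; [rewrite lee_fin ltW|exact: a0].
Qed.

Lemma esum_ge1 (T' : choiceType) (A : set T') (a : T' -> \bar R) t : A t ->
  (forall s, A s -> 0 <= a s) -> a t <= \esum_(s in A) a s.
Proof.
move=> At a0; apply: esum_ge; exists [set t]; last by rewrite fsbig_set1.
by split => // _ ->.
Qed.

Context d (X : measurableType d) (mu : {measure set X -> \bar R}) (p : X -> T).
Hypothesis mp : forall t, measurable (p @^-1` [set t]).

Lemma measurable_discrete_comp d' (Y : measurableType d') (F : T -> Y) (A : set X) :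
  measurable A -> measurable_fun A (F \o p).
Proof.
move=> mA _ B mB.
rewrite (_ : _ `&` _ = \bigcup_t (if `[< B (F t) >] then A `&` p @^-1` [set t] else
  set0)).
  apply: countable_bigcupT_measurable => // t.
  by case: ifP => // _; exact: measurableI.
apply/seteqP; split=> [x [Ax Bx]|x [t _]].
  by exists (p x) => //; rewrite ifT//; exact/asboolP.
by case: ifPn => // /asboolP Bt [Ax /= px]; split => //=; rewrite px.
Qed.

(** [F (p x)] is the sum over t of [F t] times the indicator of the fibre over t, and monotone
    convergence integrates it term by term. *)
Lemma integral_discrete (A : set X) (F : T -> R) : measurable A ->
  (forall t, (0 <= F t)%R) ->
  \int[mu]_(x in A) (F (p x))%:E =
  \esum_(t in setT) ((F t)%:E * mu (A `&` p @^-1` [set t])).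
Proof.
move=> mA F0; rewrite esum_nneseries; last first.
  by move=> t; rewrite mule_ge0// lee_fin.
pose f n x : \bar R := if @pickle_inv T n is Some t then
  (F t)%:E * (\1_(p @^-1` [set t]) x)%:E else 0.
transitivity (\int[mu]_(x in A) \sum_(n <oo) f n x).
  apply: eq_integral => x _; rewrite /f.
  transitivity (\esum_(t in setT) ((F t)%:E * (\1_(p @^-1` [set t]) x)%:E)); last first.
    rewrite esum_nneseries// => t; rewrite mule_ge0// lee_fin//.
  rewrite (esumID [set p x]) => [|t _]; last by rewrite mule_ge0// lee_fin.
  rewrite setTI setTI esum_set1; last by rewrite mule_ge0// lee_fin.
  rewrite esum1 ?adde0 => [|t /= tp].
    by rewrite indicE mem_set//= mule1.
  by rewrite indicE memNset ?mule0//= => /esym.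
rewrite integral_nneseries//; last 2 first.
- move=> n; rewrite /f; case: pickle_inv => [t|//].
  apply: emeasurable_funM => //; apply/measurable_EFinP.
  by apply: measurable_indic.
- by move=> n x _; rewrite /f; case: pickle_inv => // t; rewrite mule_ge0// lee_fin.
apply: eq_eseriesr => n _; rewrite /f; case: pickle_inv => [t|]; last exact: integral0.
rewrite ge0_integralZl//; last 2 first.
- by apply/measurable_EFinP; exact: measurable_indic.
- by rewrite lee_fin.
by rewrite integral_indic// setIC.
Qed.

Lemma measure_discrete (A : set X) : measurable A ->
  mu A = \esum_(t in setT) mu (A `&` p @^-1` [set t]).
Proof.
move=> mA; rewrite -[LHS]mul1e -integral_cst//.
have := @integral_discrete A (fun=> 1%R) mA (fun=> ler01) => ->.
by apply: eq_esum => t _; rewrite mul1e.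
Qed.

End countable_sums.

(** * Words and cylinders *)

Section words.
Context (R : realType) (theta : {itv R & `]0, 1[}) (S : countType) (t : rel S)
  (ne : admissible t !=set0).
Local Notation X := (markov_shift theta ne).
Local Notation T := (@left_shift R theta S t ne).
Implicit Types (x y : X) (u v w : seq S) (n : nat).

Definition prefix_word n x : seq S := mkseq x n.

(** Words are plain sequences, not tuples, so that concatenation, [take] and [drop] need no casts
    between lengths; [cylinderE] relates the two notions. *)
Definition word_cylinder w : set X := [set x | prefix_word (size w) x = w].
Local Notation cyl := word_cylinder.

(** Inadmissible words are included: their cylinders are empty, so every measure gives them mass
    0. *)
Definition words n : set (seq S) := [set w | size w = n].

Lemma size_prefix_word n x : size (prefix_word n x) = n.
Proof. exact: size_mkseq. Qed.

Lemma iter_shiftE n x i : iter n T x i = x (n + i)%N.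
Proof. by elim: n i => //= n IH i; rewrite IH addnS. Qed.

Lemma prefix_wordD m n x :
  prefix_word (m + n) x = prefix_word m x ++ prefix_word n (iter m T x).
Proof.
rewrite /prefix_word /mkseq iotaD map_cat; congr (_ ++ _).
rewrite add0n -[in LHS](addn0 m) iotaDl -map_comp; apply: eq_map => i /=.
by rewrite iter_shiftE.
Qed.

Lemma prefix_wordS n x : prefix_word n.+1 x = x 0%N :: prefix_word n (T x).
Proof. by rewrite -add1n prefix_wordD. Qed.

Lemma take_prefix m n x : (m <= n)%N -> take m (prefix_word n x) = prefix_word m x.
Proof.
by move=> mn; rewrite -(subnKC mn) prefix_wordD take_size_cat// size_prefix_word.
Qed.

Lemma cyl_prefix n x : cyl (prefix_word n x) x.
Proof. by rewrite /word_cylinder/= size_prefix_word. Qed.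

Lemma cyl_cat u v x : cyl (u ++ v) x <-> cyl u x /\ cyl v (iter (size u) T x).
Proof.
rewrite /word_cylinder/= size_cat prefix_wordD; split=> [/eqP|[-> ->]//].
by rewrite eqseq_cat ?size_prefix_word// => /andP[/eqP ? /eqP ?].
Qed.

Lemma cyl_cons s v x : cyl (s :: v) x <-> x 0%N = s /\ cyl v (T x).
Proof.
rewrite /word_cylinder/= prefix_wordS; split=> [[]//|[-> ->]//].
Qed.

Lemma eq_prefixP n x y :
  prefix_word n x = prefix_word n y <-> (forall i, (i < n)%N -> x i = y i).
Proof.
split=> [xy i ni|xy]; last by apply/eq_in_map => i; rewrite mem_iota => /xy.
by have := congr1 (fun w => nth (x 0%N) w i) xy; rewrite !nth_mkseq.
Qed.

Lemma cylinderE n (a : n.-tuple S) : cylinder a = cyl a :> set X.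
Proof.
apply/seteqP; split=> x; rewrite /cylinder /word_cylinder/= size_tuple => xa.
  apply: (@eq_from_nth _ (x 0%N)); first by rewrite size_prefix_word size_tuple.
  by move=> i; rewrite size_prefix_word => ni;
    rewrite nth_mkseq// (xa (Ordinal ni)) (tnth_nth (x 0%N)).
by move=> i; rewrite (tnth_nth (x 0%N)) -xa nth_mkseq.
Qed.

(** The strict inequality gains one letter: a disagreement at an index at most n already puts the
    points at distance at least [theta^n]. *)
Lemma mdist_prefix n x y : (mdist x y < theta%:num ^+ n)%R ->
  prefix_word n.+1 x = prefix_word n.+1 y.
Proof.
move=> dxy; apply/eq_prefixP => i; rewrite ltnS => ni; apply/eqP/negPn/negP => xyi.
move: dxy; rewrite ltNge => /negP; apply.
rewrite [mdist x y]/(shift_dist x y)/shift_dist; case: pselect => [h|[]];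
  last by exists i.
case: ex_minnP => k _ /(_ _ xyi) ki.
by apply: ler_wiXn2l; [|exact: ltW|exact: leq_trans ki ni].
Qed.

Lemma prefix_mdist n x y : prefix_word n x = prefix_word n y ->
  (mdist x y <= theta%:num ^+ n)%R.
Proof.
move=> /eq_prefixP xy.
rewrite [mdist x y]/(shift_dist x y)/shift_dist; case: pselect => [h|_];
  last exact: exprn_ge0.
case: ex_minnP => k xyk _; apply: ler_wiXn2l => //.
by rewrite leqNgt; apply/negP => /xy/eqP; apply/negP.
Qed.

Lemma nbhs_prefix n x (A : set X) :
  (forall y, prefix_word n y = prefix_word n x -> A y) -> nbhs x A.
Proof.
move=> nA; apply/nbhs_ballP; exists (theta%:num ^+ n)%R => /=; first exact: exprn_gt0.
move=> y; rewrite ballEmdist/= => /mdist_prefix xy; apply: nA.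
by rewrite -[LHS](take_prefix _ (leqnSn n)) -[RHS](take_prefix _ (leqnSn n)) xy.
Qed.

Lemma open_cyl w : open (cyl w).
Proof.
rewrite openE => x wx; apply: (@nbhs_prefix (size w)) => y xy.
by rewrite /word_cylinder/= xy.
Qed.

Lemma open_measurable_shift (A : set X) : open A -> measurable A.
Proof. by move=> oA; apply: sub_gen_smallest. Qed.

Lemma measurable_cyl w : measurable (cyl w).
Proof. by apply: open_measurable_shift; apply: open_cyl. Qed.

Lemma measurable_prefix n w : measurable (prefix_word n @^-1` [set w]).
Proof.
have [<-|wn] := eqVneq (size w) n; first exact: measurable_cyl.
rewrite (_ : _ @^-1` _ = set0)//; apply/seteqP; split=> // x /= xw.
by move: wn; rewrite -xw size_prefix_word eqxx.
Qed.

Lemma measurable_of_open (Y : topologicalType) (f : X -> Y) :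
  continuous f -> forall B, open B -> measurable (f @^-1` B).
Proof.
move=> cf B oB; apply: open_measurable_shift.
by move/continuousP: cf; exact.
Qed.

Lemma continuous_measurable_real (f : X -> R) : continuous f ->
  measurable_fun setT f.
Proof.
move=> cf; apply: (measurability _ (RGenOpens.measurableE R)).
move=> _ [_ [a [b ->] <-]]; rewrite setTI.
by apply: measurable_of_open => //; exact: interval_open.
Qed.

Lemma measurable_shift : measurable_fun setT T.
Proof.
apply: (@measurability _ _ X X setT T (@open X)) => //.
move=> _ [B oB <-]; rewrite setTI; apply: measurable_of_open => // x A.
move=> /nbhs_ballP[e e0 eA].
have [n ne'] : exists n, (theta%:num ^+ n < e)%R.
  have /cvgrPdist_lt/(_ e e0)[n _] : (theta%:num ^+ n : R)%R @[n --> \oo] --> (0 : R)%R.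
    by apply: cvg_expr; rewrite ger0_norm.
  move=> /(_ n (leqnn n)) /=; rewrite sub0r normrN ger0_norm ?exprn_ge0// => ?.
  by exists n.
(* One extra letter is fixed because T deletes the first one. *)
apply: (@nbhs_prefix n.+1) => y; rewrite !prefix_wordS => -[_ yx] /=.
by apply: eA; rewrite ballEmdist/=; apply: le_lt_trans ne'; apply: prefix_mdist.
Qed.

Lemma measurable_iter_shift n : measurable_fun setT (iter n T).
Proof.
elim: n => [|n IH]; first exact: measurable_id.
exact: measurableT_comp measurable_shift IH.
Qed.

End words.
Arguments words S n : clear implicits.

Section word_sums.
Context (R : realType) (S : countType).
Implicit Types (u v w : seq S) (F : seq S -> \bar R).

Lemma esum_words0 F : 0 <= F [::] -> \esum_(w in words S 0) F w = F [::].
Proof.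
move=> F0; rewrite (_ : words S 0 = [set [::]]) ?esum_set1//.
by apply/seteqP; split=> w /= => [/size0nil|->].
Qed.

Lemma esum_words_cons n F : (forall w, size w = n.+1 -> 0 <= F w) ->
  \esum_(w in words S n.+1) F w =
  \esum_(v in words S n) \esum_(s in setT) F (s :: v).
Proof.
move=> F0; rewrite (@esum_esum _ _ _ (words S n) (fun=> setT) (fun v s => F (s :: v)));
  last first.
  by move=> v s vn _; apply: F0; rewrite /= vn.
apply: (reindex_esum _ _ (fun k : seq S * S => k.2 :: k.1)); split.
- by move=> [v s] [/= vn _]; rewrite /words/= vn.
- by move=> [v s] [v' s'] _ _ /= [-> ->].
- by move=> [//|s v] [vn]; exists (v, s).
Qed.

Lemma esum_words_head n F : (forall w, size w = n.+1 -> 0 <= F w) ->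
  \esum_(w in words S n.+1) F w =
  \esum_(s in setT) \esum_(v in words S n) F (s :: v).
Proof.
move=> F0; rewrite (@esum_esum _ _ _ setT (fun=> words S n) (fun s v => F (s :: v)));
  last first.
  by move=> s v _ vn; apply: F0; rewrite /= vn.
apply: (reindex_esum _ _ (fun k : S * seq S => k.1 :: k.2)); split.
- by move=> [s v] [/= _ vn]; rewrite /words/= vn.
- by move=> [s v] [s' v'] _ _ /= [-> ->].
- by move=> [//|s v] [vn]; exists (s, v).
Qed.

Lemma esum_words_rcons n F : (forall w, size w = n.+1 -> 0 <= F w) ->
  \esum_(w in words S n.+1) F w =
  \esum_(v in words S n) \esum_(s in setT) F (rcons v s).
Proof.
move=> F0; rewrite (@esum_esum _ _ _ (words S n) (fun=> setT)
  (fun v s => F (rcons v s))); last first.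
  by move=> v s vn _; apply: F0; rewrite size_rcons vn.
apply: (reindex_esum _ _ (fun k : seq S * S => rcons k.1 k.2)); split.
- by move=> [v s] [/= vn _]; rewrite /words/= size_rcons vn.
- by move=> [v s] [v' s'] _ _ /= /rcons_inj[-> ->].
- by case/lastP => [//|v s]; rewrite /words/= size_rcons => -[vn]; exists (v, s).
Qed.

End word_sums.

(** * Masses of words under an invariant measure *)

Section invariant_measures.
Context (R : realType) (theta : {itv R & `]0, 1[}) (S : countType) (t : rel S)
  (ne : admissible t !=set0).
Local Notation X := (markov_shift theta ne).
Local Notation T := (@left_shift R theta S t ne).
Local Notation cyl := (@word_cylinder R theta S t ne).
Implicit Types (x y : X) (u v w : seq S) (n : nat).
Variable mu : probability X R.

Definition pr w : R := fine (mu (cyl w)).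

Lemma prE w : mu (cyl w) = (pr w)%:E.
Proof. by rewrite fineK// fin_num_measure//; exact: measurable_cyl. Qed.

Lemma pr_ge0 w : (0 <= pr w)%R.
Proof. by rewrite -lee_fin -prE. Qed.

Lemma pr_le1 w : (pr w <= 1)%R.
Proof. by rewrite -lee_fin -prE probability_le1//; exact: measurable_cyl. Qed.

Lemma pr_nil : pr [::] = 1%R.
Proof.
apply: EFin_inj; rewrite -prE (_ : cyl _ = setT) ?probability_setT//.
by apply/seteqP; split.
Qed.

Lemma pr_gt0 w : (0 < pr w)%R -> cyl w !=set0.
Proof.
move=> w0; apply/set0P/negP => /eqP E; move: w0.
by rewrite /pr E measure0/= ltxx.
Qed.

Lemma pr_eq0 w : ~ (cyl w !=set0) -> pr w = 0%R.
Proof.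
move=> wne; apply/eqP; rewrite eq_le pr_ge0 andbT leNgt; apply/negP.
by move=> /pr_gt0/wne.
Qed.

Lemma measure_words n (A : set X) : measurable A ->
  mu A = \esum_(w in words S n) mu (A `&` cyl w).
Proof.
move=> mA; rewrite (measure_discrete (p := prefix_word n) mu (measurable_prefix n) mA).
rewrite [RHS]esum_mkcond; apply: eq_esum => w _; case: ifPn => [|].
  by rewrite inE /words/= => <-.
rewrite notin_setE => wn; rewrite (_ : _ `&` _ = set0) ?measure0//.
by apply/seteqP; split=> // x [_ /= xw]; apply: wn; rewrite /words/= -xw size_prefix_word.
Qed.

Lemma integral_words n (F : seq S -> R) : (forall w, (0 <= F w)%R) ->
  \int[mu]_x (F (prefix_word n x))%:E =
  \esum_(w in words S n) (F w * pr w)%:E.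
Proof.
move=> F0; rewrite (integral_discrete (p := prefix_word n) mu (measurable_prefix n))//.
rewrite [RHS]esum_mkcond; apply: eq_esum => w _; rewrite setTI; case: ifPn => [|].
  by rewrite inE /words/= => <-; rewrite EFinM -prE.
rewrite notin_setE => wn; rewrite (_ : _ @^-1` _ = set0) ?measure0 ?mule0//.
by apply/seteqP; split=> // x /= xw; apply: wn; rewrite /words/= -xw size_prefix_word.
Qed.

Lemma esum_pr n : \esum_(w in words S n) (pr w)%:E = 1.
Proof.
rewrite -[RHS](probability_setT mu) (measure_words n measurableT).
by apply: eq_esum => w _; rewrite setTI prE.
Qed.

Lemma esum_pr_cst n (c : R) : (0 <= c)%R ->
  \esum_(w in words S n) (pr w * c)%:E = c%:E.
Proof.
move=> c0; rewrite -[RHS]mule1 -(esum_pr n) -esumZl// => [|w _]; last first.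
  by rewrite lee_fin pr_ge0.
by apply: eq_esum => w _; rewrite -EFinM mulrC.
Qed.

Lemma esum_pr_suffix n u : \esum_(v in words S n) (pr (u ++ v))%:E = (pr u)%:E.
Proof.
rewrite -prE (measure_words (size u + n) (measurable_cyl u)).
rewrite [RHS](esumID [set w | take (size u) w = u])//.
rewrite [X in _ + X]esum1 ?adde0 => [|w [wn /= wu]]; last first.
  rewrite (_ : _ `&` _ = set0) ?measure0//; apply/seteqP; split=> // x [xu xw].
  apply: wu; move: xu xw; rewrite /word_cylinder/= wn => xu <-.
  by rewrite take_prefix// leq_addr.
rewrite [RHS](reindex_esum (words S n) _ (cat u)).
  apply: eq_esum => v _; rewrite -prE; congr (mu _); apply/seteqP.
  split=> x; first by move=> xuv; split=> //; exact: (proj1 (proj1 (cyl_cat _ _ _) xuv)).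
  by case.
split.
- by move=> v; rewrite /words/= size_cat take_size_cat// => ->.
- by move=> v w _ _ /eqP; rewrite eqseq_cat// => /andP[_ /eqP].
- move=> w [/= wn wu]; exists (drop (size u) w) => /=; last first.
    by rewrite -{1}wu cat_take_drop.
  by rewrite /words/= size_drop wn addKn.
Qed.

Lemma esum_pr_rcons w : \esum_(s in setT) (pr (rcons w s))%:E = (pr w)%:E.
Proof.
have := esum_pr_suffix 1 w; rewrite esum_words_cons => [|v _];
  last by rewrite lee_fin pr_ge0.
rewrite esum_words0 => [|]; last by apply: esum_ge0 => s _; rewrite lee_fin pr_ge0.
by under eq_esum do rewrite cats1.
Qed.

Lemma pr_cat_lel u v : (pr (u ++ v) <= pr u)%R.
Proof.
rewrite -lee_fin -!prE le_measure ?inE//; [exact: measurable_cyl..|].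
by move=> x /cyl_cat[].
Qed.

Hypothesis muT : shift_invariant mu.

Lemma measure_iter_shift n B : measurable B -> mu (iter n T @^-1` B) = mu B.
Proof.
elim: n B => [//|n IH] B mB.
rewrite (_ : _ @^-1` B = iter n T @^-1` (T @^-1` B))//.
rewrite IH ?muT//; rewrite -[X in measurable X]setTI.
exact: measurable_shift.
Qed.

Lemma pr_cat_ler u v : (pr (u ++ v) <= pr v)%R.
Proof.
rewrite -lee_fin -!prE -(measure_iter_shift (size u) (measurable_cyl v)).
rewrite le_measure ?inE//; first exact: measurable_cyl.
  rewrite -[X in measurable X]setTI; apply: measurable_iter_shift => //.
  exact: measurable_cyl.
by move=> x /cyl_cat[].
Qed.

(** Extension to the left rests on invariance: the cylinders of the words [u ++ v] partition the
    n-th preimage of the cylinder of v. *)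
Lemma esum_pr_prefix n v : \esum_(u in words S n) (pr (u ++ v))%:E = (pr v)%:E.
Proof.
rewrite -prE -(measure_iter_shift n (measurable_cyl v)) (measure_words n); last first.
  rewrite -[X in measurable X]setTI; apply: measurable_iter_shift => //.
  exact: measurable_cyl.
apply: eq_esum => u un; rewrite -prE; congr (mu _); rewrite -un.
by apply/seteqP; split=> x; [move=> /cyl_cat[]|case=> ? ?; apply/cyl_cat].
Qed.

Lemma esum_pr_cons v : \esum_(s in setT) (pr (s :: v))%:E = (pr v)%:E.
Proof.
have := esum_pr_prefix 1 v; rewrite esum_words_cons => [|w _];
  last by rewrite lee_fin pr_ge0.
by rewrite esum_words0// ; apply: esum_ge0 => s _; rewrite lee_fin pr_ge0.
Qed.

Lemma ge0_integral_iter_shift n (f : X -> \bar R) : measurable_fun setT f ->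
  (forall x, 0 <= f x) -> \int[mu]_x f (iter n T x) = \int[mu]_x f x.
Proof.
move=> mf f0; have mT := @measurable_iter_shift R theta S t ne n.
have := @ge0_integral_pushforward _ _ _ _ R _ mT mu setT f measurableT mf (in1W f0).
rewrite preimage_setT => <-; apply: eq_measure_integral => A mA _.
by rewrite /= /pushforward measure_iter_shift.
Qed.

Lemma integral_iter_shift n (f : X -> \bar R) : mu.-integrable setT f ->
  \int[mu]_x f (iter n T x) = \int[mu]_x f x.
Proof.
move=> fi; have mf : measurable_fun setT f by case/integrableP: fi.
rewrite integralE [RHS]integralE; congr (_ - _).
  by rewrite -(ge0_integral_iter_shift n (measurable_funepos mf) (funepos_ge0 f));
    apply: eq_integral => x _; rewrite !funeposE.
by rewrite -(ge0_integral_iter_shift n (measurable_funeneg mf) (funeneg_ge0 f));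
  apply: eq_integral => x _; rewrite !funenegE.
Qed.

Lemma integrable_iter_shift n (f : X -> \bar R) : mu.-integrable setT f ->
  mu.-integrable setT (fun x => f (iter n T x)).
Proof.
move=> /integrableP[mf fi]; apply/integrableP; split.
  exact: measurableT_comp mf (@measurable_iter_shift R theta S t ne n).
rewrite (@ge0_integral_iter_shift n (fun x => `|f x|))//.
exact: measurableT_comp.
Qed.

End invariant_measures.

(** * Splicing of admissible words, periodic points *)

Section splice.
Context (R : realType) (theta : {itv R & `]0, 1[}) (S : countType) (t : rel S)
  (ne : admissible t !=set0).
Local Notation X := (markov_shift theta ne).
Local Notation T := (@left_shift R theta S t ne).
Local Notation cyl := (@word_cylinder R theta S t ne).
Implicit Types (x y z : X) (u v w : seq S) (n : nat).

Definition spliced n x y i := if (i < n)%N then x i else y (i - n)%N.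

Lemma spliced_admissible n x y : x n = y 0%N -> admissible t (spliced n x y).
Proof.
move=> xy i; rewrite /spliced; have [i1n|] := ltnP i.+1 n.
  by rewrite (ltnW i1n); exact: coordsP.
rewrite leq_eqVlt => /predU1P[ni|]; last first.
  by rewrite ltnS => ni; rewrite ltnNge ni/= subSn//; exact: coordsP.
by rewrite ni subnn ltnSn -xy ni; exact: coordsP.
Qed.

Lemma splice n x y : x n = y 0%N ->
  exists z, prefix_word n z = prefix_word n x /\ iter n T z = y.
Proof.
move=> xy; exists (MarkovShift theta ne (spliced_admissible xy)); split.
  by apply/eq_prefixP => i ni /=; rewrite /spliced ni.
apply: coords_inj => i; rewrite iter_shiftE /= /spliced.
by rewrite ltnNge leq_addr/= addKn.
Qed.

(** The Markov property: admissibility only concerns adjacent letters, so an overlap of one letter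
    is enough to glue. *)
Lemma splice_adm u s w : cyl (rcons u s) !=set0 -> cyl (s :: w) !=set0 ->
  cyl (rcons u s ++ w) !=set0.
Proof.
rewrite -cats1 => -[x /cyl_cat[xu xs]] [y ysw].
have [z [zx zy]] : exists z, prefix_word (size u) z = prefix_word (size u) x /\
    iter (size u) T z = y.
  apply: splice; move: xs ysw => /cyl_cons[+ _] /cyl_cons[-> _].
  by rewrite iter_shiftE addn0.
exists z; rewrite -catA; apply/cyl_cat; rewrite zy/=; split => //.
by rewrite /word_cylinder/= zx.
Qed.

(** The point repeats [s :: w] forever; the final s in the hypothesis makes the transition at the
    wrap-around admissible. *)
Lemma periodic_point w s : cyl (rcons (s :: w) s) !=set0 ->
  exists x, iter (size w).+1 T x = x /\ cyl (s :: w) x.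
Proof.
move=> [y]; rewrite -cats1 => /cyl_cat[yw].
set n := size (s :: w) => /cyl_cons[]; rewrite iter_shiftE addn0 => yn _.
have n0 : (0 < n)%N by [].
have y0 : y 0%N = s by move/cyl_cons: yw => [].
have fP : admissible t (fun i => y (i %% n)%N).
  move=> i; have [E|E] := eqVneq (i %% n).+1 n.
    by rewrite -addn1 -modnDml addn1 E modnn y0 -yn -[in y n]E; exact: coordsP.
  rewrite -addn1 -modnDml addn1 (@modn_small (i %% n).+1); first exact: coordsP.
  by rewrite ltn_neqAle E ltn_pmod.
exists (MarkovShift theta ne fP); split.
  by apply: coords_inj => i; rewrite iter_shiftE/= modnDl.
rewrite /word_cylinder/= -[RHS]yw; apply/eq_prefixP => i ni /=; by rewrite modn_small.
Qed.

End splice.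

Lemma seq_uniform_pos (R : realType) (T : eqType) (F : seq T) (f : T -> R) :
  (forall b, b \in F -> 0 < f b)%R ->
  exists2 e : R, (0 < e)%R & forall b, b \in F -> (e <= f b)%R.
Proof.
elim: F => [|a F IH] f0; first by exists 1%R.
have [|e e0 He] := IH; first by move=> b bF; apply: f0; rewrite inE bF orbT.
exists (Num.min e (f a)); first by rewrite lt_min e0 f0// mem_head.
by move=> b; rewrite inE => /predU1P[->|/He]; rewrite ge_min ?lexx ?orbT// => ->.
Qed.

Lemma seq_uniform_nat (T : eqType) (F : seq T) (f : T -> nat) :
  exists N, forall b, b \in F -> (f b <= N)%N.
Proof.
exists (\max_(b <- F) f b) => b bF.
by rewrite (big_rem b)//= leq_maxl.
Qed.

(** * Gibbs measures *)

Definition gibbs_bounds (R : realType) (theta : {itv R & `]0, 1[}) (S : countType)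
    (t : rel S) (ne : admissible t !=set0) (phi : markov_shift theta ne -> R)
    (m : probability (markov_shift theta ne) R) (C P : R) :=
  forall n (a : n.-tuple S) x, (1 <= n)%N -> cylinder a x ->
    (C^-1 <= fine (m (cylinder a)) / expR (birkhoff phi n x - n%:R * P) <= C)%R.

Section gibbs_measures.
Context (R : realType) (theta : {itv R & `]0, 1[}) (S : countType) (t : rel S)
  (ne : admissible t !=set0).
Local Notation X := (markov_shift theta ne).
Local Notation T := (@left_shift R theta S t ne).
Local Notation cyl := (@word_cylinder R theta S t ne).
Implicit Types (x y z : X) (u v w : seq S) (n : nat).
Variables (phi : X -> R) (m : probability X R) (C P : R).
Hypothesis Hmix : topologically_mixing theta ne.
Hypothesis mT : shift_invariant m.
Hypothesis C0 : (0 < C)%R.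
Hypothesis Hg : gibbs_bounds phi m C P.
Local Notation M := (pr m).

Local Open Scope ring_scope.

Definition weight n x : R := expR (birkhoff phi n x - n%:R * P).
Local Notation E := weight.

Lemma weight_gt0 n x : 0 < E n x. Proof. exact: expR_gt0. Qed.

Lemma birkhoffD n k x :
  birkhoff phi (n + k) x = birkhoff phi n x + birkhoff phi k (iter n T x).
Proof.
rewrite /birkhoff big_split_ord/=; congr (_ + _); apply: eq_bigr => i _.
by rewrite addnC iterD.
Qed.

Lemma weightD n k x : E (n + k) x = E n x * E k (iter n T x).
Proof. by rewrite /E -expRD birkhoffD natrD; congr expR; ring. Qed.

Lemma weight0 x : E 0 x = 1.
Proof. by rewrite /E /birkhoff big_ord0 mul0r subr0 expR0. Qed.

Lemma weight1 x : E 1 x = expR (phi x - P).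
Proof. by rewrite /E /birkhoff big_ord1 mul1r. Qed.

Lemma gibbs_word1 w x : w != [::] -> cyl w x ->
  C^-1 * E (size w) x <= M w <= C * E (size w) x.
Proof.
move=> w0 wx; have sw0 : (1 <= size w)%N by case: (w) w0.
have := @Hg _ (in_tuple w) x sw0; rewrite cylinderE => /(_ wx).
by rewrite ler_pdivlMr ?expR_gt0// ler_pdivrMr ?expR_gt0.
Qed.

Lemma gibbs_const_ge1 : 1 <= C.
Proof.
pose x : X := point.
have := @gibbs_word1 (prefix_word 1 x) x isT (cyl_prefix _ _).
move=> /andP[/le_trans h/h]; rewrite ler_pM2r ?weight_gt0//.
have [//|C1] := leP 1 C; move=> CC; exfalso.
have : 1 < C^-1 by rewrite invf_gt1.
by move=> /lt_le_trans/(_ CC); rewrite ltNge ltW.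
Qed.

(** The Gibbs property only speaks of words of positive length; [1 <= C] extends it to the empty
    word. *)
Lemma gibbs_word w x : cyl w x ->
  C^-1 * E (size w) x <= M w <= C * E (size w) x.
Proof.
have [->|w0] := eqVneq w [::]; last exact: gibbs_word1.
move=> _; rewrite pr_nil weight0 !mulr1 gibbs_const_ge1 andbT.
by rewrite invf_le1// gibbs_const_ge1.
Qed.

Lemma weight_le w x : cyl w x -> E (size w) x <= C * M w.
Proof. by move=> /gibbs_word/andP[+ _]; rewrite ler_pdivrMl. Qed.

Lemma pr_le_weight w x : cyl w x -> M w <= C * E (size w) x.
Proof. by move=> /gibbs_word/andP[]. Qed.

Lemma gibbs_gt0 w : cyl w !=set0 -> 0 < M w.
Proof.
move=> [x wx]; have /andP[+ _] := gibbs_word wx; apply: lt_le_trans.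
by rewrite mulr_gt0 ?invr_gt0 ?weight_gt0.
Qed.

(** With [gibbs_cat_ge], the quasi-Bernoulli property. Weights multiply along orbits, and passing
    between mass and weight costs a factor C for each of the words u, v and [u ++ v]. *)
Lemma gibbs_cat_le u v : M (u ++ v) <= C ^+ 3 * (M u * M v).
Proof.
have [/pr_gt0[x xuv]|] := ltP 0 (M (u ++ v)); last first.
  by move=> /le_trans; apply; rewrite !mulr_ge0 ?exprn_ge0 ?pr_ge0 ?ltW.
have [xu xv] := proj1 (cyl_cat _ _ _) xuv.
apply: le_trans (pr_le_weight xuv) _; rewrite size_cat weightD.
have := weight_le xu; have := weight_le xv.
have := weight_gt0 (size u) x; have := weight_gt0 (size v) (iter (size u) T x).
set a := E _ _; set b := E _ _ => a0 b0 ha hb.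
rewrite (_ : C ^+ 3 * _ = C * ((C * M u) * (C * M v))); last by ring.
by rewrite ler_pM2l// ler_pM// ltW.
Qed.

Lemma gibbs_cat_ge u v : cyl (u ++ v) !=set0 ->
  M u * M v <= C ^+ 3 * M (u ++ v).
Proof.
move=> [x xuv]; have [xu xv] := proj1 (cyl_cat _ _ _) xuv.
have := weight_le xuv; rewrite size_cat weightD.
have := pr_le_weight xu; have := pr_le_weight xv.
have := weight_gt0 (size u) x; have := weight_gt0 (size v) (iter (size u) T x).
set a := E _ _; set b := E _ _ => a0 b0 ha hb hab.
rewrite (_ : C ^+ 3 * _ = C * C * (C * M (u ++ v))); last by ring.
apply: (@le_trans _ _ ((C * b) * (C * a))).
  by rewrite ler_pM ?pr_ge0.
rewrite (_ : _ * _ = C * C * (b * a)); last by ring.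
by rewrite ler_pM2l// mulr_gt0.
Qed.

Lemma adm_cat_suffix u v : cyl (u ++ v) !=set0 -> cyl v !=set0.
Proof. by move=> [x /cyl_cat[_ ?]]; eexists; eassumption. Qed.

Lemma adm_cat_prefix u v : cyl (u ++ v) !=set0 -> cyl u !=set0.
Proof. by move=> [x /cyl_cat[? _]]; eexists; eassumption. Qed.

(* The big preimages property: quasi-Bernoulli bounds force the states that
   may precede a given word to have total mass at least [C ^- 3]. *)
Lemma finite_preimages : exists F : seq S, forall w, cyl w !=set0 ->
  exists s, s \in F /\ cyl (s :: w) !=set0.
Proof.
have C3 : 0 < (C ^+ 3)^-1 by rewrite invr_gt0 exprn_gt0.
(* A finite set of letters of mass above [1 - C^-3] meets every set of letters of mass at least
   [C^-3]. *)
have /ereal_sup_gt[_ [A [finA _]] <-] :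
    ((1 - (C ^+ 3)^-1)%R%:E < \esum_(s in [set: S]) (M [:: s])%:E)%E.
  by rewrite (esum_pr_cons mT) pr_nil lte_fin gtrBl.
move=> hA; have /finite_seqP[F FA] := finA; exists F => w wne.
apply: contrapT => hF.
have: ((M w)%:E <= \esum_(s in ~` A) ((C ^+ 3 * M w)%:E * (M [:: s])%:E))%E.
  rewrite -(esum_pr_cons mT) [leRHS]esum_mkcond; apply: le_esum => s _.
  case: ifPn => [_|]; first by rewrite -EFinM lee_fin (le_trans (gibbs_cat_le [:: s]
    w))// [leRHS]mulrAC -[leRHS]mulrA.
  rewrite in_setC negbK => sA; rewrite lee_fin leNgt; apply/negP => /pr_gt0 sw.
  by apply: hF; exists s; split=> //; move: sA; rewrite FA inE.
apply/negP; rewrite -ltNge esumZl ?mulr_ge0 ?exprn_ge0 ?pr_ge0 ?ltW//; last first.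
  by move=> s _; rewrite lee_fin pr_ge0.
have M0 := gibbs_gt0 wne.
have : (\esum_(s in ~` A) (M [:: s])%:E < (C ^+ 3)^-1%:E)%E.
  have : (\esum_(s in [set: S]) (M [:: s])%:E = 1)%E by rewrite (esum_pr_cons mT) pr_nil.
  rewrite (esumID A) => [|s _]; last by rewrite lee_fin pr_ge0.
  rewrite setTI setTI => E1; move: hA; rewrite -esum_fset//; last first.
    by move=> s _; rewrite lee_fin pr_ge0.
  move: E1; case: (esum A _) => [a||]//; case: (esum _ _) => [b||]//.
  by move=> [<-]; rewrite !lte_fin; lra.
rewrite -(@lte_pmul2l _ (C ^+ 3 * M w)%:E)// ?lte_fin ?mulr_gt0 ?exprn_gt0//.
rewrite -EFinM (_ : C ^+ 3 * M w / C ^+ 3 = M w)//.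
by field; rewrite gt_eqF.
Qed.

(** Some letter b of the finite list F may precede w, and mixing joins u0 to every such b by a word
    of the prescribed length. Only finitely many joining words occur, so their masses have a
    positive minimum e; gluing one of them to w costs the factor [C^3]. *)
Lemma minorization u0 : cyl u0 !=set0 ->
  exists N0, forall N, (N0 <= N)%N -> exists2 d, 0 < d &
    forall w, cyl w !=set0 -> exists u,
      [/\ size u = N, take (size u0) u = u0 & d * M w <= M (u ++ w)].
Proof.
move=> u0ne; have [F HF] := finite_preimages.
have /choice[f Hf] : forall b, exists Nb, cyl [:: b] !=set0 ->
    forall n, (Nb <= n)%N -> cyl u0 `&` (iter n T @^-1` cyl [:: b]) !=set0.
  move=> b; have [bne|] := pselect (cyl [:: b] !=set0); last by exists 0%N.
  by have [Nb ?] := Hmix (open_cyl (w := u0)) (open_cyl (w := [:: b])) u0ne bne;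
    exists Nb.
have [N1 HN1] := seq_uniform_nat F f.
(* One letter is reserved for b. The other N exceed the mixing times of the letters of F and leave
   room for u0 as a prefix. *)
exists (N1 + size u0).+1 => -[//|N]; rewrite ltnS => HN.
have /choice[g Hg'] : forall b, exists u, b \in F -> cyl [:: b] !=set0 ->
    [/\ size u = N, cyl (rcons u b) !=set0 & take (size u0) u = u0].
  move=> b; have [[bF bne]|h] := pselect (b \in F /\ cyl [:: b] !=set0); last first.
    by exists [::] => bF bne; exfalso; apply: h.
  have [x [xu0 xb]] := Hf b bne N (leq_trans (HN1 b bF) (leq_trans (leq_addr _ _) HN)).
  exists (prefix_word N x) => _ _; split; first exact: size_prefix_word.
    by exists x; rewrite -cats1; apply/cyl_cat; split;
      [exact: cyl_prefix|rewrite size_prefix_word].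
  by rewrite take_prefix ?(leq_trans (leq_addl _ _) HN).
(* Letters with an empty cylinder are discarded, as only the others come with a joining word of
   positive mass. *)
pose F' := [seq b <- F | `[< cyl [:: b] !=set0 >]].
have [e e0 He] : exists2 e : R, 0 < e & forall b, b \in F' -> e <= M (rcons (g b) b).
  apply: seq_uniform_pos => b; rewrite mem_filter => /andP[/asboolP bne bF].
  by apply: gibbs_gt0; case: (Hg' b bF bne).
exists (e / C ^+ 3); first by rewrite divr_gt0 ?exprn_gt0.
move=> w wne; have [b [bF bw]] := HF w wne.
have bne : cyl [:: b] !=set0 by exact: (@adm_cat_prefix [:: b] w).
have [gN gne g0] := Hg' b bF bne.
exists (rcons (g b) b); split; first by rewrite size_rcons gN.
  by rewrite -cats1 takel_cat// gN (leq_trans (leq_addl _ _) HN).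
rewrite mulrAC ler_pdivrMr ?exprn_gt0// [leRHS]mulrC.
apply: le_trans (gibbs_cat_ge (splice_adm gne bw)).
by rewrite ler_wpM2r ?pr_ge0// He// mem_filter bF andbT; apply/asboolP.
Qed.

End gibbs_measures.

Lemma subset_esum (R : realType) (I : choiceType) (A B : set I) (a : I -> \bar R) :
  A `<=` B -> \esum_(i in A) a i <= \esum_(i in B) a i.
Proof.
move=> AB; apply: ereal_sup_le => _ [X [finX XA] <-]; exists X => //.
by split=> //; exact: subset_trans AB.
Qed.

(** * Pressure *)

Section pressure.
Context (R : realType) (theta : {itv R & `]0, 1[}) (S : countType) (t : rel S)
  (ne : admissible t !=set0).
Local Notation X := (markov_shift theta ne).
Local Notation T := (@left_shift R theta S t ne).
Local Notation cyl := (@word_cylinder R theta S t ne).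
Implicit Types (x y z : X) (u v w : seq S) (n : nat).

Lemma periodic_mod n x i : iter n T x = x -> x (i + n)%N = x i.
Proof. by move=> nx; rewrite addnC -iter_shiftE nx. Qed.

Lemma periodic_inj n x y : (0 < n)%N -> iter n T x = x -> iter n T y = y ->
  prefix_word n x = prefix_word n y -> x = y.
Proof.
move=> n0 nx ny /eq_prefixP xy; apply: coords_inj => i.
have mod z : iter n T z = z -> z i = z (i %% n)%N.
  move=> nz; rewrite {1}(divn_eq i n) addnC.
  elim: (i %/ n)%N => [|k IH]; first by rewrite mul0n addn0.
  by rewrite mulSn [(n + _)%N]addnC addnA periodic_mod.
by rewrite (mod x)// (mod y)// xy// ltn_pmod.
Qed.

Variables (phi : X -> R) (m : probability X R) (C P : R).
Hypothesis Hmix : topologically_mixing theta ne.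
Hypothesis mT : shift_invariant m.
Hypothesis C0 : (0 < C)%R.
Hypothesis Hg : gibbs_bounds phi m C P.
Local Notation M := (pr m).
Local Notation E := (weight phi P).

Definition partition_sum s n : \bar R :=
  \esum_(x in [set x | iter n T x = x])
           (expR (birkhoff phi n x) * \1_(cylinder [tuple s]) x)%:E.

Lemma expR_birkhoff n x : expR (birkhoff phi n x) = (expR (n%:R * P) * E n x)%R.
Proof. by rewrite -expRD; congr expR; ring. Qed.

(** A point of period n is determined by its first n letters, and the masses of all words of length
    n add up to 1. *)
Lemma partition_sum_le s n : (0 < n)%N ->
  partition_sum s n <= (C * expR (n%:R * P))%:E.
Proof.
move=> n0; rewrite -[leRHS]mule1 -(esum_pr m n).
pose D := [set x : X | iter n T x = x].
apply: (@le_trans _ _ (\esum_(x in D) ((C * expR (n%:R * P))%:E * (M (prefix_word n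
  x))%:E))).
  apply: le_esum => x _; rewrite -EFinM lee_fin.
  apply: (@le_trans _ _ (expR (birkhoff phi n x))).
    by rewrite ler_piMr ?expR_ge0// indicE; case: (_ \in _).
  rewrite expR_birkhoff mulrAC [leRHS]mulrC ler_pM2l ?expR_gt0//.
  by have := weight_le C0 Hg (cyl_prefix n x); rewrite size_prefix_word.
rewrite esumZl; last 2 first.
- by rewrite mulr_ge0 ?expR_ge0// ltW.
- by move=> x _; rewrite lee_fin pr_ge0.
rewrite lee_pmul2l//; last by rewrite lte_fin mulr_gt0 ?expR_gt0.
rewrite -(esum_image D (prefix_word n) (fun w => (M w)%:E)); last first.
  by move=> x y /set_mem xD /set_mem yD; exact: periodic_inj.
by apply: subset_esum => _ [x _ <-]; exact: size_prefix_word.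
Qed.

(** For every word w of length [n - N] such that [rcons w s] is admissible, [minorization] supplies
    a word u of length N that starts with s, and repeating [u ++ w] gives a periodic point in the
    cylinder of s. Different w give different points, since w is recovered by dropping N letters; by
    invariance the masses of the words [rcons w s] add up to that of s. *)
Lemma partition_sum_ge s : cyl [:: s] !=set0 ->
  exists2 d : R, (0 < d)%R & exists n0, forall n, (n0 <= n)%N ->
    (d * expR (n%:R * P))%:E <= partition_sum s n.
Proof.
move=> sne; have [N0 /(_ _ (leqnSn _))[d d0 Hd]] := minorization Hmix mT C0 Hg sne.
set N := N0.+1 in Hd.
have Ms0 := gibbs_gt0 C0 Hg sne.
exists (C^-1 * d * M [:: s])%R; first by rewrite !mulr_gt0 ?invr_gt0.
exists N => n Nn; pose k := (n - N)%N.
pose A := [set w | size w = k /\ cyl (rcons w s) !=set0].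
have /choice[f Hf] : forall w, exists x, A w ->
    [/\ iter n T x = x, drop N (prefix_word n x) = w, x 0%N = s &
        (d * M (rcons w s) <= M (prefix_word n x))%R].
  move=> w; have [[wk wne]|] := pselect (A w); last by exists point.
  have [u [uN us uM]] := Hd _ wne.
  case: u uN us uM => [//|s' u] uN /(congr1 (head s))/= -> uM.
  have une : cyl (rcons (s :: (u ++ w)) s) !=set0.
    rewrite -cat_cons rcons_cat; apply: (@pr_gt0 _ _ _ _ _ m).
    by apply: lt_le_trans uM; rewrite mulr_gt0// (gibbs_gt0 C0 Hg wne).
  have [x [xx xw]] := periodic_point une.
  have nE : (size (u ++ w)).+1 = n by rewrite size_cat wk -addSn -[(size u).+1]/(size
    (s' :: u)) uN subnKC.
  have xE : prefix_word n x = s :: (u ++ w) by rewrite -nE; exact: xw.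
  exists x => _; split.
  - by rewrite -[in iter _ _ _]nE.
  - by rewrite xE -cat_cons drop_size_cat.
  - by move: xw => /cyl_cons[].
  - by rewrite xE (le_trans uM)// -cats1 -cat_cons catA pr_cat_lel.
apply: (@le_trans _ _ (\esum_(w in A) (C^-1 * d * expR (n%:R * P))%:E * (M (rcons w
  s))%:E)).
  rewrite esumZl; last 2 first.
  - by rewrite !mulr_ge0 ?expR_ge0// ?invr_ge0 ltW.
  - by move=> w _; rewrite lee_fin pr_ge0.
  rewrite mulrAC EFinM lee_pmul2l//; last by rewrite lte_fin !mulr_gt0 ?invr_gt0
    ?expR_gt0.
  rewrite -(esum_pr_prefix mT k [:: s]) (esumID [set w | cyl (rcons w s) !=set0]);
    last first.
    by move=> w _; rewrite lee_fin pr_ge0.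
  rewrite [X in _ + X]esum1 ?adde0 => [|w [_ wne]]; last first.
    by rewrite cats1 pr_eq0.
  by under eq_esum do rewrite cats1.
apply: (@le_trans _ _ (\esum_(w in A) (expR (birkhoff phi n (f w)) * \1_(cylinder [tuple
  s]) (f w))%:E)).
  apply: le_esum => w Aw; have [xx xw xs xM] := Hf w Aw.
  rewrite -EFinM lee_fin indicE mem_set ?mulr1; last first.
    by rewrite cylinderE; apply/cyl_cons.
  rewrite expR_birkhoff mulrAC [leRHS]mulrC ler_pM2r ?expR_gt0//.
  rewrite -mulrA ler_pdivrMl//; apply: le_trans xM _.
  by have := pr_le_weight C0 Hg (cyl_prefix n (f w)); rewrite size_prefix_word.
rewrite -(esum_image A f (fun x => (expR (birkhoff phi n x) * \1_(cylinder [tuple s])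
  x)%:E)).
  by apply: subset_esum => _ [w Aw <-] /=; case: (Hf w Aw).
move=> w w' /set_mem wA /set_mem wA' ff; have [_ <- _ _] := Hf w wA.
by rewrite ff; have [_ -> _ _] := Hf w' wA'.
Qed.

End pressure.

Section pressure_value.
Context (R : realType) (theta : {itv R & `]0, 1[}) (S : countType) (t : rel S)
  (ne : admissible t !=set0).
Local Notation X := (markov_shift theta ne).
Local Notation cyl := (@word_cylinder R theta S t ne).
Implicit Types (x y z : X) (u v w : seq S) (n : nat).
Variables (phi : X -> R) (m : probability X R) (C P : R).
Hypothesis Hmix : topologically_mixing theta ne.
Hypothesis mT : shift_invariant m.
Hypothesis C0 : (0 < C)%R.
Hypothesis Hg : gibbs_bounds phi m C P.
Local Notation M := (pr m).
Local Notation E := (weight phi P).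

(** The partition sums equal [expR (n%:R * P)] up to constant factors, and these disappear after
    division of the logarithm by n. *)
Lemma pressureE s : cyl [:: s] !=set0 -> pressure phi s = P%:E.
Proof.
move=> sne; have [d d0 [n0 Hd]] := partition_sum_ge Hmix mT C0 Hg sne.
rewrite /pressure; apply/cvg_lim => //.
have cst (a : R) : ((P + a * n%:R^-1)%R)%:E @[n --> \oo] --> P%:E.
  apply: cvg_EFin; first by apply: nearW.
  rewrite -[X in _ --> X]addr0 -[X in _ --> (_ + X)%R](mulr0 a).
  apply: cvgD; [exact: cvg_cst|apply: cvgMr].
  apply/(gtr0_cvgV0 (f := fun n : nat => n%:R : R)); last exact: cvgr_idn.
  by exists 1%N => // n /=; rewrite ltr0n.
apply: (@squeeze_cvge _ _ _ _ (fun n => ((P + ln d * n%:R^-1)%R)%:E) _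
  (fun n => ((P + ln C * n%:R^-1)%R)%:E)) => //.
near=> n.
have n1 : (0 < n)%N by near: n; exists 1%N.
have nn0 : (n0 <= n)%N by near: n; exists n0.
have lo := Hd n nn0; have up := partition_sum_le C0 Hg s n1.
rewrite -/(partition_sum phi s n).
move: lo up; case: (partition_sum phi s n) => [z||]//; rewrite !lee_fin => lo up.
have z0 : (0 < z)%R by apply: lt_le_trans lo; rewrite mulr_gt0 ?expR_gt0.
have n0R : (0 < n%:R :> R)%R by rewrite ltr0n.
have H a : (0 < a)%R -> (ln (a * expR (n%:R * P)) = ln a + n%:R * P)%R.
  by move=> a0; rewrite lnM ?posrE ?expR_gt0// expRK.
have E1 a : (P + a * n%:R^-1 = n%:R^-1 * (a + n%:R * P))%R.
  by field; rewrite gt_eqF.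
rewrite lne_EFin// -EFinM !lee_fin !E1 -!H//.
rewrite !ler_pM2l ?invr_gt0// !ler_ln ?posrE ?mulr_gt0 ?expR_gt0//.
by rewrite lo.
Unshelve. all: by end_near. Qed.

(** The prefixes of two distinct points yield two different words of length N, each of which takes
    at least a share d of [M w] when put before w. The word v differs from one of the two, so that
    share is lost to it. *)
Lemma pr_contraction : (exists x y, x <> y) -> exists N, exists2 d : R,
  (0 < d)%R & forall v w, size v = N -> (M (v ++ w) <= (1 - d) * M w)%R.
Proof.
move=> [x [y xy]].
have [r xyr] : exists r, prefix_word r x <> prefix_word r y.
  apply: contrapT => h; apply: xy; apply: coords_inj => i.
  apply: contrapT => xyi; apply: h; exists i.+1 => /eq_prefixP/(_ i (ltnSn i)).
  exact: xyi.
have [N0 HN0] := minorization Hmix mT C0 Hg (ex_intro _ x (cyl_prefix r x)).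
have [N1 HN1] := minorization Hmix mT C0 Hg (ex_intro _ y (cyl_prefix r y)).
pose N := maxn N0 N1; exists N.
have [d d0 Hd] := HN0 N (leq_maxl _ _); have [e e0 He] := HN1 N (leq_maxr _ _).
exists (Num.min d e); first by rewrite lt_min d0.
move=> v w vN; have [Mw|] := ltP 0%R (M w); last first.
  move=> Mw; have -> : M w = 0%R by apply/eqP; rewrite eq_le Mw pr_ge0.
  by rewrite mulr0 (le_trans (pr_cat_ler mT v w)).
have wne := pr_gt0 Mw.
have [u [uv uN uM]] : exists u, [/\ v <> u, size u = N & (Num.min d e * M w <= M (u ++
  w))%R].
  have [u [uN ur uM]] := Hd w wne; have [u' [uN' ur' uM']] := He w wne.
  have [vu|vu] := eqVneq v u; last first.
    exists u; split=> //; first exact/eqP.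
    by rewrite (le_trans _ uM)// ler_pM2r// ge_min lexx.
  exists u'; split=> //; last by rewrite (le_trans _ uM')// ler_pM2r// ge_min lexx orbT.
  rewrite vu => uu'; apply: xyr; move: ur ur'; rewrite uu' !size_prefix_word.
  by move=> <-.
rewrite mulrBl mul1r lerBrDr (le_trans (lerD (lexx _) uM))//.
rewrite -lee_fin -(esum_pr_prefix mT N w) EFinD (esumID [set v]) => [|s _];
  last by rewrite lee_fin pr_ge0.
rewrite (_ : words S N `&` [set v] = [set v]); last first.
  by apply/seteqP; split=> z; [case|move=> ->].
rewrite esum_set1; last by rewrite lee_fin pr_ge0.
apply: leeD2l; apply: (@esum_ge1 _ _ _ (fun w0 => (M (w0 ++ w))%:E)).
  by split=> //= /esym.
by move=> s _; rewrite lee_fin pr_ge0.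
Qed.

Lemma pr_small (e : R) : (exists x y, x <> y) -> (0 < e)%R ->
  exists2 n, (0 < n)%N & forall w, size w = n -> (M w <= e)%R.
Proof.
move=> xy e0; have [N [d d0 Hd]] := pr_contraction xy.
have [[k ke] Mk] : (exists k, (1 - d) ^+ k <= e)%R /\
    forall k w, size w = (k * N)%N -> (M w <= (1 - d) ^+ k)%R.
  have d1 : (0 <= 1 - d)%R.
    have [x _] := xy; have := Hd (prefix_word N x) [::].
    rewrite size_prefix_word cats0 pr_nil mulr1 => /(_ erefl).
    by apply: le_trans; rewrite pr_ge0.
  split.
    have /cvgrPdist_le/(_ e e0)[k _] : ((1 - d) ^+ n : R)%R @[n --> \oo] --> (0 : R)%R.
      by apply: cvg_expr; rewrite ger0_norm// ltrBlDr ltrDl.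
    move=> /(_ k (leqnn k)) /=; rewrite sub0r normrN ger0_norm ?exprn_ge0// => ?.
    by exists k.
  elim=> [|k IH] w wk; first by rewrite pr_le1.
  rewrite -(cat_take_drop N w) (le_trans (Hd _ _ _))//.
    by rewrite size_takel// wk mulSn leq_addr.
  by rewrite exprS ler_wpM2l// IH// size_drop wk mulSn addKn.
(* A positive length is wanted. If [k * N] is 0, the bound for the empty word reads
   [1 <= (1 - d) ^+ k], hence [1 <= e], and length 1 will do. *)
have [kN0|] := posnP (k * N)%N; last by move=> kN;
  exists (k * N)%N => // w /Mk/le_trans->.
exists 1%N => // w w1; apply: (le_trans _ ke); apply: le_trans (Mk k [::] _).
  by rewrite pr_nil pr_le1.
by rewrite kN0.
Qed.

End pressure_value.

(** * Regularity and integrability of observables *)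

Section regularity.
Context (R : realType) (theta : {itv R & `]0, 1[}) (S : countType) (t : rel S)
  (ne : admissible t !=set0).
Local Notation X := (markov_shift theta ne).
Implicit Types (x y z : X) (u v w : seq S) (n : nat).
Implicit Types (phi f : X -> R).

Lemma cyl_variation_le phi n (v : R) x y : cyl_variation phi n <= v%:E ->
  prefix_word n x = prefix_word n y -> (`|phi x - phi y| <= v)%R.
Proof.
move=> nv xy; have H x' y' : prefix_word n x' = prefix_word n y' ->
    (phi x' - phi y' <= v)%R.
  move=> /eq_prefixP xy'; rewrite -lee_fin; apply: le_trans nv.
  by apply: ereal_sup_ubound; exists x', y'.
by rewrite ler_norml H// andbT lerNl opprB H.
Qed.

Lemma cyl_variation_ge0 phi n : 0 <= cyl_variation phi n.
Proof.
apply: ereal_sup_ubound; exists point, point; split => //.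
by rewrite subrr.
Qed.

Lemma exists_theta_lt (e : R) : (0 < e)%R -> exists n, (theta%:num ^+ n < e)%R.
Proof.
move=> e0.
have /cvgrPdist_lt/(_ e e0)[n _] : (theta%:num ^+ n : R)%R @[n --> \oo] --> (0 : R)%R.
  by apply: cvg_expr; rewrite ger0_norm.
move=> /(_ n (leqnn n)) /=; rewrite sub0r normrN ger0_norm ?exprn_ge0// => ?.
by exists n.
Qed.

Lemma locally_Holder_continuous phi : locally_Holder phi -> continuous phi.
Proof.
move=> [A [A0 HA]] x B /nbhs_ballP[e /= e0 eB].
have [n ne'] := @exists_theta_lt (e / A) (divr_gt0 e0 A0).
apply: (@nbhs_prefix R theta S t ne n.+1) => y yx; apply: eB => /=.
rewrite /ball/=; apply: le_lt_trans (cyl_variation_le (HA n.+1 isT) (esym yx)) _.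
rewrite mulrC -ltr_pdivlMr//; apply: le_lt_trans ne'.
by apply: ler_wiXn2l => //; exact: ltW.
Qed.

(** One number L serves as a bound for f and for its Lipschitz constant. Positivity of n is required
    because [theta_norm] only compares points with the same first letter. *)
Lemma in_L_bounds f : in_L f -> exists L : R, [/\ L_norm f = L%:E,
  forall x, (`|f x| <= L)%R &
  forall n x y, (0 < n)%N -> prefix_word n x = prefix_word n y ->
    (`|f x - f y| <= L * theta%:num ^+ n)%R].
Proof.
move=> [_]; rewrite /L_norm.
have s0 x : `|f x|%:E <= sup_norm f by apply: ereal_sup_ubound; exists x.
have t0 : 0 <= theta_norm f by rewrite /theta_norm le_max lexx.
have p0 := le_trans (abse_ge0 (f point)%:E) (s0 point).
have := s0; have tE : forall x y, x <> y -> x 0%N = y 0%N -> (`|f x - f y| / mdist x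
  y)%:E <= theta_norm f.
  move=> x y xy xy0; rewrite /theta_norm le_max; apply/orP; right.
  by apply: ereal_sup_ubound; exists x, y.
move: t0 p0 tE; case: (theta_norm f) => [a||]//; case: (sup_norm f) => [b||]//.
rewrite !lee_fin => a0 b0 tE sE _; exists (a + b)%R; split => //.
  by move=> x; have := sE x; rewrite lee_fin => /le_trans; apply; rewrite lerDr.
move=> n x y n0 xy; have [->|nxy] := pselect (x = y).
  by rewrite subrr normr0 mulr_ge0 ?addr_ge0 ?exprn_ge0.
have xy0 : x 0%N = y 0%N by move/eq_prefixP: xy; exact.
have dxy : (0 < mdist x y)%R by rewrite mdist_gt0; apply/eqP.
have := tE x y nxy xy0; rewrite lee_fin ler_pdivrMr// => /le_trans; apply.
rewrite ler_pM ?mdist_ge0// ?lerDl//.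
exact: prefix_mdist.
Qed.

End regularity.

Section integrability.
Context (R : realType) (theta : {itv R & `]0, 1[}) (S : countType) (t : rel S)
  (ne : admissible t !=set0).
Local Notation X := (markov_shift theta ne).
Variable mu : probability X R.

Lemma bounded_continuous_integrable (f : X -> R) (L : R) : continuous f ->
  (forall x, (`|f x| <= L)%R) -> mu.-integrable setT (EFin \o f).
Proof.
move=> cf fL; apply: measurable_bounded_integrable => //.
- by rewrite (le_lt_trans (probability_le1 mu measurableT))// ltry.
- exact: continuous_measurable_real.
- exists L; split; first exact: num_real.
  by move=> K LK x _ /=; apply: le_trans (fL x) _; exact: ltW.
Qed.

Lemma integral_probability_cst (c : R) : \int[mu]_x c%:E = c%:E.
Proof.
rewrite -[RHS]mule1 -[in RHS](probability_setT mu).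
exact: integral_cst.
Qed.

(** The positive part is bounded by [Num.max K 0], so the assumption on the integral can only hold
    if the negative part has a finite integral. For the potential, [potential_le] supplies K. *)
Lemma upper_bounded_integrable (f : X -> R) (K : R) : measurable_fun setT f ->
  (forall x, (f x <= K)%R) -> - (\int[mu]_x (f x)%:E) < +oo ->
  mu.-integrable setT (EFin \o f).
Proof.
move=> mf fK; rewrite integralE => fi.
have mf' : measurable_fun setT (EFin \o f) by exact/measurable_EFinP.
have fp : \int[mu]_x (EFin \o f)^\+ x < +oo.
  apply: (@le_lt_trans _ _ (\int[mu]_x (cst (Num.max K 0)%:E x))).
    apply: ge0_le_integral => //; first exact: measurable_funepos.
    by move=> x _; rewrite funeposE -EFin_max lee_fin ge_max !le_max fK lexx orbT.
  rewrite integral_cst//; apply: (@le_lt_trans _ _ ((Num.max K 0)%:E * 1));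
    last by rewrite mule1 ltry.
  by apply: lee_wpmul2l; [rewrite lee_fin le_max lexx orbT|exact: probability_le1].
have fp0 : 0 <= \int[mu]_x (EFin \o f)^\+ x by apply: integral_ge0.
have fn0 : 0 <= \int[mu]_x (EFin \o f)^\- x by apply: integral_ge0.
have fn : \int[mu]_x (EFin \o f)^\- x < +oo.
  have : - (\int[mu]_x (EFin \o f)^\+ x - \int[mu]_x (EFin \o f)^\- x) < +oo by [].
  move: fp fp0 fn0; set a := (\int[mu]_x _); set b := (\int[mu]_x _).
  by case: a => [a||]//; case: b => [b||]// *; rewrite ltry.
apply/integrableP; split => //.
rewrite (eq_integral (fun x => (EFin \o f)^\+ x + (EFin \o f)^\- x)); last first.
  by move=> x _; rewrite -[LHS]/((abse \o (EFin \o f)) x) fune_abse.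
rewrite ge0_integralD//; [|exact: measurable_funepos|exact: measurable_funeneg].
by rewrite lte_add_pinfty.
Qed.

End integrability.

(** * Partitions into words, and the gap between P and mu(phi) *)

Section pressure_gap.
Context (R : realType) (theta : {itv R & `]0, 1[}) (S : countType) (t : rel S)
  (ne : admissible t !=set0).
Local Notation X := (markov_shift theta ne).
Local Notation T := (@left_shift R theta S t ne).
Local Notation cyl := (@word_cylinder R theta S t ne).
Implicit Types (x y z : X) (u v w : seq S) (n : nat).

Lemma iterated_join_words n :
  iterated_join (principal theta ne) n = [set cyl w | w in words S n].
Proof.
(* Generalized to joins that start at time i, because splitting off the first factor shifts the
   remaining times by one. *)
suff H i : \big[@partition_join R theta S t ne/[set setT]]_(j < n)
    [set iter (i + j) T @^-1` B | B in principal theta ne] =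
    [set iter i T @^-1` cyl w | w in words S n].
  by have := H 0%N; rewrite /iterated_join.
elim: n i => [|n IH] i.
  rewrite big_ord0; apply/seteqP; split=> [_ ->|_ [w /size0nil -> <-]].
    by exists [::] => //; apply/seteqP; split.
  by apply/seteqP; split.
rewrite big_ord_recl; under eq_bigr do rewrite addnS -addSn.
rewrite IH addn0; apply/seteqP; split.
  move=> _ [_ [_ [s _ <-] <-] [_ [w wn <-] <-]].
  exists (s :: w); first by rewrite /words/= wn.
  rewrite cylinderE; apply/seteqP; split=> x.
    by move=> /cyl_cons[xs xw]; split => //; apply/cyl_cons.
  by move=> [/cyl_cons[xs _] xw]; apply/cyl_cons.
move=> _ [[//|s w] [wn] <-].
exists (iter i T @^-1` cyl [:: s]); first by exists (cyl [:: s]) => //; exists s;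
  rewrite ?cylinderE.
exists (iter i.+1 T @^-1` cyl w); first by exists w.
apply/seteqP; split=> x.
  by move=> [/cyl_cons[xs _] xw]; apply/cyl_cons.
by move=> /cyl_cons[xs xw]; split => //; apply/cyl_cons.
Qed.

Lemma cond_entropy_refine (mu : probability X R) n : (0 < n)%N ->
  cond_entropy mu (principal theta ne) (iterated_join (principal theta ne) n) = 0.
Proof.
case: n => // n _; rewrite /cond_entropy iterated_join_words.
rewrite esum1// => _ [[//|s' w] wn <-]; rewrite esum1// => _ [s _ <-].
rewrite cylinderE; have [ss|ss] := eqVneq s s'.
  rewrite (_ : _ `&` _ = cyl (s' :: w)); last first.
    by apply/setIidPr => x /cyl_cons[xs _]; apply/cyl_cons; rewrite ss.
  rewrite prE; have [->|w0] := eqVneq (pr mu (s' :: w)) 0%R; first by rewrite mul0e oppe0.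
  by rewrite inver (negbTE w0) -EFinM divff// lne1 mule0 oppe0.
rewrite (_ : _ `&` _ = set0) ?measure0 ?mul0e ?oppe0//; apply/seteqP; split=> // x.
by move=> [/cyl_cons[xs _] /cyl_cons[xs' _]]; move: ss; rewrite -xs -xs' eqxx.
Qed.

Variables (phi : X -> R) (m : probability X R) (C P : R).
Hypothesis Hmix : topologically_mixing theta ne.
Hypothesis mT : shift_invariant m.
Hypothesis C0 : (0 < C)%R.
Hypothesis Hg : gibbs_bounds phi m C P.
Local Notation M := (pr m).
Local Notation E := (weight phi P).

Lemma potential_le x : (phi x <= P + ln C)%R.
Proof.
rewrite addrC -lerBlDr -ler_expR lnK ?posrE//.
have := weight_le C0 Hg (cyl_prefix 1 x); rewrite size_prefix_word weight1.
by move/le_trans; apply; rewrite ler_piMr ?pr_le1// ltW.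
Qed.

Lemma birkhoff_integrable (mu : probability X R) n : shift_invariant mu ->
  mu.-integrable setT (EFin \o phi) ->
  mu.-integrable setT (EFin \o birkhoff phi n) /\
  \int[mu]_x (birkhoff phi n x)%:E = n%:R%:E * \int[mu]_x (phi x)%:E.
Proof.
move=> muT phiI; elim: n => [|n [IH1 IH2]].
  rewrite mul0e (_ : birkhoff phi 0 = cst 0%R); last first.
    by apply/funext => x; rewrite /birkhoff big_ord0.
  split; first exact: finite_measure_integrable_cst.
  exact: integral0.
have sI := integrable_iter_shift muT n phiI.
have bE x : (birkhoff phi n.+1 x)%:E = (birkhoff phi n x)%:E + (EFin \o phi) (iter n T x).
  by rewrite -EFinD /= -addn1 birkhoffD /birkhoff big_ord1.
split.
  apply: eq_integrable (integrableD measurableT IH1 sI) => //.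
  by move=> x _ /=; rewrite bE.
under eq_integral do rewrite bE.
rewrite integralD// IH2 (integral_iter_shift muT n phiI).
by rewrite -natr1 EFinD ge0_muleDl ?mul1e// lee_fin.
Qed.

Lemma pressure_gap : (exists x y, x <> y) -> exists2 c : R, (0 < c)%R &
  forall mu : probability X R, shift_invariant mu ->
    mu.-integrable setT (EFin \o phi) -> \int[mu]_x (phi x)%:E <= (P - c)%:E.
Proof.
(* The factor C is spent on passing from mass to weight; the factor e turns the bound on the weight
   into the term -1 of [bx]. *)
move=> xy; have e0 : (0 < (C * expR 1)^-1)%R by rewrite invr_gt0 mulr_gt0 ?expR_gt0.
have [n n0 Hn] := pr_small Hmix mT C0 Hg xy e0.
have nR0 : (0 < n%:R :> R)%R by rewrite ltr0n.
exists (n%:R^-1)%R; first by rewrite invr_gt0.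
move=> mu muT phiI; have [bI bE] := birkhoff_integrable n muT phiI.
have bx x : (birkhoff phi n x <= n%:R * P - 1)%R.
  have := weight_le C0 Hg (cyl_prefix n x); rewrite size_prefix_word.
  have := Hn _ (size_prefix_word n x); rewrite /weight => h1 h2.
  have : (expR (birkhoff phi n x - n%:R * P) <= expR (- 1))%R.
    apply: le_trans h2 _; rewrite expRN -ler_pdivlMl//.
    by apply: le_trans h1 _; rewrite invfM.
  by rewrite ler_expR lerBlDr addrC.
have : \int[mu]_x (birkhoff phi n x)%:E <= (n%:R * P - 1)%:E.
  rewrite -[leRHS](integral_probability_cst mu).
  apply: le_integral => //; first exact: finite_measure_integrable_cst.
  by move=> x _; rewrite lee_fin.
have fI : \int[mu]_x (phi x)%:E \is a fin_num := integrable_fin_num measurableT phiI.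
rewrite bE -(fineK fI); move: (fine _) => r.
rewrite -EFinM !lee_fin => h.
by rewrite -(ler_pM2l nR0) mulrBr divff// gt_eqF.
Qed.

End pressure_gap.

(** * Transition probabilities *)

Section transition_function.
Context (R : realType) (theta : {itv R & `]0, 1[}) (S : countType) (t : rel S)
  (ne : admissible t !=set0).
Local Notation X := (markov_shift theta ne).
Local Notation T := (@left_shift R theta S t ne).
Local Notation cyl := (@word_cylinder R theta S t ne).
Implicit Types (x y : X) (u v w z : seq S) (n : nat).
Variables (phi : X -> R) (m : probability X R) (C P : R).
Hypothesis mT : shift_invariant m.
Hypothesis C0 : (0 < C)%R.
Hypothesis Hg : gibbs_bounds phi m C P.
Variable r : nat.
Hypothesis r0 : (0 < r)%N.
Hypothesis Hr : forall x y, prefix_word r x = prefix_word r y -> phi x = phi y.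
Local Notation M := (pr m).
Local Notation E := (weight phi P).
Local Open Scope ring_scope.

(* The default value [point] is returned when the cylinder is empty. *)
Definition cyl_point w : X := xget point (cyl w).
Local Notation pt := cyl_point.

Lemma cyl_pointP w : cyl w !=set0 -> cyl w (pt w).
Proof. by move=> [x wx]; rewrite /pt; case: xgetP => // /(_ x). Qed.

Lemma weight_local n x y : prefix_word (n + r) x = prefix_word (n + r) y ->
  E n x = E n y.
Proof.
move=> /eq_prefixP xy; rewrite /weight.
suff -> : birkhoff phi n x = birkhoff phi n y by [].
apply: eq_bigr => i _; apply: Hr; apply/eq_prefixP => k kr.
rewrite !iter_shiftE; apply: xy; have := ltn_ord i; lia.
Qed.

Lemma weight_cyl n w x y : (n + r <= size w)%N -> cyl w x -> cyl w y -> E n x = E n y.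
Proof.
move=> nw xw yw; apply: weight_local.
by rewrite -(take_prefix x nw) -(take_prefix y nw)
  (_ : prefix_word _ x = w)// (_ : prefix_word _ y = w).
Qed.

(* Invariance of [m] makes this density exactly harmonic for the transfer
   operator of [phi - P] (see [tail_density_cons]), and the Gibbs property
   keeps it between [C ^- 2] and [C ^+ 2]. *)
Definition tail_density z :=
  M z / (M (drop (size z - r) z) * E (size z - r) (pt z)).
Local Notation D := tail_density.

(** The Gibbs bounds are used for z and for its last r letters; the weights of these letters cancel,
    which leaves one factor C for each use. *)
Lemma tail_density_bound z : cyl z !=set0 -> (r <= size z)%N ->
  (C ^+ 2)^-1 <= D z <= C ^+ 2.
Proof.
move=> zne rz; rewrite /D; set n := (size z - r)%N.
have zx := cyl_pointP zne; set x := pt z in zx *.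
have nz : (n <= size z)%N by rewrite leq_subr.
have sd : size (drop n z) = r by rewrite size_drop subKn.
have [_ dx] : cyl (take n z) x /\ cyl (drop n z) (iter n T x).
  by have := proj1 (cyl_cat (take n z) (drop n z) x);
    rewrite cat_take_drop size_takel// => /(_ zx).
have := pr_le_weight C0 Hg zx; have := weight_le C0 Hg zx.
rewrite -[X in E X x](subnK rz) -/n weightD.
have := pr_le_weight C0 Hg dx; have := weight_le C0 Hg dx; rewrite sd.
have d0 := gibbs_gt0 C0 Hg (ex_intro _ _ dx).
have := weight_gt0 phi P n x; move: d0.
set a := E n x; set b := E r _; set d := M (drop n z); set c := M z.
move=> d0 a0 bd db abc cab; have ad0 : 0 < d * a by rewrite mulr_gt0.
rewrite ler_pdivlMr// ler_pdivrMr// ler_pdivrMl ?exprn_gt0//; apply/andP; split.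
  apply: (@le_trans _ _ (C * (a * b))).
    by rewrite (_ : C * (a * b) = C * b * a) ?ler_pM2r//; ring.
  by rewrite (_ : C ^+ 2 * c = C * (C * c)) ?ler_pM2l//; ring.
apply: le_trans cab _; rewrite (_ : C ^+ 2 * _ = C * (a * (C * d))); last by ring.
by rewrite !ler_pM2l.
Qed.

Lemma tail_density_gt0 z : cyl z !=set0 -> (r <= size z)%N -> 0 < D z.
Proof.
move=> zne rz; have /andP[+ _] := tail_density_bound zne rz.
by apply: lt_le_trans; rewrite invr_gt0 exprn_gt0.
Qed.

(** The words z and [s :: z] end with the same r letters, so only the weight of one step is new.
    Summed over s, the masses of [s :: z] give [M z]: this is harmonicity. *)
Lemma tail_density_cons s z : cyl (s :: z) !=set0 -> (r <= size z)%N ->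
  E 1 (pt (s :: z)) * D (s :: z) = M (s :: z) / M z * D z.
Proof.
move=> szne rz; have zne : cyl z !=set0 by exact: (@adm_cat_suffix _ _ _ _ _ [:: s] z).
have [_ xz] := proj1 (cyl_cons _ _ _) (cyl_pointP szne).
have M0 := gibbs_gt0 C0 Hg zne.
rewrite /D /= subSn//= -[(size z - r).+1]add1n weightD.
rewrite (@weight_cyl _ z _ (pt z) _ xz (cyl_pointP zne)) ?subnK//.
have := weight_gt0 phi P (size z - r) (pt z); have := weight_gt0 phi P 1 (pt (s :: z)).
have dne : cyl (drop (size z - r) z) !=set0.
  by apply: (@adm_cat_suffix _ _ _ _ _ (take (size z - r) z)); rewrite cat_take_drop.
have := gibbs_gt0 C0 Hg dne.
move: (E _ _) (E _ _) (M (drop _ _)) => a b c c0 b0 a0.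
by field; rewrite !gt_eqF.
Qed.

Lemma adm_cons_head s v z : cyl (s :: v) !=set0 -> cyl z !=set0 ->
  (0 < size v)%N -> (0 < size z)%N -> take 1 v = take 1 z -> cyl (s :: z) !=set0.
Proof.
case: v => [//|a v] sv; case: z => [//|b z] zne _ _ /(congr1 (head s))/= ab.
rewrite -ab in zne *.
have H := @splice_adm R theta S t ne [:: s] a z; apply: H => //.
exact: (@adm_cat_prefix _ _ _ _ _ [:: s; a] v).
Qed.

Lemma take_r_head v z : (r <= size v)%N -> (r <= size z)%N ->
  take r v = take r z -> take 1 v = take 1 z.
Proof.
by move=> rv rz /(congr1 (take 1)); rewrite !take_takel.
Qed.

Lemma adm_cons_take s v z : cyl (s :: v) !=set0 -> cyl z !=set0 ->
  (r <= size v)%N -> (r <= size z)%N -> take r v = take r z -> cyl (s :: z) !=set0.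
Proof.
move=> sv zne rv rz vz; apply: (adm_cons_head sv zne);
  [exact: leq_trans rv|exact: leq_trans rz|exact: take_r_head].
Qed.

Lemma weight1_take v z : cyl v !=set0 -> cyl z !=set0 -> (r <= size v)%N ->
  (r <= size z)%N -> take r v = take r z -> E 1 (pt v) = E 1 (pt z).
Proof.
move=> vne zne rv rz vz; rewrite !weight1.
suff -> : phi (pt v) = phi (pt z) by []; apply: Hr.
rewrite -(take_prefix (pt v) rv) -(take_prefix (pt z) rz).
have := cyl_pointP vne; have := cyl_pointP zne.
by rewrite /word_cylinder/= => -> ->.
Qed.

Definition same_block v : set (seq S) :=
  [set z | [/\ cyl z !=set0, (r <= size z)%N & take r z = take r v]].

(* The infimum makes a superharmonic function of the first [r] letters out of
   the exactly harmonic [tail_density], which depends on the whole word. *)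
Definition eigenfunction v : R := inf [set D z | z in same_block v].
Local Notation h := eigenfunction.

Lemma same_block_refl v : cyl v !=set0 -> (r <= size v)%N -> same_block v v.
Proof. by move=> vne rv; split. Qed.

Lemma same_block_lb v : lbound [set D z | z in same_block v] (C ^+ 2)^-1.
Proof. by move=> _ [z [zne rz _] <-]; have /andP[] := tail_density_bound zne rz. Qed.

Lemma eigenfunction_le v z : same_block v z -> h v <= D z.
Proof.
move=> vz; apply: ge_inf; last by exists z.
by exists (C ^+ 2)^-1; exact: same_block_lb.
Qed.

Lemma eigenfunction_bound v : cyl v !=set0 -> (r <= size v)%N ->
  (C ^+ 2)^-1 <= h v <= C ^+ 2.
Proof.
move=> vne rv; apply/andP; split.
  apply: lb_le_inf; last exact: same_block_lb.
  by exists (D v), v => //; exact: same_block_refl.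
apply: le_trans (eigenfunction_le (same_block_refl vne rv)) _.
by have /andP[] := tail_density_bound vne rv.
Qed.

Lemma eigenfunction_gt0 v : cyl v !=set0 -> (r <= size v)%N -> 0 < h v.
Proof.
move=> vne rv; have /andP[+ _] := eigenfunction_bound vne rv.
by apply: lt_le_trans; rewrite invr_gt0 exprn_gt0.
Qed.

Lemma eigenfunction_take v z : take r v = take r z -> h v = h z.
Proof. by move=> vz; rewrite /h /same_block vz. Qed.

(** For each z in the block of v, replacing [h (s :: v)] by the larger [D (s :: z)] turns the sum
    into at most [D z], by harmonicity of the density. The infimum over z gives [h v]. *)
Lemma eigenfunction_superharmonic v : cyl v !=set0 -> (r <= size v)%N ->
  (\esum_(s in [set s | cyl (s :: v) !=set0]) (E 1 (pt (s :: v)) * h (s :: v))%:E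
    <= (h v)%:E)%E.
Proof.
move=> vne rv; set A := [set s | _].
have H z : same_block v z ->
  (\esum_(s in A) (E 1 (pt (s :: v)) * h (s :: v))%:E <= (D z)%:E)%E.
  move=> [zne rz zv]; have Mz := gibbs_gt0 C0 Hg zne.
  have Dz := tail_density_gt0 zne rz; have DM : 0 <= D z / M z by apply: divr_ge0;
    exact: ltW.
  apply: (@le_trans _ _ (\esum_(s in [set: S]) ((D z / M z)%:E * (M (s :: z))%:E)%E));
    last first.
    rewrite esumZl// => [|s _]; last by rewrite lee_fin pr_ge0.
    by rewrite esum_pr_cons// -EFinM lee_fin mulfVK// gt_eqF.
  rewrite [leLHS]esum_mkcond; apply: le_esum => s _; case: ifPn => [|_]; last first.
    by rewrite -EFinM lee_fin mulr_ge0 ?pr_ge0.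
  rewrite inE => sv; have sz := adm_cons_take sv zne rv rz (esym zv).
  have sE : take r (s :: v) = take r (s :: z).
    by case: (r) r0 zv => [//|k] _; rewrite /= => zv; congr (_ :: _);
      rewrite -(take_takel v (leqnSn k)) -(take_takel z (leqnSn k)) zv.
  rewrite (weight1_take sv sz) ?leqW// -EFinM lee_fin.
  apply: (@le_trans _ _ (E 1 (pt (s :: z)) * D (s :: z))).
    rewrite ler_pM2l ?weight_gt0// eigenfunction_le//.
    by split => //; rewrite ?leqW.
  by rewrite tail_density_cons// (_ : _ * D z = D z / M z * M (s :: z))//; ring.
have : (0%E <= \esum_(s in A) (E 1 (pt (s :: v)) * h (s :: v))%:E)%E.
  apply: esum_ge0 => s sv; rewrite lee_fin mulr_ge0 ?(ltW (weight_gt0 _ _ _ _))//.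
  by rewrite ltW// eigenfunction_gt0// leqW.
move: H; case: (\esum_(s in A) _)%E => [c||]//; last first.
  by move=> /(_ v (same_block_refl vne rv)).
move=> H _; rewrite lee_fin; apply: lb_le_inf.
  by exists (D v), v => //; exact: same_block_refl.
by move=> _ [z vz <-]; rewrite -lee_fin; exact: H.
Qed.

(* Written as a quotient of [kappa], the products of transition probabilities
   along a word telescope; on inadmissible words both are 0. *)
Definition kappa w : R := M w * h w / D w.
Definition transition w : R := kappa w / kappa (behead w).
Local Notation g := transition.

Lemma kappa_gt0 w : cyl w !=set0 -> (r <= size w)%N -> 0 < kappa w.
Proof.
move=> wne rw; apply: divr_gt0; last exact: tail_density_gt0.
by apply: mulr_gt0; [exact: (gibbs_gt0 C0 Hg)|exact: eigenfunction_gt0].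
Qed.

Lemma transition_nadm w : ~ (cyl w !=set0) -> g w = 0.
Proof. by move=> wne; rewrite /g /kappa pr_eq0// !mul0r. Qed.

Lemma transition_gt0 s v : cyl (s :: v) !=set0 -> (r <= size v)%N -> 0 < g (s :: v).
Proof.
move=> sv rv; rewrite divr_gt0 ?kappa_gt0// ?leqW//=.
exact: (@adm_cat_suffix _ _ _ _ _ [:: s] v).
Qed.

(** In this form g visibly depends on s and on the first r letters of v only, which
    [transition_take] records. *)
Lemma transitionE s v : cyl (s :: v) !=set0 -> (r <= size v)%N ->
  g (s :: v) = E 1 (pt (s :: v)) * h (s :: v) / h v.
Proof.
move=> sv rv; have vne : cyl v !=set0 by exact: (@adm_cat_suffix _ _ _ _ _ [:: s] v).
have := tail_density_cons sv rv; have := tail_density_gt0 vne rv.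
have := tail_density_gt0 sv (leqW rv); have := eigenfunction_gt0 vne rv.
have := gibbs_gt0 C0 Hg vne; rewrite /g /kappa /=.
move: (E _ _) (D (s :: v)) (D v) (M (s :: v)) (M v) (h (s :: v)) (h v) => e d1 d2 c1 c2
  k1 k2.
move=> c20 k20 d10 d20 ed.
have -> : e = c1 / c2 * d2 / d1 by rewrite -ed mulfK// gt_eqF.
by field; rewrite !gt_eqF.
Qed.

Lemma transition_ge0 s v : (r <= size v)%N -> 0 <= g (s :: v).
Proof.
move=> rv; have [sv|sv] := pselect (cyl (s :: v) !=set0).
  by rewrite ltW// transition_gt0.
by rewrite transition_nadm.
Qed.

Lemma transition_take s v z : cyl v !=set0 -> cyl z !=set0 ->
  (r <= size v)%N -> (r <= size z)%N -> take r v = take r z ->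
  g (s :: v) = g (s :: z).
Proof.
move=> vne zne rv rz vz.
have [sv|sv] := pselect (cyl (s :: v) !=set0); last first.
  rewrite !transition_nadm// => sz; apply: sv.
  by apply: (adm_cons_take sz) => //; rewrite vz.
have sz := adm_cons_take sv zne rv rz vz.
have sE : take r (s :: v) = take r (s :: z).
  by case: (r) r0 vz => [//|k] _; rewrite /= => vz; congr (_ :: _);
    rewrite -(take_takel v (leqnSn k)) -(take_takel z (leqnSn k)) vz.
by rewrite !transitionE// (weight1_take sv sz) ?leqW// (eigenfunction_take sE)
  (eigenfunction_take vz).
Qed.

(** Superharmonicity divided by [h v]; [esum_transition] improves it to an equality. *)
Lemma esum_transition_le1 v : cyl v !=set0 -> (r <= size v)%N ->
  (\esum_(s in [set: S]) (g (s :: v))%:E <= 1)%E.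
Proof.
move=> vne rv; have hv := eigenfunction_gt0 vne rv.
rewrite (esumID [set s | cyl (s :: v) !=set0]) => [|s _]; last first.
  by rewrite lee_fin transition_ge0.
rewrite setTI setTI [X in (_ + X)%E]esum1 ?adde0 => [|s /= sv]; last first.
  by rewrite transition_nadm.
apply: (@le_trans _ _ (\esum_(s in [set s | cyl (s :: v) !=set0])
    ((h v)^-1%:E * (E 1 (pt (s :: v)) * h (s :: v))%:E))%E).
  by apply: le_esum => s sv; rewrite transitionE// -EFinM mulrC.
rewrite esumZl ?invr_ge0 ?(ltW hv)// => [|s sv]; last first.
  rewrite lee_fin mulr_ge0 ?(ltW (weight_gt0 _ _ _ _))//.
  by rewrite ltW// eigenfunction_gt0// leqW.
apply: (@le_trans _ _ ((h v)^-1%:E * (h v)%:E)%E).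
  by apply: lee_wpmul2l; [rewrite lee_fin invr_ge0 ltW|exact:
    eigenfunction_superharmonic].
by rewrite -EFinM mulVf ?gt_eqF.
Qed.

Lemma transition_le1 s v : (r <= size v)%N -> g (s :: v) <= 1.
Proof.
move=> rv; have [sv|sv] := pselect (cyl (s :: v) !=set0); last by rewrite transition_nadm.
have vne : cyl v !=set0 by exact: (@adm_cat_suffix _ _ _ _ _ [:: s] v).
rewrite -lee_fin; apply: le_trans (esum_transition_le1 vne rv).
apply: (@esum_ge1 _ _ _ (fun s => (g (s :: v))%:E)) => // s' _.
by rewrite lee_fin transition_ge0.
Qed.

End transition_function.

(** * Relative entropy *)

Section kullback_leibler.
Context (R : realType).
Implicit Types p q : R.
Local Open Scope ring_scope.

(** The added [- p + q] makes every single term nonnegative, as sums over a countable alphabet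
    demand; it cancels in the sum of two laws of equal mass. *)
Definition kl p q : R := p * ln (p / q) - p + q.

(** This is [ln x <= x - 1] at x = sqrt (q / p), multiplied by -2p. *)
Lemma kl_ge_hellinger p q : 0 <= p -> 0 <= q -> (0 < p -> 0 < q) ->
  (Num.sqrt p - Num.sqrt q) ^+ 2 <= kl p q.
Proof.
move=> p0 q0 pq; have [p_gt0|] := ltP 0 p; last first.
  move=> p_le0; have -> : p = 0 by apply/eqP; rewrite eq_le p_le0.
  by rewrite sqrtr0 sub0r sqrrN sqr_sqrtr// /kl mul0r oppr0 !add0r.
have q_gt0 := pq p_gt0.
have := sqr_sqrtr p0; have := sqr_sqrtr q0.
have : 0 < Num.sqrt p by rewrite sqrtr_gt0.
have : 0 < Num.sqrt q by rewrite sqrtr_gt0.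
move: (Num.sqrt p) (Num.sqrt q) => a b b0 a0 bq ap.
have ba0 : 0 < b / a by rewrite divr_gt0.
have lnba : ln (b / a) <= b / a - 1.
  have := @le_ln1Dx R (b / a - 1); rewrite (_ : 1 + (b / a - 1) = b / a); last by ring.
  apply.
  by rewrite ltrBrDl subrr.
have lnE : ln (p / q) = - (ln (b / a) *+ 2).
  by rewrite -ap -bq -expr_div_n -lnXn// -lnV ?posrE ?exprn_gt0// -exprVn invf_div.
have H : - (2 * (a * b)) + 2 * p <= p * ln (p / q).
  rewrite lnE (_ : - _ + _ = p * - ((b / a - 1) *+ 2)); last first.
    by rewrite -ap; field; rewrite gt_eqF.
  by rewrite ler_pM2l// lerN2 lerMn2r.
by rewrite /kl; move: H; rewrite sqrrB ap bq mulr_natl => H; lra.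
Qed.

Lemma kl_ge0 p q : 0 <= p -> 0 <= q -> (0 < p -> 0 < q) -> 0 <= kl p q.
Proof. by move=> p0 q0 pq; apply: le_trans (kl_ge_hellinger p0 q0 pq);
  exact: sqr_ge0. Qed.

(** Factor |p - q| as |sqrt p - sqrt q| (sqrt p + sqrt q) and split the product with weight e. For
    fixed e the bound is linear in [kl p q], p and q, so it can be summed over words before e is
    optimized. *)
Lemma kl_pinsker p q e : 0 < e -> 0 <= p -> 0 <= q -> (0 < p -> 0 < q) ->
  `|p - q| <= kl p q / (2 * e) + e * (p + q).
Proof.
move=> e0 p0 q0 pq; have := kl_ge_hellinger p0 q0 pq.
have := sqr_sqrtr p0; have := sqr_sqrtr q0.
have := sqrtr_ge0 p; have := sqrtr_ge0 q.
move: (Num.sqrt p) (Num.sqrt q) => a b b0 a0 bq ap abk.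
have -> : `|p - q| = `|a - b| * (a + b).
  by rewrite -ap -bq subr_sqr normrM (ger0_norm (addr_ge0 a0 b0)).
have -> : p + q = a ^+ 2 + b ^+ 2 by rewrite ap bq.
have -> : kl p q / (2 * e) + e * (a ^+ 2 + b ^+ 2) =
    (kl p q + 2 * e ^+ 2 * (a ^+ 2 + b ^+ 2)) / (2 * e).
  by field; rewrite gt_eqF.
rewrite ler_pdivlMr ?mulr_gt0//.
move: abk; rewrite -real_normK ?num_real// => abk.
have := sqr_ge0 (`|a - b| - e * (a + b)); have := sqr_ge0 (e * (a - b)).
move: (`|_|) abk => c abk; nra.
Qed.

(* Optimizes the free parameter of [kl_pinsker]. *)
Lemma sqrt_optimize (a o d : R) : 0 <= o -> 0 <= d ->
  (forall e, 0 < e -> a <= o * (d / (2 * e) + 2 * e)) -> a <= 2 * o * Num.sqrt d.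
Proof.
move=> o0; rewrite le_eqVlt => /predU1P[<- H|d0 /(_ (Num.sqrt d / 2))]; last first.
  rewrite divr_gt0 ?sqrtr_gt0// => /(_ isT) /le_trans; apply.
  have s0 : 0 < Num.sqrt d by rewrite sqrtr_gt0.
  rewrite -{1}(sqr_sqrtr (ltW d0)); move: (Num.sqrt d) s0 => s s0.
  rewrite (_ : _ * _ = 2 * o * s)//; field; rewrite gt_eqF//.
rewrite sqrtr0 mulr0; apply/ler_addgt0Pl => e e0; rewrite addr0.
have h : 0 < e / (2 * (o + 1)) by rewrite divr_gt0// mulr_gt0// ltr_wpDl.
have o1 : 0 < o + 1 by rewrite ltr_wpDl.
apply: le_trans (H _ h) _; rewrite mul0r add0r.
rewrite (_ : o * _ = e * o / (o + 1)); last by field; rewrite gt_eqF.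
by rewrite ler_pdivrMr// ler_pM2l// lerDl.
Qed.

End kullback_leibler.

Lemma archimed_le0 (R : realType) (c B : R) :
  (forall k : nat, (k%:R * c <= B)%R) -> (c <= 0)%R.
Proof.
move=> H; rewrite leNgt; apply/negP => c0.
have B0 : (0 <= B)%R by have := H 0%N; rewrite mul0r.
have := H (Num.bound (B / c)); apply/negP; rewrite -ltNge -ltr_pdivrMr//.
by apply: archi_boundP; rewrite divr_ge0// ltW.
Qed.

(** The arithmetic of one step of [J_step]: b and a are consecutive values of J, d is the
    divergence, q the total mass of the reference weights, and c the defect. *)
Lemma defect_le (R : realType) (a b c e : R) (d q : \bar R) : 0 <= q -> e%:E <= d ->
  q + c%:E <= 1 -> d + a%:E + 1 = b%:E + q -> (a + c + e <= b)%R.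
Proof.
case: q => [q||]//; case: d => [d||]// _.
by rewrite -EFinD !lee_fin => ed qc [E]; lra.
Qed.

Section divergence.
Context (R : realType) (theta : {itv R & `]0, 1[}) (S : countType) (t : rel S)
  (ne : admissible t !=set0).
Local Notation X := (markov_shift theta ne).
Local Notation cyl := (@word_cylinder R theta S t ne).
Implicit Types (x y : X) (u v w z : seq S) (n : nat).
Variables (phi : X -> R) (m : probability X R) (C P : R).
Hypothesis mT : shift_invariant m.
Hypothesis C0 : (0 < C)%R.
Hypothesis Hg : gibbs_bounds phi m C P.
Variable r : nat.
Hypothesis r0 : (0 < r)%N.
Hypothesis Hr : forall x y, prefix_word r x = prefix_word r y -> phi x = phi y.
Local Notation E := (weight phi P).
Local Open Scope ring_scope.
Local Notation D := (tail_density phi m P r).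
Local Notation h := (eigenfunction phi m P r).
Local Notation g := (transition phi m P r).
Local Open Scope ereal_scope.

(** The D_j of the overview. Written with [kl], it is nonnegative even while g is only known to have
    sums at most 1. *)
Definition divergence (mu : probability X R) j : \bar R :=
  \esum_(w in words S j.+1) (kl (pr mu w) (g w * pr mu (behead w)))%:E.

Lemma transition_word_ge0 w : (r < size w)%N -> (0 <= g w)%R.
Proof. by case: w => [//|s v] rv; exact: (transition_ge0 C0 Hg). Qed.

Lemma transition_word_gt0 w : cyl w !=set0 -> (r < size w)%N -> (0 < g w)%R.
Proof. by case: w => [//|s v] sv rv; exact: (transition_gt0 C0 Hg). Qed.

Lemma transition_weight_gt0 (mu : probability X R) w : shift_invariant mu ->
  (r < size w)%N -> (0 < pr mu w)%R -> (0 < g w * pr mu (behead w))%R.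
Proof.
move=> muT rw w0; have wne := pr_gt0 w0; rewrite mulr_gt0//.
  exact: transition_word_gt0.
by apply: lt_le_trans w0 _; case: (w) rw => [//|s v] _; exact: (pr_cat_ler muT [:: s] v).
Qed.

Lemma esum_transition_weight (mu : probability X R) j (F : seq S -> R) : (r <= j)%N ->
  (forall w, (0 <= F w)%R) ->
  \esum_(w in words S j.+1) (g w * pr mu (behead w) * F w)%:E =
  \esum_(v in words S j) ((pr mu v)%:E * \esum_(s in [set: S]) (g (s :: v) * F (s ::
    v))%:E).
Proof.
move=> rj F0.
pose G w := (if (r < size w)%N then g w * pr mu (behead w) * F w else 0)%R.
transitivity (\esum_(w in words S j.+1) (G w)%:E).
  by apply: eq_esum => w wj; rewrite /G wj ltnS rj.
rewrite esum_words_cons => [|w _]; last first.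
  rewrite lee_fin /G; case: ifPn => // rw.
  by rewrite mulr_ge0// mulr_ge0 ?pr_ge0// transition_word_ge0.
apply: eq_esum => v vj; rewrite -esumZl ?pr_ge0// => [|s _]; last first.
  by rewrite lee_fin mulr_ge0// transition_word_ge0// [size _]/= vj ltnS.
by apply: eq_esum => s _; rewrite /G /= vj ltnS rj -EFinM mulrAC mulrC mulrA.
Qed.

Lemma divergence_term_ge0 (mu : probability X R) w : shift_invariant mu ->
  (r < size w)%N -> (0 <= kl (pr mu w) (g w * pr mu (behead w)))%R.
Proof.
move=> muT rw; apply: kl_ge0; [exact: pr_ge0| |exact: transition_weight_gt0].
by apply: mulr_ge0; [exact: transition_word_ge0|exact: pr_ge0].
Qed.

Lemma divergence_ge0 (mu : probability X R) j : shift_invariant mu -> (r <= j)%N ->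
  0 <= divergence mu j.
Proof.
by move=> muT rj; apply: esum_ge0 => w wj; rewrite lee_fin divergence_term_ge0// wj ltnS.
Qed.

(** If the logarithm of the density is a difference of x along [behead] up to a cost y, the
    divergence telescopes, since invariance makes the sum of [x (behead w)] a sum over words of
    length j. It serves for m with x built from ln (D / h) and y = 0, and for mu with x = -ln p and
    y = -ln g. Terms are moved across the equation to keep all of them nonnegative; the 1 is the
    mass of mu. *)
Lemma divergence_telescope (mu : probability X R) j (x y : seq S -> R) :
  shift_invariant mu -> (r <= j)%N ->
  (forall w, (0 <= x w)%R) -> (forall w, (0 <= y w)%R) ->
  (forall w, size w = j.+1 -> (0 < pr mu w)%R ->
    (x w - x (behead w) - y w = ln (g w * pr mu (behead w) / pr mu w))%R) ->
  divergence mu j + \esum_(w in words S j.+1) (pr mu w * x w)%:E + 1 =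
  \esum_(v in words S j) (pr mu v * x v)%:E +
  \esum_(w in words S j.+1) (pr mu w * y w)%:E +
  \esum_(w in words S j.+1) (g w * pr mu (behead w))%:E.
Proof.
move=> muT rj x0 y0 xy.
have -> : \esum_(v in words S j) (pr mu v * x v)%:E =
    \esum_(w in words S j.+1) (pr mu w * x (behead w))%:E.
  rewrite esum_words_cons => [|w _]; last by rewrite lee_fin mulr_ge0 ?pr_ge0.
  apply: eq_esum => v vj.
  rewrite mulrC EFinM -(esum_pr_cons muT v) -esumZl// => [|s _];
    last by rewrite lee_fin pr_ge0.
  by apply: eq_esum => s _; rewrite -EFinM mulrC.
rewrite -(esum_pr mu j.+1).
have q0 w : words S j.+1 w -> (0 <= g w * pr mu (behead w))%R.
  by move=> wj; rewrite mulr_ge0 ?pr_ge0// transition_word_ge0// wj.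
have kl0 w : words S j.+1 w -> 0 <= (kl (pr mu w) (g w * pr mu (behead w)))%:E.
  by move=> wj; rewrite lee_fin divergence_term_ge0// wj.
rewrite /divergence -!esumD; do ?[by move=> w wj;
  rewrite ?adde_ge0 ?kl0 ?lee_fin ?q0 ?mulr_ge0 ?pr_ge0].
apply: eq_esum => w wj; rewrite -!EFinD; congr EFin.
have := pr_ge0 mu w; rewrite le_eqVlt => /predU1P[<-|p0].
  by rewrite /kl !mul0r; ring.
have := xy w wj p0; have rw : (r < size w)%N by rewrite wj.
have := transition_weight_gt0 muT rw p0.
move: (g w * _)%R (pr mu w) p0 => q p p0 qp0 E1.
have -> : x (behead w) = (x w - y w - ln (q / p))%R by rewrite -E1; ring.
have -> : (ln (q / p) = - ln (p / q))%R by rewrite -lnV ?posrE ?divr_gt0// invf_div.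
rewrite /kl; ring.
Qed.

(** As h is an infimum of values of D, [logratio] lies in [0, A]. Its reflection x is nonnegative
    too, and the mean J of x cannot increase with the length. *)
Let logratio w : R := ln (D w / h w).
Let A : R := ln (C ^+ 4).
Let x w : R := if pselect (cyl w !=set0 /\ (r <= size w)%N) then (A - logratio w)%R else
  0%R.
Let J j := \esum_(v in words S j) (pr m v * x v)%:E.

Let logratio_bound w : cyl w !=set0 -> (r <= size w)%N -> (0 <= logratio w <= A)%R.
Proof.
move=> wne rw; have /andP[_ D2] := tail_density_bound C0 Hg wne rw.
have /andP[h1 _] := eigenfunction_bound C0 Hg wne rw.
have hD := eigenfunction_le C0 Hg (same_block_refl wne rw).
have h0 : (0 < h w)%R by apply: lt_le_trans h1; rewrite invr_gt0 exprn_gt0.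
have D0 : (0 < D w)%R by exact: lt_le_trans hD.
rewrite /logratio; apply/andP; split.
  by apply: ln_ge0; rewrite ler_pdivlMr// mul1r.
rewrite /A ler_ln ?posrE ?exprn_gt0 ?(divr_gt0 D0 h0)//.
rewrite ler_pdivrMr//; apply: le_trans D2 _.
rewrite (_ : (C ^+ 2 = C ^+ 4 * (C ^+ 2)^-1)%R); last by field; rewrite gt_eqF.
by rewrite ler_pM2l// exprn_gt0.
Qed.

Let x_bound w : (0 <= x w <= A)%R.
Proof.
rewrite /x; case: pselect => [[wne rw]|?] /=.
  by have /andP[l0 lA] := logratio_bound wne rw; rewrite subr_ge0 lA lerBlDr lerDl.
by rewrite lexx /A ln_ge0// exprn_ege1// (gibbs_const_ge1 C0 Hg).
Qed.

Let J_bound j : 0 <= J j <= A%:E.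
Proof.
apply/andP; split.
  by apply: esum_ge0 => v _; rewrite lee_fin mulr_ge0 ?pr_ge0//;
    have /andP[] := x_bound v.
have A0 : (0 <= A)%R by have /andP[/le_trans] := x_bound [::]; exact.
rewrite -[leRHS]mule1 -(esum_pr m j) -esumZl// => [|v _]; last by rewrite lee_fin pr_ge0.
apply: le_esum => v _; rewrite -EFinM lee_fin [leRHS]mulrC ler_wpM2l ?pr_ge0//.
by have /andP[] := x_bound v.
Qed.

Let JE j : J j = (fine (J j))%:E.
Proof.
have /andP[J0 JA] := J_bound j; rewrite fineK// ge0_fin_numE//.
by rewrite (le_lt_trans JA)// ltry.
Qed.

Let J_step j : (r <= j)%N ->
  divergence m j + J j.+1 + 1 =
  J j + \esum_(w in words S j.+1) (g w * pr m (behead w))%:E.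
Proof.
move=> rj; have := @divergence_telescope m j x (fun=> 0%R) mT rj.
rewrite [X in _ = _ + X + _]esum1 => [|w _]; last by rewrite mulr0.
rewrite adde0; apply => //; first by move=> w; have /andP[] := x_bound w.
move=> [//|s v] [vj] sv0; have svne := pr_gt0 sv0; rewrite /= subr0.
have vne : cyl v !=set0 by exact: (@adm_cat_suffix _ _ _ _ _ [:: s] v).
have rv : (r <= size v)%N by rewrite vj.
rewrite /x; case: pselect => [[? ?]|[]] /=; last by split => //=; exact: leqW.
case: pselect => [[? ?]|[]] /=; last by split.
have hv := eigenfunction_gt0 C0 Hg vne rv; have Dv := tail_density_gt0 C0 Hg vne rv.
have hs := eigenfunction_gt0 C0 Hg svne (leqW rv);
  have Ds := tail_density_gt0 C0 Hg svne (leqW rv).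
have -> : (A - logratio (s :: v) - (A - logratio v) = logratio v - logratio (s :: v))%R
  by ring.
rewrite /logratio -ln_div ?posrE ?(divr_gt0 Dv hv) ?(divr_gt0 Ds hs)//; congr ln.
rewrite /transition /kappa /=; have Mv := gibbs_gt0 C0 Hg vne.
by field; rewrite !gt_eqF.
Qed.

(* Each step of [J_step] loses the defect [1 - \sum_s g (s :: v)] weighted by
   [m], whereas [J] stays in [[0, A]]: the superharmonic function is harmonic. *)
Lemma esum_transition v : cyl v !=set0 -> (r <= size v)%N ->
  \esum_(s in [set: S]) (g (s :: v))%:E = 1.
Proof.
move=> vne rv; have := esum_transition_le1 mT C0 Hg r0 Hr vne rv.
have : 0 <= \esum_(s in [set: S]) (g (s :: v))%:E.
  by apply: esum_ge0 => s _; rewrite lee_fin (transition_ge0 C0 Hg).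
set sg := esum _ _ => sg0 sg1; have sgE : (fine sg)%:E = sg.
  by rewrite fineK// ge0_fin_numE// (le_lt_trans sg1)// ltry.
have Mv := gibbs_gt0 C0 Hg vne.
rewrite -sgE in sg0 sg1 *; rewrite !lee_fin in sg0 sg1.
congr EFin; apply/eqP; rewrite eq_le sg1/= -subr_le0 -(pmulr_lle0 _ Mv).
have Q k : \esum_(w in words S (size v + k).+1) (g w * pr m (behead w))%:E +
    ((1 - fine sg) * pr m v)%:E <= 1.
  have H := @esum_transition_weight m (size v + k) (fun=> 1%R).
  under eq_esum do rewrite -[X in X%:E]mulr1.
  rewrite H ?(leq_trans rv) ?leq_addr// {H}.
  under eq_esum => w _ do under eq_esum do rewrite mulr1.
  (* Every extension of v has the same defect as v, because it has the same first r letters, and the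
     masses of the extensions add up to that of v. So the defect at v is charged in full at each
     length. *)
  pose c w : R := if take (size v) w == v then (1 - fine sg)%R else 0%R.
  have c0 w : (0 <= c w)%R by rewrite /c; case: ifP; rewrite ?subr_ge0.
  apply: (@le_trans _ _ (\esum_(w in words S (size v + k)) ((pr m w)%:E * \esum_(s in
    [set: S]) (g (s :: w))%:E) +
    \esum_(w in words S (size v + k)) (c w * pr m w)%:E)).
    rewrite leeD2l// EFinM -(esum_pr_suffix m k v) -esumZl ?subr_ge0// => [|w _];
      last by rewrite lee_fin pr_ge0.
    rewrite [leLHS](_ : _ = \esum_(w in words S k) (c (v ++ w) * pr m (v ++ w))%:E);
      last first.
      by apply: eq_esum => w _; rewrite -EFinM /c take_size_cat// eqxx.
    rewrite -(esum_image (words S k) (cat v) (fun w => (c w * pr m w)%:E)); last first.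
      by move=> w w' _ _ /eqP; rewrite eqseq_cat// => /andP[_ /eqP].
    by apply: subset_esum => _ [w wk <-]; rewrite /words/= size_cat wk.
  have g0 w s : words S (size v + k) w -> 0 <= (g (s :: w))%:E.
    by move=> wk; rewrite lee_fin (transition_ge0 C0 Hg)// wk (leq_trans rv)// leq_addr.
  rewrite -esumD; last 2 first.
  - by move=> w wk; rewrite mule_ge0 ?lee_fin ?pr_ge0//; apply: esum_ge0 => s _;
    exact: g0.
  - by move=> w wk; rewrite lee_fin mulr_ge0 ?pr_ge0.
  rewrite -(esum_pr m (size v + k)); apply: le_esum => w wk.
  have [wne|wne] := pselect (cyl w !=set0); last first.
    by rewrite (pr_eq0 _ wne) mul0e mulr0 add0e.
  rewrite mulrC EFinM -ge0_muleDr ?lee_fin//; last by apply: esum_ge0 => s _; exact: g0.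
  rewrite -[leRHS]mule1; apply: lee_wpmul2l; first by rewrite lee_fin pr_ge0.
  have rw : (r <= size w)%N by rewrite wk (leq_trans rv)// leq_addr.
  rewrite /c; case: eqP => [wv|_]; last first.
    by rewrite adde0; exact: (esum_transition_le1 mT C0 Hg r0 Hr).
  rewrite [X in X + _](_ : _ = sg); last first.
    apply: eq_esum => s _; rewrite (transition_take C0 Hg r0 Hr s wne vne)//.
    by rewrite -[in RHS]wv take_takel.
  by rewrite -sgE -EFinD addrC subrK.
have step k : J (size v + k.+1) + ((1 - fine sg) * pr m v)%:E <= J (size v + k).
  have := J_step (leq_trans rv (leq_addr k _)); have := Q k; rewrite addnS.
  have d0 := divergence_ge0 mT (leq_trans rv (leq_addr k _)).
  have q0 : 0 <= \esum_(w in words S (size v + k).+1) (g w * pr m (behead w))%:E.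
    apply: esum_ge0 => w wk; rewrite lee_fin mulr_ge0 ?pr_ge0// transition_word_ge0//.
    by rewrite wk ltnS (leq_trans rv)// leq_addr.
  rewrite JE (JE (_ + k)%N) => E1 E2; rewrite -EFinD lee_fin -[leLHS]addr0.
  exact: (@defect_le _ _ _ _ 0%R _ _ q0 d0 E1 E2).
have decr k : (fine (J (size v + k)) + k%:R * ((1 - fine sg) * pr m v) <= A)%R.
  elim: k => [|k IH]; first by rewrite mul0r addr0 -lee_fin -JE;
    have /andP[] := J_bound (size v + 0).
  apply: le_trans IH; have := step k; rewrite JE (JE (_ + k)%N) -EFinD lee_fin.
  by rewrite -natr1 mulrDl mul1r; lra.
apply: archimed_le0 => k; apply: le_trans (decr k).
rewrite lerDr fine_ge0//; by have /andP[] := J_bound (size v + k).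
Qed.

(** With sums of g equal to 1, each step of [J_step] lowers J by the divergence; divergences above e
    from j0 on would make J negative. *)
Lemma divergence_gibbs_small (e : R) j0 : (0 < e)%R -> (r <= j0)%N ->
  exists2 j, (j0 <= j)%N & divergence m j <= e%:E.
Proof.
move=> e0 rj0; apply: contrapT => H.
have {}H j : (j0 <= j)%N -> e%:E <= divergence m j.
  by move=> jj; rewrite leNgt; apply/negP => /ltW he; apply: H; exists j.
have step k : J (j0 + k.+1) + e%:E <= J (j0 + k).
  have rk : (r <= j0 + k)%N by rewrite (leq_trans rj0)// leq_addr.
  have := J_step rk; have := H _ (leq_addr k j0); rewrite addnS.
  have -> : \esum_(w in words S (j0 + k).+1) (g w * pr m (behead w))%:E = 1.
    under eq_esum do rewrite -[X in X%:E]mulr1.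
    rewrite (esum_transition_weight m rk (F := fun=> 1%R))// -(esum_pr m (j0 + k)).
    apply: eq_esum => w wk; under eq_esum do rewrite mulr1.
    have [wne|wne] := pselect (cyl w !=set0); last first.
      by rewrite (pr_eq0 _ wne) mul0e.
    by rewrite esum_transition ?mule1// wk.
  rewrite JE (JE (_ + k)%N) => E1 E2; rewrite -EFinD lee_fin -[in leLHS](addr0 (fine _)).
  by apply: defect_le lee01 E1 _ E2; rewrite adde0.
have decr k : (fine (J (j0 + k)) + k%:R * e <= A)%R.
  elim: k => [|k IH]; first by rewrite mul0r addr0 -lee_fin -JE;
    have /andP[] := J_bound (j0 + 0).
  apply: le_trans IH; have := step k; rewrite JE (JE (_ + k)%N) -EFinD lee_fin.
  by rewrite -natr1 mulrDl mul1r; lra.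
suff : (e <= 0)%R by rewrite leNgt e0.
apply: archimed_le0 => k; apply: le_trans (decr k).
rewrite lerDr fine_ge0//; by have /andP[] := J_bound (j0 + k).
Qed.

End divergence.

(** * Contraction of the transfer operator *)

Section transfer_operator.
Context (R : realType) (theta : {itv R & `]0, 1[}) (S : countType) (t : rel S)
  (ne : admissible t !=set0).
Local Notation X := (markov_shift theta ne).
Local Notation cyl := (@word_cylinder R theta S t ne).
Implicit Types (x y : X) (u v w z : seq S) (n : nat).
Variables (phi : X -> R) (m : probability X R) (C P : R).
Hypothesis mT : shift_invariant m.
Hypothesis C0 : (0 < C)%R.
Hypothesis Hg : gibbs_bounds phi m C P.
Variable r : nat.
Hypothesis r0 : (0 < r)%N.
Hypothesis Hr : forall x y, prefix_word r x = prefix_word r y -> phi x = phi y.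
Local Notation E := (weight phi P).
Local Open Scope ring_scope.
Local Notation g := (transition phi m P r).
Implicit Types (H : seq S -> R).

Definition transfer H v : R := fine (\esum_(s in [set: S]) (g (s :: v) * H (s ::
  v))%:E)%E.

Let g_ge0 s v (rv : (r <= size v)%N) : 0 <= g (s :: v) := transition_ge0 C0 Hg s rv.
Let g_sum v (vne : cyl v !=set0) (rv : (r <= size v)%N) := esum_transition mT C0 Hg r0
  Hr vne rv.

Let term_ge0 H v : (r <= size v)%N -> (forall s, cyl (s :: v) !=set0 -> 0 <= H (s :: v))
  ->
  forall s, 0 <= g (s :: v) * H (s :: v).
Proof.
move=> rv H0 s; have [sv|sv] := pselect (cyl (s :: v) !=set0).
  by rewrite mulr_ge0 ?g_ge0 ?H0.
by rewrite transition_nadm ?mul0r.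
Qed.

Lemma transferE H v K : cyl v !=set0 -> (r <= size v)%N ->
  (forall s, cyl (s :: v) !=set0 -> 0 <= H (s :: v) <= K) ->
  (\esum_(s in [set: S]) (g (s :: v) * H (s :: v))%:E = (transfer H v)%:E)%E.
Proof.
move=> vne rv HK; have t0 := @term_ge0 H v rv (fun s sv => proj1 (andP (HK s sv))).
rewrite /transfer fineK// ge0_fin_numE; last by apply: esum_ge0 => s _;
  rewrite lee_fin t0.
apply: (@le_lt_trans _ _ (`|K|%:E * \esum_(s in [set: S]) (g (s :: v))%:E)%E).
  rewrite -esumZl// => [|s _]; last by rewrite lee_fin g_ge0.
  apply: le_esum => s _; rewrite -EFinM lee_fin.
  have [sv|sv] := pselect (cyl (s :: v) !=set0); last first.
    by rewrite transition_nadm ?mul0r ?mulr0.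
  have /andP[_ HK'] := HK s sv; rewrite mulrC ler_wpM2r ?g_ge0//.
  exact: le_trans HK' (ler_norm _).
by rewrite g_sum// mule1 ltry.
Qed.

Let esum_pick s0 (c : R) : 0 <= c ->
  (\esum_(s in [set: S]) (if s == s0 then c else 0)%:E = c%:E)%E.
Proof.
move=> c0; rewrite (esumID [set s0]) => [|s _]; last by case: ifP.
rewrite setTI setTI esum_set1 eqxx ?lee_fin//.
rewrite esum1 ?adde0// => s /= /eqP ss.
by rewrite (negbTE ss).
Qed.

(** One letter s0 is singled out and the others get the crude bound b; [iterate_chain] applies this
    along the letters of a fixed word. *)
Lemma transfer_le H v a b s0 : cyl v !=set0 -> (r <= size v)%N -> 0 <= a ->
  (forall s, cyl (s :: v) !=set0 -> a <= H (s :: v) <= b) -> cyl (s0 :: v) !=set0 ->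
  transfer H v <= g (s0 :: v) * H (s0 :: v) + (1 - g (s0 :: v)) * b.
Proof.
move=> vne rv a0 Hab s0v.
have H0 s : cyl (s :: v) !=set0 -> 0 <= H (s :: v) <= b.
  by move=> /Hab/andP[aH ->]; rewrite (le_trans a0 aH).
have /andP[H00 Hb0] := H0 s0 s0v.
have c0 : 0 <= g (s0 :: v) * (b - H (s0 :: v)) by rewrite mulr_ge0 ?g_ge0 ?subr_ge0.
(* The gain at s0 is written as a nonnegative sum supported at s0, so that the two sides can be
   compared term by term. *)
suff : ((transfer H v)%:E + (g (s0 :: v) * (b - H (s0 :: v)))%:E <= b%:E)%E.
  by rewrite -EFinD lee_fin; lra.
rewrite -(transferE vne rv H0) -(esum_pick s0 c0) -[leRHS]mule1 -(g_sum vne rv).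
rewrite -esumZl ?(le_trans H00)// => [|s _]; last by rewrite lee_fin g_ge0.
rewrite -esumD; last 2 first.
- by move=> s _; rewrite lee_fin term_ge0// => s' /H0/andP[].
- by move=> s _; case: ifP.
apply: le_esum => s _; rewrite -EFinD -EFinM lee_fin; case: eqP => [->|_].
  by rewrite mulrBr addrC subrK mulrC.
rewrite addr0 mulrC; have [sv|sv] := pselect (cyl (s :: v) !=set0); last first.
  by rewrite transition_nadm// mulr0 mulr0.
by rewrite ler_wpM2r ?g_ge0//; have /andP[] := H0 s sv.
Qed.

Lemma transfer_ge H v a b s0 : cyl v !=set0 -> (r <= size v)%N -> 0 <= a ->
  (forall s, cyl (s :: v) !=set0 -> a <= H (s :: v) <= b) -> cyl (s0 :: v) !=set0 ->
  g (s0 :: v) * H (s0 :: v) + (1 - g (s0 :: v)) * a <= transfer H v.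
Proof.
move=> vne rv a0 Hab s0v.
have H0 s : cyl (s :: v) !=set0 -> 0 <= H (s :: v) <= b.
  by move=> /Hab/andP[aH ->]; rewrite (le_trans a0 aH).
have /andP[H00 _] := Hab s0 s0v.
have c0 : 0 <= g (s0 :: v) * (H (s0 :: v) - a) by rewrite mulr_ge0 ?g_ge0 ?subr_ge0.
suff : (a%:E + (g (s0 :: v) * (H (s0 :: v) - a))%:E <= (transfer H v)%:E)%E.
  by rewrite -EFinD lee_fin; lra.
rewrite -(transferE vne rv H0) -(esum_pick s0 c0) -[X in (X + _)%E]mule1 -(g_sum vne rv).
rewrite -esumZl// => [|s _]; last by rewrite lee_fin g_ge0.
rewrite -esumD; last 2 first.
- by move=> s _; rewrite mule_ge0 ?lee_fin ?g_ge0.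
- by move=> s _; case: ifP.
apply: le_esum => s _; rewrite -EFinM -EFinD lee_fin; case: eqP => [->|_].
  by rewrite mulrBr addrC [a * _]mulrC subrK.
rewrite addr0 mulrC; have [sv|sv] := pselect (cyl (s :: v) !=set0); last first.
  by rewrite transition_nadm// !mul0r.
by rewrite ler_wpM2l ?g_ge0//; have /andP[] := Hab s sv.
Qed.

Lemma transition_predecessor v : cyl v !=set0 -> (r <= size v)%N ->
  exists s, cyl (s :: v) !=set0.
Proof.
move=> vne rv; apply: contrapT => noS.
have := g_sum vne rv; rewrite esum1 => [/eqP|s _]; first by rewrite eq_sym onee_eq0.
by rewrite transition_nadm// => sv; apply: noS; exists s.
Qed.

Lemma transfer_between H v a b : cyl v !=set0 -> (r <= size v)%N -> 0 <= a ->
  (forall s, cyl (s :: v) !=set0 -> a <= H (s :: v) <= b) -> a <= transfer H v <= b.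
Proof.
move=> vne rv a0 Hab; have [s sv] := transition_predecessor vne rv.
have /andP[aH Hb] := Hab s sv; have g0 := g_ge0 s rv.
have g1 : g (s :: v) <= 1 by exact: (transition_le1 mT C0 Hg r0 Hr).
apply/andP; split.
  by apply: le_trans (transfer_ge vne rv a0 Hab sv); nra.
by apply: le_trans (transfer_le vne rv a0 Hab sv) _; nra.
Qed.

(** Both values average with the same transition probabilities, since v and v' share their first r
    letters. *)
Lemma transfer_lip H v v' K c : cyl v !=set0 -> cyl v' !=set0 ->
  (r <= size v)%N -> (r <= size v')%N -> take r v = take r v' -> 0 <= c ->
  (forall s, cyl (s :: v) !=set0 -> 0 <= H (s :: v) <= K) ->
  (forall s, cyl (s :: v') !=set0 -> 0 <= H (s :: v') <= K) ->
  (forall s, cyl (s :: v) !=set0 -> cyl (s :: v') !=set0 -> H (s :: v) <= H (s :: v') +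
    c) ->
  transfer H v <= transfer H v' + c.
Proof.
move=> vne vne' rv rv' vv' c0 HK HK' Hc; rewrite -lee_fin EFinD.
rewrite -(transferE vne rv HK) -(transferE vne' rv' HK') -[X in (_ + X)%E]mule1 -(g_sum
  vne' rv').
rewrite -esumZl// => [|s _]; last by rewrite lee_fin g_ge0.
rewrite -esumD; last 2 first.
- by move=> s _; rewrite lee_fin term_ge0// => s' /HK'/andP[].
- by move=> s _; rewrite mule_ge0 ?lee_fin ?g_ge0.
apply: le_esum => s _; rewrite -EFinM -EFinD lee_fin.
rewrite (transition_take C0 Hg r0 Hr s vne vne' rv rv' vv') [c * _]mulrC -mulrDr.
have [sv|sv] := pselect (cyl (s :: v') !=set0); last by rewrite transition_nadm// !mul0r.
rewrite ler_wpM2l ?g_ge0// Hc//.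
by apply: (adm_cons_take r0 sv) => //; rewrite vv'.
Qed.

End transfer_operator.

Section real_sums.
Context (R : realType).
Local Open Scope ring_scope.

Lemma geometric_sum_le (x : R) n : 0 <= x < 1 -> \sum_(k < n) x ^+ k <= (1 - x)^-1.
Proof.
move=> /andP[x0 x1]; rewrite -[leRHS]mul1r ler_pdivlMr ?subr_gt0//.
suff -> : (\sum_(k < n) x ^+ k) * (1 - x) = 1 - x ^+ n by rewrite gerBl exprn_ge0.
elim: n => [|n IH]; first by rewrite big_ord0 mul0r expr0 subrr.
by rewrite big_ord_recr/= mulrDl IH exprSr; ring.
Qed.

Lemma sum_blocks (e : nat -> R) N n : (0 < N)%N ->
  \sum_(i < n * N) e (i %/ N)%N = N%:R * \sum_(k < n) e k.
Proof.
move=> N0; elim: n => [|n IH]; first by rewrite mul0n !big_ord0 mulr0.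
rewrite mulSn addnC big_split_ord/= IH big_ord_recr mulrDr/=; congr (_ + _).
under eq_bigr => i _ do rewrite divnMDl// divn_small ?ltn_ord// addn0.
by rewrite sumr_const card_ord mulr_natl.
Qed.

End real_sums.

Section iterates.
Context (R : realType) (theta : {itv R & `]0, 1[}) (S : countType) (t : rel S)
  (ne : admissible t !=set0).
Local Notation X := (markov_shift theta ne).
Local Notation cyl := (@word_cylinder R theta S t ne).
Implicit Types (x y : X) (u v w z : seq S) (n : nat).
Variables (phi : X -> R) (m : probability X R) (C P : R).
Hypothesis Hmix : topologically_mixing theta ne.
Hypothesis mT : shift_invariant m.
Hypothesis C0 : (0 < C)%R.
Hypothesis Hg : gibbs_bounds phi m C P.
Variable r : nat.
Hypothesis r0 : (0 < r)%N.
Hypothesis Hr : forall x y, prefix_word r x = prefix_word r y -> phi x = phi y.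
Local Notation M := (pr m).
Local Open Scope ring_scope.
Local Notation pt := (@cyl_point R theta S t ne).
Local Notation g := (transition phi m P r).
Local Notation kap := (kappa phi m P r).
Local Notation transf := (transfer phi m P r).
Local Notation th := (theta%:num : R).

Let th0 : 0 < th. Proof. by []. Qed.
Let th1 : th < 1. Proof. by []. Qed.

Lemma kappa_bound w : cyl w !=set0 -> (r <= size w)%N ->
  (C ^+ 4)^-1 * M w <= kap w <= C ^+ 4 * M w.
Proof.
move=> wne rw; have /andP[d1 d2] := tail_density_bound C0 Hg wne rw.
have /andP[h1 h2] := eigenfunction_bound C0 Hg wne rw.
have D0 := tail_density_gt0 C0 Hg wne rw.
have h0 := eigenfunction_gt0 C0 Hg wne rw.
have C2 : 0 < C ^+ 2 by rewrite exprn_gt0.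
rewrite /kappa -mulrA [M w * _]mulrC !(mulrC _ (M w)) !ler_pM2l ?(gibbs_gt0 C0 Hg wne)//.
rewrite ler_pdivlMr// ler_pdivrMr//; apply/andP; split.
  apply: le_trans h1; rewrite (_ : (C ^+ 2)^-1 = (C ^+ 4)^-1 * C ^+ 2); last by field;
    rewrite gt_eqF.
  by rewrite ler_pM2l// invr_gt0 exprn_gt0.
apply: le_trans h2 _; rewrite [leLHS](_ : _ = C ^+ 4 * (C ^+ 2)^-1); last by field;
  rewrite gt_eqF.
by rewrite ler_pM2l// exprn_gt0.
Qed.

(** The quotient of [kappa] is the probability of prepending u to v, so this is a Doeblin condition:
    with probability at least d, N steps lead to a word whose first r letters are u0. *)
Lemma kappa_minorization : exists N (d : R) u0, [/\ (0 < N)%N, (r <= N)%N, 0 < d <= 1 &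
  forall v, cyl v !=set0 -> (r <= size v)%N -> exists u,
    [/\ size u = N, take r u = u0, cyl (u ++ v) !=set0 & d <= kap (u ++ v) / kap v]].
Proof.
pose x : X := point; pose u0 := prefix_word r x.
have [N0 /(_ (N0 + r).+1)] := minorization Hmix mT C0 Hg (ex_intro _ x (cyl_prefix r x)).
case=> [|d d0 Hd]; first by rewrite leqW// leq_addr.
have dC : 0 < d / C ^+ 8 by rewrite divr_gt0// exprn_gt0.
(* [C ^+ 8] pays for replacing M by [kappa] at v and at [u ++ v], [C ^+ 4] each; the minimum with 1
   makes d a convex weight. *)
exists (N0 + r).+1, (Num.min 1 (d / C ^+ 8)), u0; split => //.
  by rewrite leqW// leq_addl.
  by rewrite lt_min ltr01 dC ge_min lexx.
move=> v vne rv; have [u [uN ur uM]] := Hd v vne.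
have Mv := gibbs_gt0 C0 Hg vne.
have uvne : cyl (u ++ v) !=set0.
  by apply: (@pr_gt0 _ _ _ _ _ m); apply: lt_le_trans uM; rewrite mulr_gt0.
exists u; split => //; first by move: ur; rewrite size_prefix_word.
have ruv : (r <= size (u ++ v))%N by rewrite size_cat (leq_trans rv)// leq_addl.
have /andP[_ k2] := kappa_bound vne rv; have /andP[k1 _] := kappa_bound uvne ruv.
have k0 := kappa_gt0 C0 Hg vne rv.
rewrite ler_pdivlMr//; apply: (@le_trans _ _ (d / C ^+ 8 * (C ^+ 4 * M v))).
  apply: (@le_trans _ _ (d / C ^+ 8 * kap v)); last by rewrite ler_pM2l.
  by rewrite ler_pM2r// ge_min lexx orbT.
apply: le_trans k1; rewrite [leLHS](_ : _ = (C ^+ 4)^-1 * (d * M v)); last by field;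
  rewrite gt_eqF.
by rewrite ler_pM2l// invr_gt0 exprn_gt0.
Qed.

Variables (f : X -> R) (L : R).
Hypothesis Hfb : forall x, `|f x| <= L.
Hypothesis Hfl : forall n x y, (0 < n)%N -> prefix_word n x = prefix_word n y ->
    `|f x - f y| <= L * th ^+ n.

Let L0 : 0 <= L. Proof. exact: le_trans (Hfb point). Qed.

(* The shift by [L] makes the observable nonnegative, so that all the sums
   over the countable alphabet are sums of nonnegative terms. *)
Fixpoint iterate i : seq S -> R :=
  if i is i'.+1 then transf (iterate i') else fun v => f (pt v) + L.
Local Notation F := iterate.

Definition confined i a b := forall v, cyl v !=set0 -> (r <= size v)%N -> a <= F i v <= b.

Lemma confinedS i a b : 0 <= a -> confined i a b -> confined i.+1 a b.
Proof.
move=> a0 Hi v vne rv /=; apply: (transfer_between mT C0 Hg r0 Hr vne rv a0) => s sv.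
by apply: Hi => //; exact: leqW.
Qed.

Lemma confinedD i n a b : 0 <= a -> confined i a b -> confined (i + n) a b.
Proof.
by move=> a0 Hi; elim: n => [|n IH]; rewrite ?addn0// addnS; exact: confinedS.
Qed.

Lemma confined0 : confined 0 0 (2 * L).
Proof.
move=> v vne rv /=; have := Hfb (pt v); rewrite ler_norml => /andP[? ?].
by apply/andP; split; lra.
Qed.

Lemma iterate_bound i v : cyl v !=set0 -> (r <= size v)%N -> 0 <= F i v <= 2 * L.
Proof. exact: (@confinedD 0 i 0 (2 * L) (lexx _) confined0). Qed.

(** The words at which f is finally evaluated share the i prepended letters besides the k given
    ones. *)
Lemma iterate_lip i k v v' : cyl v !=set0 -> cyl v' !=set0 -> (r <= k)%N ->
  (k <= size v)%N -> (k <= size v')%N -> take k v = take k v' ->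
  F i v <= F i v' + L * th ^+ (i + k).
Proof.
elim: i k v v' => [|i IH] k v v' vne vne' rk kv kv' vv' /=.
  have : prefix_word k (pt v) = prefix_word k (pt v').
    rewrite -(take_prefix _ kv) -(take_prefix _ kv').
    have := cyl_pointP vne; have := cyl_pointP vne'.
    by rewrite /word_cylinder/= => -> ->.
  move=> /(Hfl (leq_trans r0 rk)); rewrite ler_norml add0n => /andP[_].
  by rewrite lerBlDl; lra.
have rv := leq_trans rk kv; have rv' := leq_trans rk kv'.
have rr : take r v = take r v' by rewrite -(take_takel v rk) vv' take_takel.
apply: (transfer_lip mT C0 Hg r0 Hr (K := 2 * L) vne vne' rv rv' rr).
- by rewrite mulr_ge0 ?exprn_ge0.
- by move=> s sv; apply: iterate_bound => //; exact: leqW.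
- by move=> s sv; apply: iterate_bound => //; exact: leqW.
- move=> s sv sv'; rewrite addSnnS; apply: IH => //=; first exact: leqW.
  by rewrite vv'.
Qed.

(** One trajectory of the chain is followed and the remaining ones are bounded by a and b. The
    induction is on the right end of u, because its last letter is the first to be prepended to
    v. *)
Lemma iterate_chain i a b u v : 0 <= a -> confined i a b ->
  cyl (u ++ v) !=set0 -> (r <= size v)%N ->
  kap (u ++ v) / kap v * F i (u ++ v) + (1 - kap (u ++ v) / kap v) * a <= F (i + size u) v
    <= kap (u ++ v) / kap v * F i (u ++ v) + (1 - kap (u ++ v) / kap v) * b.
Proof.
move=> a0 Hab; elim/last_ind: u v => [|u s IH] v uvne rv.
  rewrite /= addn0 divff ?gt_eqF ?(kappa_gt0 C0 Hg)//.
  by rewrite subrr !mul0r !addr0 mul1r lexx.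
rewrite cat_rcons in uvne *; rewrite size_rcons addnS /=.
have svne : cyl (s :: v) !=set0 by exact: (adm_cat_suffix uvne).
have vne : cyl v !=set0 by exact: (@adm_cat_suffix _ _ _ _ _ [:: s] v).
have /andP[IH1 IH2] := IH (s :: v) uvne (leqW rv).
have Hab' s' : cyl (s' :: v) !=set0 -> a <= F (i + size u) (s' :: v) <= b.
  by move=> sv'; apply: confinedD => //; exact: leqW.
have lo := transfer_ge mT C0 Hg r0 Hr vne rv a0 Hab' svne.
have up := transfer_le mT C0 Hg r0 Hr vne rv a0 Hab' svne.
have kv := kappa_gt0 C0 Hg vne rv; have ksv := kappa_gt0 C0 Hg svne (leqW rv).
have gE : kap (u ++ s :: v) / kap v = g (s :: v) * (kap (u ++ s :: v) / kap (s :: v)).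
  by rewrite /transition /=; field; rewrite !gt_eqF.
have g0 : 0 <= g (s :: v) by exact: (transition_ge0 C0 Hg).
move: IH1 IH2 lo up; rewrite gE; move: (kap _ / _) (F i (u ++ s :: v)) (F (i + size u)
  (s :: v)) (g (s :: v)) g0 => c y z q q0 h1 h2 lo up.
apply/andP; split.
  by apply: le_trans lo; have := ler_wpM2l q0 h1; nra.
by apply: le_trans up _; have := ler_wpM2l q0 h2; nra.
Qed.

(** From every v, a share d of the value comes from words starting with u0, on which [F i] differs
    from the reference value F0 by at most [L * th ^+ i]. Only the share [1 - d] keeps the old
    spread e. *)
Lemma confined_contract N d u0 i a e : 0 < d <= 1 ->
  (forall v, cyl v !=set0 -> (r <= size v)%N -> exists u,
    [/\ size u = N, take r u = u0, cyl (u ++ v) !=set0 & d <= kap (u ++ v) / kap v]) ->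
  (r <= N)%N ->
  0 <= a -> confined i a (a + e) -> exists2 a', 0 <= a' &
  confined (i + N) a' (a' + ((1 - d) * e + 2 * d * L * th ^+ i)).
Proof.
move=> /andP[d0 d1] Hu rN a0 Hi; pose x : X := point; pose v0 := prefix_word r x.
have [u1 [u1N u1r u1ne _]] := Hu v0 (ex_intro _ x (cyl_prefix r x))
  (eq_leq (esym (size_prefix_word r x))).
pose F0 := F i (u1 ++ v0).
pose c := L * th ^+ i; have c0 : 0 <= c by rewrite mulr_ge0 ?exprn_ge0.
(* The maximum keeps the lower end nonnegative, as the next application requires; the iterates are
   nonnegative anyway. *)
exists (Num.max 0 (d * (F0 - c) + (1 - d) * a)); first by rewrite le_max lexx.
move=> v vne rv; have [u [uN ur uvne ud]] := Hu v vne rv.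
have := iterate_chain a0 Hi uvne rv; rewrite uN => /andP[lo up].
have ruv : (r <= size (u ++ v))%N by rewrite size_cat uN (leq_trans rN)// leq_addr.
have ru1 : (r <= size (u1 ++ v0))%N by rewrite size_cat u1N (leq_trans rN)// leq_addr.
have uu : take r (u ++ v) = take r (u1 ++ v0).
  by rewrite !takel_cat ?uN ?u1N// ur u1r.
have thr : L * th ^+ (i + r) <= c.
  by rewrite ler_wpM2l// ler_wiXn2l ?leq_addr// ltW.
have F1 : F i (u ++ v) <= F0 + c by apply: le_trans (iterate_lip i uvne u1ne (leqnn r)
  ruv ru1 uu) _; rewrite lerD2l.
have F2 : F0 <= F i (u ++ v) + c by apply: le_trans (iterate_lip i u1ne uvne (leqnn r)
  ru1 ruv (esym uu)) _; rewrite lerD2l.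
have /andP[Fa Fb] := Hi _ uvne ruv.
have /andP[FN _] : 0 <= F (i + N) v <= 2 * L by exact: iterate_bound.
move: lo up ud; move: (kap _ / _) => k lo up ud.
apply/andP; split.
  rewrite ge_max FN/=; apply: le_trans lo; nra.
apply: (@le_trans _ _ (d * (F0 - c) + (1 - d) * a + ((1 - d) * e + 2 * d * L * th ^+ i))).
  apply: le_trans up _; rewrite (_ : 2 * d * L * th ^+ i = 2 * d * c);
    last by rewrite /c; ring.
  nra.
by rewrite lerD2r le_max lexx orbT.
Qed.

Variables (N : nat) (d : R) (u0 : seq S).
Hypothesis N0 : (0 < N)%N.
Hypothesis rN : (r <= N)%N.
Hypothesis d01 : 0 < d <= 1.
Hypothesis Hu : forall v, cyl v !=set0 -> (r <= size v)%N -> exists u,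
    [/\ size u = N, take r u = u0, cyl (u ++ v) !=set0 & d <= kap (u ++ v) / kap v].

Fixpoint width k : R :=
  if k is k'.+1 then (1 - d) * width k' + 2 * d * L * th ^+ (k' * N) else 2 * L.

Lemma width_ge0 k : 0 <= width k.
Proof.
have /andP[d0 d1] := d01; elim: k => [|k IH] /=; first by rewrite mulr_ge0.
by rewrite addr_ge0 ?mulr_ge0 ?subr_ge0 ?exprn_ge0// ltW.
Qed.

Lemma confined_width k : exists2 a, 0 <= a & confined (k * N) a (a + width k).
Proof.
elim: k => [|k [a a0 Ha]]; first by exists 0 => //; rewrite add0r; exact: confined0.
by rewrite mulSn addnC; exact: confined_contract d01 Hu rN a0 Ha.
Qed.

Lemma iterate_oscillation i v w : cyl v !=set0 -> (r <= size v)%N ->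
  cyl w !=set0 -> (r <= size w)%N -> `|F i v - F i w| <= width (i %/ N).
Proof.
move=> vne rv wne rw; have [a a0 Ha] := confined_width (i %/ N).
rewrite {1 2}(divn_eq i N); have Hi := confinedD (i %% N) a0 Ha.
have /andP[? ?] := Hi v vne rv; have /andP[? ?] := Hi w wne rw.
by rewrite ler_norml; apply/andP; split; lra.
Qed.

(** Summing the recursion expresses d times the sum of the widths through the initial width and a
    geometric series. *)
Lemma sum_width_le n : \sum_(k < n) width k <= L * (2 / d + 2 / (1 - th)).
Proof.
have /andP[d0 d1] := d01.
have E1 : d * \sum_(k < n) width k + width n = 2 * L + 2 * d * L * \sum_(k < n) th ^+ (k
  * N).
  elim: n => [|n IH]; first by rewrite !big_ord0 !mulr0 add0r addr0.
  rewrite !big_ord_recr/=; move: IH; move: (\sum_(_ < n) _) (\sum_(_ < n) _) => s1 s2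
    IH; nra.
have E2 : \sum_(k < n) th ^+ (k * N) <= (1 - th)^-1.
  apply: le_trans (geometric_sum_le n _); last by rewrite ltW//=.
  by apply: ler_sum => k _; rewrite ler_wiXn2l ?leq_pmulr// ltW.
have w0 := width_ge0 n.
rewrite -(ler_pM2l d0); apply: (@le_trans _ _ (2 * L + 2 * d * L * (1 - th)^-1)).
  apply: (@le_trans _ _ (d * \sum_(k < n) width k + width n)); first by rewrite lerDl.
  by rewrite E1 lerD2l ler_wpM2l// !mulr_ge0// ltW.
rewrite le_eqVlt; apply/orP; left; apply/eqP.
by field; rewrite !gt_eqF ?subr_gt0.
Qed.

Lemma width_small (e : R) : 0 < e -> exists k, width k <= e.
Proof.
move=> e0; apply: contrapT => H; suff : e <= 0 by rewrite leNgt e0.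
apply: (@archimed_le0 _ _ (L * (2 / d + 2 / (1 - th)))) => n.
apply: le_trans (sum_width_le n); rewrite mulr_natl -[X in _ *+ X]card_ord -sumr_const.
apply: ler_sum => k _; rewrite leNgt; apply/negP => /ltW he.
by apply: H; exists k.
Qed.

End iterates.

(** * Means of the iterates over words *)

Section means.
Context (R : realType) (theta : {itv R & `]0, 1[}) (S : countType) (t : rel S)
  (ne : admissible t !=set0).
Local Notation X := (markov_shift theta ne).
Local Notation cyl := (@word_cylinder R theta S t ne).
Implicit Types (x y : X) (u v w z : seq S) (n : nat).
Variables (phi : X -> R) (m : probability X R) (C P : R).
Hypothesis mT : shift_invariant m.
Hypothesis C0 : (0 < C)%R.
Hypothesis Hg : gibbs_bounds phi m C P.
Variable r : nat.
Hypothesis r0 : (0 < r)%N.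
Hypothesis Hr : forall x y, prefix_word r x = prefix_word r y -> phi x = phi y.
Local Notation E := (weight phi P).
Local Open Scope ring_scope.
Local Notation pt := (@cyl_point R theta S t ne).
Local Notation g := (transition phi m P r).
Local Notation kap := (kappa phi m P r).
Local Notation th := (theta%:num : R).
Variables (f : X -> R) (L : R).
Hypothesis Hfc : continuous f.
Hypothesis Hfb : forall x, `|f x| <= L.
Hypothesis Hfl : forall n x y, (0 < n)%N -> prefix_word n x = prefix_word n y ->
    `|f x - f y| <= L * th ^+ n.
Variables (N : nat) (d : R) (u0 : seq S).
Hypothesis N0 : (0 < N)%N.
Hypothesis rN : (r <= N)%N.
Hypothesis d01 : 0 < d <= 1.
Hypothesis Hu : forall v, cyl v !=set0 -> (r <= size v)%N -> exists u,
    [/\ size u = N, take r u = u0, cyl (u ++ v) !=set0 & d <= kap (u ++ v) / kap v].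
Variable mu : probability X R.
Hypothesis muT : shift_invariant mu.
Local Notation F := (iterate phi m P r f L).
Local Notation wid := (width theta L N d).
Local Notation p := (pr mu).
Implicit Types (H G : seq S -> R).

Let th0 : 0 < th. Proof. by []. Qed.
Let th1 : th < 1. Proof. by []. Qed.
Let L0 : 0 <= L. Proof. exact: le_trans (Hfb point). Qed.

Definition mean j H : R := fine (\esum_(v in words S j) (p v * H v)%:E)%E.

Let pF_ge0 w a : (cyl w !=set0 -> 0 <= a) -> 0 <= p w * a.
Proof.
have [wne a0|/pr_eq0 ->] := pselect (cyl w !=set0); last by rewrite mul0r.
by rewrite mulr_ge0 ?pr_ge0 ?a0.
Qed.

Lemma meanE j H K : (forall v, size v = j -> cyl v !=set0 -> 0 <= H v <= K) ->
  (\esum_(v in words S j) (p v * H v)%:E = (mean j H)%:E)%E.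
Proof.
move=> HK; rewrite /mean fineK// ge0_fin_numE; last first.
  apply: esum_ge0 => v vj; rewrite lee_fin pF_ge0// => vne.
  by have /andP[] := HK v vj vne.
apply: (@le_lt_trans _ _ (`|K|%:E * \esum_(v in words S j) (p v)%:E)%E).
  rewrite -esumZl// => [|s _]; last by rewrite lee_fin pr_ge0.
  apply: le_esum => v vj; rewrite -EFinM lee_fin.
  have [vne|/pr_eq0 ->] := pselect (cyl v !=set0); last by rewrite mul0r mulr0.
  have /andP[_ HK'] := HK v vj vne; rewrite mulrC ler_wpM2r ?pr_ge0//.
  exact: le_trans HK' (ler_norm _).
by rewrite esum_pr mule1 ltry.
Qed.

Let iter_bound i v := @iterate_bound R theta S t ne phi m C P mT C0 Hg r r0 Hr f L Hfb i
  v.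

Let meanF j i : (r <= j)%N ->
  (\esum_(v in words S j) (p v * F i v)%:E = (mean j (F i))%:E)%E.
Proof. by move=> rj; apply: (@meanE _ _ (2 * L)) => v vj vne; apply: iter_bound => //;
  rewrite vj. Qed.

(** Applying the transfer operator passes from words of length j + 1 to length j; this is the price
    of restoring the length before the next application. *)
Lemma mean_restrict j i : (r <= j)%N ->
  `|mean j.+1 (F i) - mean j (F i)| <= L * th ^+ (i + j).
Proof.
move=> rj; pose c := L * th ^+ (i + j); have c0 : 0 <= c by rewrite mulr_ge0 ?exprn_ge0.
have E1 : (\esum_(w in words S j.+1) (p w * F i (take j w))%:E = (mean j (F i))%:E)%E.
  rewrite -(meanF i rj) esum_words_rcons => [|w wj]; last first.
    rewrite lee_fin pF_ge0// => wne.
    have /andP[] : 0 <= F i (take j w) <= 2 * L; last by [].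
    apply: iter_bound; last by rewrite size_takel ?wj.
    by apply: (@adm_cat_prefix _ _ _ _ _ _ (drop j w)); rewrite cat_take_drop.
  apply: eq_esum => v vj; rewrite mulrC EFinM -(esum_pr_rcons mu v).
  have tk s : take j (rcons v s) = v by rewrite -cats1 takel_cat ?vj// -vj take_size.
  under eq_esum => s _ do rewrite tk.
  have [vne|vne] := pselect (cyl v !=set0); last first.
    have p0 s : p (rcons v s) = 0.
      by apply/eqP; rewrite eq_le pr_ge0 andbT -(pr_eq0 mu vne) -cats1 pr_cat_lel.
    by rewrite !esum1 ?mule0// => s _; rewrite p0 ?mul0r.
  have /andP[F0 _] : 0 <= F i v <= 2 * L by apply: iter_bound => //; rewrite vj.
  rewrite -esumZl// => [|s _]; last by rewrite lee_fin pr_ge0.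
  by apply: eq_esum => s _; rewrite -EFinM mulrC.
have E2 := meanF i (leqW rj).
have Ec := esum_pr_cst mu j.+1 c0.
have lip w : size w = j.+1 -> cyl w !=set0 ->
    [/\ 0 <= F i (take j w), 0 <= F i w, F i w <= F i (take j w) + c & F i (take j w) <=
      F i w + c].
  move=> wj wne; have tne : cyl (take j w) !=set0.
    by apply: (@adm_cat_prefix _ _ _ _ _ _ (drop j w)); rewrite cat_take_drop.
  have st : size (take j w) = j by rewrite size_takel ?wj.
  have /andP[? _] : 0 <= F i (take j w) <= 2 * L by apply: iter_bound; rewrite ?st.
  have /andP[? _] : 0 <= F i w <= 2 * L by apply: iter_bound; rewrite ?wj ?leqW.
  have tt : take j (take j w) = take j w by rewrite take_takel.
  by split=> //; apply: (iterate_lip mT C0 Hg r0 Hr Hfb Hfl); rewrite ?st ?wj ?tt.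
have H1 : mean j.+1 (F i) <= mean j (F i) + c.
  rewrite -lee_fin [leRHS]EFinD -E1 -E2 -[in leRHS]Ec -esumD; last 2 first.
  - by move=> w wj; rewrite lee_fin pF_ge0// => /(lip w wj)[].
  - by move=> w _; rewrite lee_fin mulr_ge0 ?pr_ge0.
  apply: le_esum => w wj; rewrite -EFinD lee_fin -mulrDr.
  have [wne|wne] := pselect (cyl w !=set0); last by rewrite pr_eq0// !mul0r.
  by have [_ _ ? _] := lip w wj wne; rewrite ler_wpM2l ?pr_ge0.
have H2 : mean j (F i) <= mean j.+1 (F i) + c.
  rewrite -lee_fin [leRHS]EFinD -E1 -E2 -[in leRHS]Ec -esumD; last 2 first.
  - by move=> w wj; rewrite lee_fin pF_ge0// => /(lip w wj)[].
  - by move=> w _; rewrite lee_fin mulr_ge0 ?pr_ge0.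
  apply: le_esum => w wj; rewrite -EFinD lee_fin -mulrDr.
  have [wne|wne] := pselect (cyl w !=set0); last by rewrite pr_eq0// !mul0r.
  by have [_ _ _ ?] := lip w wj wne; rewrite ler_wpM2l ?pr_ge0.
by rewrite -/c ler_norml; apply/andP; split; lra.
Qed.

Let osc i v w := @iterate_oscillation R theta S t ne phi m C P mT C0 Hg r r0 Hr f L Hfb
  Hfl N d u0 rN d01 Hu i v w.

(** The difference is the sum of (p - q) [F i], where q is the reference law of the divergence.
    Pinsker bounds p - q, and the oscillation of [F i] bounds the other factor after centering. *)
Lemma mean_transfer j i (D : R) : (r <= j)%N -> (divergence phi m P r mu j = D%:E)%E ->
  `|mean j.+1 (F i) - mean j (F i.+1)| <= 2 * wid (i %/ N) * Num.sqrt D.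
Proof.
move=> rj HD.
have D0 : 0 <= D by rewrite -lee_fin -HD; exact: (divergence_ge0 C0 Hg muT rj).
pose q w := g w * p (behead w).
have q0 w : size w = j.+1 -> 0 <= q w.
  by move=> wj; rewrite mulr_ge0 ?pr_ge0// (transition_word_ge0 C0 Hg)// wj.
have q_nadm w : ~ (cyl w !=set0) -> q w = 0.
  by move=> wne; rewrite /q transition_nadm// mul0r.
pose v0 := prefix_word r (point : X).
have v0ne : cyl v0 !=set0 by exists point; exact: cyl_prefix.
have rv0 : (r <= size v0)%N by rewrite size_prefix_word.
(* The centering constant: p and q both have mass 1, so it cancels in the sum. *)
pose c := F i v0; have /andP[c0 _] : 0 <= c <= 2 * L by exact: iter_bound.
pose o := wid (i %/ N); have o0 : 0 <= o by exact: (width_ge0 Hfb).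
have E2 := meanF i (leqW rj).
have sumq H : (forall w, size w = j.+1 -> cyl w !=set0 -> 0 <= H w) ->
   (\esum_(w in words S j.+1) (q w * H w)%:E =
    \esum_(v in words S j) ((p v)%:E * \esum_(s in [set: S]) (g (s :: v) * H (s ::
      v))%:E))%E.
  (* [esum_transition_weight] wants a function that is nonnegative on all words; the truncation only
     matters on inadmissible ones, where q vanishes. *)
  move=> H0; pose H' w := Num.max 0 (H w).
  have HE w : size w = j.+1 -> q w * H w = q w * H' w.
    move=> wj; have [wne|wne] := pselect (cyl w !=set0); last by rewrite q_nadm// !mul0r.
    by rewrite /H' max_r// H0.
  transitivity (\esum_(w in words S j.+1) (q w * H' w)%:E)%E.
    by apply: eq_esum => w wj; rewrite HE.
  rewrite (esum_transition_weight C0 Hg)// => [|w]; last by rewrite /H' le_max lexx.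
  apply: eq_esum => v vj; congr (_ * _)%E; apply: eq_esum => s _.
  have [svne|svne] := pselect (cyl (s :: v) !=set0);
    last by rewrite transition_nadm// !mul0r.
  by rewrite /H' max_r// H0//= vj.
have E3 : (\esum_(w in words S j.+1) (q w * F i w)%:E = (mean j (F i.+1))%:E)%E.
  rewrite sumq => [|w wj wne]; last first.
    by have /andP[] : 0 <= F i w <= 2 * L by apply: iter_bound; rewrite ?wj ?leqW.
  rewrite -(meanF i.+1 rj); apply: eq_esum => v vj.
  have [vne|vne] := pselect (cyl v !=set0); last by rewrite pr_eq0// mul0e mul0r.
  have rv : (r <= size v)%N by rewrite vj.
  rewrite (transferE mT C0 Hg r0 Hr (K := 2 * L) vne rv)// => s sv.
  by apply: iter_bound => //; exact: leqW.
have Eq : (\esum_(w in words S j.+1) (q w)%:E = 1)%E.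
  have := sumq (fun=> 1) (fun _ _ _ => ler01); under eq_esum do rewrite mulr1.
  move=> ->; rewrite -(esum_pr mu j); apply: eq_esum => v vj.
  have [vne|vne] := pselect (cyl v !=set0); last by rewrite pr_eq0// mul0e.
  under eq_esum do rewrite mulr1.
  by rewrite (esum_transition mT C0 Hg r0 Hr)// ?mule1// vj.
have k0 w : size w = j.+1 -> 0 <= kl (p w) (q w).
  by move=> wj; apply: (divergence_term_ge0 C0 Hg muT); rewrite wj.
have main e : 0 < e -> `|mean j.+1 (F i) - mean j (F i.+1)| <= o * (D / (2 * e) + 2 * e).
  move=> e0; have e20 : 0 <= (2 * e)^-1 by rewrite invr_ge0 mulr_ge0// ltW.
  pose B w := o * (kl (p w) (q w) * (2 * e)^-1 + e * (p w + q w)).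
  have B0 w : size w = j.+1 -> 0 <= B w.
    move=> wj; apply: mulr_ge0 => //; apply: addr_ge0; apply: mulr_ge0 => //.
    - exact: k0.
    - exact: ltW.
    - by rewrite addr_ge0 ?pr_ge0 ?q0.
  have EB : (\esum_(w in words S j.+1) (B w)%:E = (o * (D / (2 * e) + 2 * e))%:E)%E.
    under eq_esum do rewrite /B EFinM EFinD.
    rewrite esumZl// => [|w wj]; last first.
      by rewrite -EFinD lee_fin addr_ge0// mulr_ge0 ?k0 ?addr_ge0 ?pr_ge0 ?q0// ltW.
    rewrite esumD; last 2 first.
    - by move=> w wj; rewrite lee_fin mulr_ge0 ?k0.
    - by move=> w wj; rewrite lee_fin mulr_ge0 ?addr_ge0 ?pr_ge0 ?q0// ltW.
    have -> : (\esum_(w in words S j.+1) (kl (p w) (q w) * (2 * e)^-1)%:E = (D / (2 *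
      e))%:E)%E.
      rewrite [(D / _)%R]mulrC EFinM -HD /divergence -esumZl//.
      by apply: eq_esum => w _; rewrite -EFinM mulrC.
    have -> : (\esum_(w in words S j.+1) (e * (p w + q w))%:E = (2 * e)%:E)%E.
      under eq_esum do rewrite EFinM EFinD.
      rewrite esumZl ?(ltW e0)// => [|w wj]; last by rewrite -EFinD lee_fin addr_ge0
        ?pr_ge0 ?q0.
      rewrite esumD => [|w wj|w wj]; last 2 first.
      - by rewrite lee_fin pr_ge0.
      - by rewrite lee_fin q0.
      by rewrite esum_pr Eq -EFinD -EFinM mulrC.
    by rewrite -EFinD -EFinM.
  have key w : size w = j.+1 -> `|(p w - q w) * (F i w - c)| <= B w.
    move=> wj; have [wne|wne] := pselect (cyl w !=set0); last first.
      by rewrite pr_eq0// q_nadm// subrr mul0r normr0 B0.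
    rewrite normrM mulrC; apply: ler_pM => //.
      by apply: osc => //; rewrite wj leqW.
    apply: kl_pinsker => //; [exact: pr_ge0|exact: q0|].
    by apply: (transition_weight_gt0 C0 Hg muT); rewrite wj.
  have Fi0 w : size w = j.+1 -> cyl w !=set0 -> 0 <= F i w.
    by move=> wj wne; have /andP[] : 0 <= F i w <= 2 * L by apply: iter_bound;
      rewrite ?wj ?leqW.
  have pc0 w : 0 <= p w * c by rewrite mulr_ge0 ?pr_ge0.
  have qc0 w : size w = j.+1 -> 0 <= q w * c by move=> wj; rewrite mulr_ge0 ?q0.
  have pF0 w : size w = j.+1 -> 0 <= p w * F i w by move=> wj; apply: pF_ge0; exact: Fi0.
  have qF0 w : size w = j.+1 -> 0 <= q w * F i w.
    move=> wj; have [wne|/q_nadm ->] := pselect (cyl w !=set0); last by rewrite mul0r.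
    by rewrite mulr_ge0 ?q0 ?Fi0.
  have Epc := esum_pr_cst mu j.+1 c0.
  have Eqc : (\esum_(w in words S j.+1) (q w * c)%:E = c%:E)%E.
    rewrite -[RHS]mule1 -Eq -esumZl//.
    by apply: eq_esum => w _; rewrite -EFinM mulrC.
  (* Adding c on both sides, as a sum against q on the left and against p on the right, arranges (p
     - q)([F i] - c) <= B with nonnegative terms only. *)
  have H1 : mean j.+1 (F i) + c <= mean j (F i.+1) + c + o * (D / (2 * e) + 2 * e).
    rewrite -lee_fin !EFinD -E2 -E3 -EB -[X in (_ + X <= _)%E]Eqc -[X in (_ <= _ + X +
      _)%E]Epc.
    rewrite -!esumD; do ?[by move=> w wj; rewrite ?adde_ge0 ?lee_fin ?pF0 ?qF0 ?pc0 ?qc0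
      ?B0].
    apply: le_esum => w wj; rewrite -!EFinD lee_fin.
    by have := key w wj; rewrite ler_norml => /andP[_]; rewrite mulrBl !mulrBr; lra.
  have H2 : mean j (F i.+1) + c <= mean j.+1 (F i) + c + o * (D / (2 * e) + 2 * e).
    rewrite -lee_fin !EFinD -E2 -E3 -EB -[X in (_ + X <= _)%E]Epc -[X in (_ <= _ + X +
      _)%E]Eqc.
    rewrite -!esumD; do ?[by move=> w wj; rewrite ?adde_ge0 ?lee_fin ?pF0 ?qF0 ?pc0 ?qc0
      ?B0].
    apply: le_esum => w wj; rewrite -!EFinD lee_fin.
    by have := key w wj; rewrite ler_norml => /andP[+ _]; rewrite mulrBl !mulrBr; lra.
  by rewrite ler_norml; apply/andP; split; lra.
exact: sqrt_optimize.
Qed.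

(** The same divergence D enters every term because j stays fixed; [sum_error_le] bounds the total
    independently of the number of iterates. *)
Lemma mean_iterate j (D : R) n : (r <= j)%N -> (divergence phi m P r mu j = D%:E)%E ->
  `|mean j (F n) - mean j (F 0)| <=
  \sum_(i < n) (2 * wid (i %/ N) * Num.sqrt D + L * th ^+ (i + j)).
Proof.
move=> rj HD; elim: n => [|n IH]; first by rewrite subrr normr0 big_ord0.
rewrite big_ord_recr/=; move: IH (mean_transfer n rj HD) (mean_restrict n rj).
move: (\sum_(i < n) _) (2 * _ * _) (L * _) => s1 s2 s3.
by rewrite !ler_norml => /andP[? ?] /andP[? ?] /andP[? ?]; apply/andP; split; lra.
Qed.

Lemma sum_error_le j (D : R) k :
  \sum_(i < k * N) (2 * wid (i %/ N) * Num.sqrt D + L * th ^+ (i + j)) <=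
  2 * N%:R * (L * (2 / d + 2 / (1 - th))) * Num.sqrt D + L * th ^+ j / (1 - th).
Proof.
rewrite big_split/=; apply: lerD.
  rewrite -mulr_suml ler_wpM2r ?sqrtr_ge0// -mulr_sumr -mulrA ler_pM2l//.
  rewrite (sum_blocks wid k N0) ler_wpM2l//.
  exact: (sum_width_le Hfb).
under eq_bigr do rewrite exprD mulrCA.
rewrite -mulr_suml mulrC ler_wpM2l ?mulr_ge0 ?exprn_ge0//.
by apply: geometric_sum_le; rewrite ltW//=.
Qed.

Lemma mean_observable j (I : R) : (r <= j)%N -> (\int[mu]_x (f x)%:E = I%:E)%E ->
  `|I + L - mean j (F 0)| <= L * th ^+ j.
Proof.
move=> rj HI; pose c := L * th ^+ j; have c0 : 0 <= c by rewrite mulr_ge0 ?exprn_ge0.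
have F0 w : 0 <= F 0 w by rewrite /=; have := Hfb (pt w); rewrite ler_norml => /andP[];
  lra.
have fI := bounded_continuous_integrable mu Hfc Hfb.
have cI (a : R) : mu.-integrable setT (EFin \o cst a) by exact:
  finite_measure_integrable_cst.
have E1 : (\int[mu]_x (f x + L)%:E = (I + L)%:E)%E.
  transitivity ((\int[mu]_x (f x)%:E) + (\int[mu]_x L%:E))%E.
    exact: (integralD measurableT fI (cI L)).
  by rewrite HI integral_probability_cst.
have E2 : (\int[mu]_x (F 0 (prefix_word j x))%:E = (mean j (F 0))%:E)%E.
  rewrite integral_words// -(meanF 0 rj); apply: eq_esum => w _.
  by rewrite mulrC.
have mF : measurable_fun setT (fun x : X => F 0 (prefix_word j x)).
  exact: (measurable_discrete_comp (p := prefix_word j) (measurable_prefix j)).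
have mf : measurable_fun setT f by exact: continuous_measurable_real.
have near x : `|f x + L - F 0 (prefix_word j x)| <= c.
  have -> : f x + L - F 0 (prefix_word j x) = f x - f (pt (prefix_word j x)) by rewrite
    /=; ring.
  apply: Hfl; first exact: leq_trans rj.
  have := cyl_pointP (ex_intro _ x (cyl_prefix j x)).
  by rewrite /word_cylinder/= size_prefix_word.
have fL0 x : 0 <= f x + L by have := Hfb x; rewrite ler_norml => /andP[]; lra.
have H1 : I + L <= mean j (F 0) + c.
  rewrite -lee_fin [leRHS]EFinD -E1 -E2 -(integral_probability_cst mu c)
    -ge0_integralD//=.
  - apply: ge0_le_integral => //=.
    + by move=> x _; rewrite lee_fin.
    + by apply/measurable_EFinP; apply: measurable_funD.
    + by apply: emeasurable_funD => //; exact/measurable_EFinP.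
    + by move=> x _; rewrite -EFinD lee_fin; have := near x;
      rewrite ler_norml => /andP[_ /=]; lra.
  - by move=> x _; rewrite lee_fin.
  - exact/measurable_EFinP.
have H2 : mean j (F 0) <= I + L + c.
  rewrite -lee_fin [leRHS]EFinD -E1 -E2 -(integral_probability_cst mu c)
    -ge0_integralD//=.
  - apply: ge0_le_integral => //=.
    + by move=> x _; rewrite lee_fin.
    + exact/measurable_EFinP.
    + by apply: emeasurable_funD => //; apply/measurable_EFinP; apply: measurable_funD.
    + by move=> x _; rewrite -EFinD lee_fin; have := near x;
      rewrite ler_norml => /andP[/= ? _]; lra.
  - by move=> x _; rewrite lee_fin.
  - by apply/measurable_EFinP; apply: measurable_funD.
by rewrite -/c ler_norml; apply/andP; split; lra.
Qed.

Lemma mean_near_point j i v : (r <= j)%N -> cyl v !=set0 -> (r <= size v)%N ->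
  `|mean j (F i) - F i v| <= wid (i %/ N).
Proof.
move=> rj vne rv; pose o := wid (i %/ N); have o0 : 0 <= o by exact: (width_ge0 Hfb).
have /andP[Fv0 _] : 0 <= F i v <= 2 * L by exact: iter_bound.
have Ec := @esum_pr_cst _ _ _ _ _ mu j.
have F0 w : size w = j -> cyl w !=set0 -> 0 <= F i w.
  by move=> wj wne; have /andP[] : 0 <= F i w <= 2 * L by apply: iter_bound; rewrite ?wj.
have near w : size w = j -> cyl w !=set0 -> `|F i w - F i v| <= o.
  by move=> wj wne; apply: osc => //; rewrite wj.
have H1 : mean j (F i) <= F i v + o.
  rewrite -lee_fin -(meanF i rj) -(Ec (F i v + o)) ?addr_ge0//; apply: le_esum => w wj.
  rewrite lee_fin; have [wne|/pr_eq0 ->] := pselect (cyl w !=set0);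
    last by rewrite !mul0r.
  rewrite ler_wpM2l ?pr_ge0//; have := near w wj wne.
  by rewrite ler_norml => /andP[_]; lra.
have H2 : F i v <= mean j (F i) + o.
  rewrite -lee_fin EFinD -(meanF i rj) -[in leRHS](Ec o o0) -(Ec (F i v) Fv0) -esumD;
    last 2 first.
  - by move=> w wj; rewrite lee_fin pF_ge0// => /(F0 w wj).
  - by move=> w _; rewrite lee_fin mulr_ge0 ?pr_ge0.
  apply: le_esum => w wj; rewrite -EFinD -mulrDr lee_fin.
  have [wne|/pr_eq0 ->] := pselect (cyl w !=set0); last by rewrite !mul0r.
  rewrite ler_wpM2l ?pr_ge0//; have := near w wj wne.
  by rewrite ler_norml => /andP[+ _]; lra.
by rewrite -/o ler_norml; apply/andP; split; lra.
Qed.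

(** The value [F (k * N) v] does not involve mu, so it can serve as a common reference for mu and
    m. *)
Lemma integral_near_iterate j (D I : R) k v : (r <= j)%N ->
  (divergence phi m P r mu j = D%:E)%E -> (\int[mu]_x (f x)%:E = I%:E)%E ->
  cyl v !=set0 -> (r <= size v)%N ->
  `|I + L - F (k * N) v| <= L * th ^+ j * (1 + (1 - th)^-1) +
    2 * N%:R * (L * (2 / d + 2 / (1 - th))) * Num.sqrt D + wid k.
Proof.
move=> rj HD HI vne rv.
have := le_trans (mean_iterate (k * N) rj HD) (sum_error_le j D k).
have := mean_observable rj HI; have := mean_near_point (k * N) rj vne rv.
rewrite mulnK// (_ : L * th ^+ j * (1 + _) = L * th ^+ j + L * th ^+ j / (1 - th));
  last by ring.
move: (2 * _ * _ * _) (L * th ^+ j) (L * _ / _) (wid k) => a c b e.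
by rewrite !ler_norml => /andP[? ?] /andP[? ?] /andP[? ?]; apply/andP; split; lra.
Qed.

End means.

(** * Comparison of m with an invariant measure *)

Section effective_uniqueness.
Context (R : realType) (theta : {itv R & `]0, 1[}) (S : countType) (t : rel S)
  (ne : admissible t !=set0).
Local Notation X := (markov_shift theta ne).
Local Notation cyl := (@word_cylinder R theta S t ne).
Implicit Types (x y : X) (u v w z : seq S) (n : nat).
Variables (phi : X -> R) (m : probability X R) (C P : R).
Hypothesis Hmix : topologically_mixing theta ne.
Hypothesis mT : shift_invariant m.
Hypothesis C0 : (0 < C)%R.
Hypothesis Hg : gibbs_bounds phi m C P.
Variable r : nat.
Hypothesis r0 : (0 < r)%N.
Hypothesis Hr : forall x y, prefix_word r x = prefix_word r y -> phi x = phi y.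
Local Notation E := (weight phi P).
Local Open Scope ring_scope.
Local Notation th := (theta%:num : R).

(** Both integrals are compared with the same iterate at v0. For m a longer word length j' is used,
    at which its divergence is negligible, so only the divergence of mu remains. *)
Lemma effective_uniqueness : exists2 B : R, 0 < B &
  forall (f : X -> R) (L : R), continuous f -> (forall x, `|f x| <= L) ->
    (forall n x y, (0 < n)%N -> prefix_word n x = prefix_word n y ->
      `|f x - f y| <= L * th ^+ n) ->
  forall mu : probability X R, shift_invariant mu ->
  forall (j : nat) (D I I' : R), (r <= j)%N -> (divergence phi m P r mu j = D%:E)%E ->
    (\int[mu]_x (f x)%:E = I%:E)%E -> (\int[m]_x (f x)%:E = I'%:E)%E ->
    `|I' - I| <= B * L * (th ^+ j + Num.sqrt D).
Proof.
have [N [d [u0 [N0 rN d01 Hu]]]] := kappa_minorization Hmix mT C0 Hg r.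
have th1 : 0 < 1 - th by rewrite subr_gt0.
have /andP[d0 _] := d01.
pose K1 := 1 + (1 - th)^-1; pose K2 := 2 * N%:R * (2 / d + 2 / (1 - th)).
have K10 : 0 < K1 by rewrite addr_gt0// invr_gt0.
have K20 : 0 <= K2 by rewrite !mulr_ge0// addr_ge0// divr_ge0// ltW.
(* K1 occurs once for each measure, K2 for mu alone. *)
exists (2 * K1 + K2); first by rewrite ltr_pwDl// mulr_gt0.
move=> f L fc fb fl mu muT j D I I' rj HD HI HI'.
have L0 : 0 <= L by exact: le_trans (fb point).
pose v0 := prefix_word r (point : X).
have v0ne : cyl v0 !=set0 by exists point; exact: cyl_prefix.
have rv0 : (r <= size v0)%N by rewrite size_prefix_word.
apply/ler_addgt0Pl => e' e'0.
(* The errors to be absorbed are [width k] for either measure and [L * K2] times the root of the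
   divergence of m, each width and the root being at most e. *)
pose e := e' / (2 + L * K2).
have e0 : 0 < e by rewrite divr_gt0// ltr_wpDr// mulr_ge0.
have [k wk] := width_small fb N0 d01 e0.
have [j' jj' Dj'] := divergence_gibbs_small mT C0 Hg r0 Hr (exprn_gt0 2 e0) rj.
have rj' := leq_trans rj jj'.
have := divergence_ge0 C0 Hg mT rj'; move: Dj'.
case E : (divergence _ _ _ _ _ _) => [D'||]//; rewrite !lee_fin => De D'0.
have := integral_near_iterate mT C0 Hg r0 Hr fc fb fl N0 rN d01 Hu muT k rj HD HI v0ne
  rv0.
have := integral_near_iterate mT C0 Hg r0 Hr fc fb fl N0 rN d01 Hu mT k rj' E HI' v0ne
  rv0.
have sD : Num.sqrt D' <= e by rewrite -(ger0_norm (ltW e0)) -sqrtr_sqr ler_sqrt//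
  exprn_ge0// ltW.
have tt : L * th ^+ j' <= L * th ^+ j by rewrite ler_wpM2l// ler_wiXn2l// ltW.
have E2 (a : R) : 2 * N%:R * (L * (2 / d + 2 / (1 - th))) * a = L * K2 * a by rewrite
  /K2; ring.
rewrite !E2 -/K1; move: (iterate _ _ _ _ _ _ _ _) => z.
have h1 : L * th ^+ j' * K1 <= L * th ^+ j * K1 by rewrite ler_pM2r.
have h2 : L * K2 * Num.sqrt D' <= L * K2 * e by rewrite ler_wpM2l// mulr_ge0.
have h3 : e' = 2 * e + L * K2 * e.
  by rewrite -mulrDl /e mulrC divfK// gt_eqF// ltr_wpDr// mulr_ge0.
have h4 : 0 <= L * th ^+ j * K2 by apply: mulr_ge0 => //; apply: mulr_ge0 => //;
  exact: exprn_ge0.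
have h5 : 0 <= L * K1 * Num.sqrt D by apply: mulr_ge0; [apply: mulr_ge0 => //;
  exact: ltW|exact: sqrtr_ge0].
rewrite h3 !ler_norml => /andP[a1 a2] /andP[b1 b2]; apply/andP; split; lra.
Qed.

End effective_uniqueness.

(** * Entropy of words *)

Section word_entropy.
Context (R : realType) (theta : {itv R & `]0, 1[}) (S : countType) (t : rel S)
  (ne : admissible t !=set0).
Local Notation X := (markov_shift theta ne).
Local Notation cyl := (@word_cylinder R theta S t ne).
Implicit Types (x y : X) (u v w z : seq S) (n : nat).
Variable mu : probability X R.
Hypothesis muT : shift_invariant mu.
Local Notation p := (pr mu).

Definition word_entropy n : \bar R := \esum_(w in words S n) (p w * - ln (p w))%:E.

Let nln_ge0 w : (0 <= - ln (p w))%R.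
Proof. by rewrite oppr_ge0 ln_le0// pr_le1. Qed.

Let eta_ge0 w : (0 <= p w * - ln (p w))%R.
Proof. by rewrite mulr_ge0 ?pr_ge0. Qed.

Lemma word_entropy_ge0 n : 0 <= word_entropy n.
Proof. by apply: esum_ge0 => w _; rewrite lee_fin. Qed.

(** All inadmissible words give the same atom, the empty set. It contributes 0 and is split off, and
    on the other words the cylinder map is injective. *)
Lemma entropy_words n : entropy mu [set cyl w | w in words S n] = word_entropy n.
Proof.
have termE w : - (mu (cyl w) * lne (mu (cyl w))) = (p w * - ln (p w))%:E.
  rewrite prE; have := pr_ge0 mu w; rewrite le_eqVlt => /predU1P[<-|w0].
    by rewrite !mul0r mul0e oppe0.
  by rewrite lne_EFin// -EFinM -EFinN mulrN.
rewrite /entropy /word_entropy.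
pose A := [set w | size w = n /\ cyl w !=set0].
rewrite (esumID [set Q | Q !=set0]); last first.
  by move=> _ [w _ <-]; rewrite termE lee_fin.
rewrite [X in _ + X]esum1 ?adde0; last first.
  by move=> Q [_ /set0P/negP/negPn/eqP ->]; rewrite measure0 mul0e oppe0.
rewrite (_ : _ `&` _ = [set cyl w | w in A]); last first.
  apply/seteqP; split; first by move=> _ [[w wn <-] wne]; exists w.
  by move=> _ [w [wn wne] <-]; split => //; exists w.
rewrite esum_image; last first.
  move=> w w' /set_mem[wn [x wx]] /set_mem[wn' _] ww'.
  by move: wx (wx); rewrite {2}ww' /word_cylinder /= wn wn' => -> ->.
rewrite [RHS](esumID [set w | cyl w !=set0]) => [|w _]; last by rewrite lee_fin.
rewrite [X in _ = _ + X]esum1 ?adde0 => [|w [_ wne]]; last first.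
  by rewrite pr_eq0// mul0r.
by apply: eq_esum => w _; rewrite termE.
Qed.

Lemma word_entropy0 : word_entropy 0 = 0.
Proof. by rewrite /word_entropy esum_words0 ?lee_fin// pr_nil ln1 oppr0 mulr0. Qed.

(** Nonnegativity of the relative entropy of the law of words [s :: v] with respect to the product
    of the laws of s and v. *)
Lemma word_entropy_subadditive n :
  word_entropy n.+1 <= word_entropy n + word_entropy 1.
Proof.
have pos1 s v : (0 <= p (s :: v) * - ln (p [:: s]))%R by rewrite mulr_ge0 ?pr_ge0.
have pos2 s v : (0 <= p (s :: v) * - ln (p v))%R by rewrite mulr_ge0 ?pr_ge0.
have pos3 s v : (0 <= p [:: s] * p v)%R by rewrite mulr_ge0 ?pr_ge0.
have term s v : (p (s :: v) * - ln (p (s :: v)) + p (s :: v) <=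
    p (s :: v) * - ln (p v) + p (s :: v) * - ln (p [:: s]) + p [:: s] * p v)%R.
  have := pr_ge0 mu (s :: v); rewrite le_eqVlt => /predU1P[<-|sv0].
    by rewrite !mul0r !add0r.
  have s0 : (0 < p [:: s])%R by exact: lt_le_trans (pr_cat_lel mu [:: s] v).
  have v0 : (0 < p v)%R by exact: lt_le_trans (pr_cat_ler muT [:: s] v).
  have := @kl_ge0 R (p (s :: v)) (p [:: s] * p v) (ltW sv0) (pos3 s v) (fun=> mulr_gt0
    s0 v0).
  by rewrite /kl ln_div ?posrE ?mulr_gt0// lnM ?posrE//; lra.
have E0 : \esum_(w in words S n.+1) (p w * - ln (p w) + p w)%:E = word_entropy n.+1 + 1.
  rewrite -(esum_pr mu n.+1) -esumD; [by []|by move=> w _; rewrite lee_fin|].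
  by move=> w _; rewrite lee_fin pr_ge0.
have E1 : \esum_(v in words S n) \esum_(s in [set: S]) (p (s :: v) * - ln (p v))%:E =
  word_entropy n.
  apply: eq_esum => v _; rewrite mulrC EFinM -(esum_pr_cons muT v) -esumZl// => [|s _];
    last by rewrite lee_fin pr_ge0.
  by apply: eq_esum => s _; rewrite -EFinM mulrC.
have E2 : \esum_(v in words S n) \esum_(s in [set: S]) (p (s :: v) * - ln (p [:: s]))%:E
  = word_entropy 1.
  pose G w := if w is s :: v then (p (s :: v) * - ln (p [:: s]))%:E else 0%E.
  have G0 w : 0 <= G w by case: w => [//|s v]; rewrite lee_fin.
  rewrite -(@esum_words_cons _ _ n G)// esum_words_head//.
  rewrite /word_entropy esum_words_head => [|w _]; last by rewrite lee_fin.
  apply: eq_esum => s _; rewrite esum_words0 ?lee_fin//= mulrC EFinM.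
  rewrite -(esum_pr_suffix mu n [:: s]) -esumZl// => [|v _];
    last by rewrite lee_fin pr_ge0.
  by apply: eq_esum => v _; rewrite -EFinM mulrC.
have E3 : \esum_(v in words S n) \esum_(s in [set: S]) (p [:: s] * p v)%:E = 1.
  rewrite -(esum_pr mu n); apply: eq_esum => v _.
  transitivity (\esum_(s in [set: S]) ((p v)%:E * (p [:: s])%:E)).
    by apply: eq_esum => s _; rewrite -EFinM mulrC.
  rewrite esumZl ?pr_ge0// => [|s _]; last by rewrite lee_fin pr_ge0.
  by rewrite (esum_pr_cons muT) pr_nil mule1.
have : word_entropy n.+1 + 1 <= word_entropy n + word_entropy 1 + 1.
  rewrite -E0 -[X in _ <= _ + X]E3 -E1 -E2 esum_words_cons => [|w _];
    last by rewrite lee_fin addr_ge0 ?pr_ge0.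
  rewrite -!esumD; do ?[by move=> v _; rewrite ?adde_ge0// ?esum_ge0// => s _;
    rewrite lee_fin].
  apply: le_esum => v _; rewrite -!esumD; do ?[by move=> s _; rewrite ?adde_ge0 ?lee_fin].
  by apply: le_esum => s _; rewrite -!EFinD lee_fin.
by rewrite leeD2rE.
Qed.

Lemma word_entropy_le n (a : R) : word_entropy 1 = a%:E -> word_entropy n <= (n%:R *
  a)%:E.
Proof.
move=> Ha; elim: n => [|n IH]; first by rewrite word_entropy0 mul0r.
apply: le_trans (word_entropy_subadditive n) _.
by rewrite Ha -natr1 mulrDl mul1r EFinD; apply: leeD.
Qed.

End word_entropy.

Section entropy_divergence.
Context (R : realType) (theta : {itv R & `]0, 1[}) (S : countType) (t : rel S)
  (ne : admissible t !=set0).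
Local Notation X := (markov_shift theta ne).
Local Notation T := (@left_shift R theta S t ne).
Local Notation cyl := (@word_cylinder R theta S t ne).
Implicit Types (x y : X) (u v w z : seq S) (n : nat).
Variables (phi : X -> R) (m : probability X R) (C P : R).
Hypothesis mT : shift_invariant m.
Hypothesis C0 : (0 < C)%R.
Hypothesis Hg : gibbs_bounds phi m C P.
Variable r : nat.
Hypothesis r0 : (0 < r)%N.
Hypothesis Hr : forall x y, prefix_word r x = prefix_word r y -> phi x = phi y.
Local Notation E := (weight phi P).
Local Open Scope ring_scope.
Local Notation g := (transition phi m P r).
Local Notation h := (eigenfunction phi m P r).
Variable mu : probability X R.
Hypothesis muT : shift_invariant mu.
Hypothesis phiI : mu.-integrable setT (EFin \o phi).
Local Notation p := (pr mu).
Local Open Scope ereal_scope.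

Let cost w : R := (if (r < size w)%N then - ln (g w) else 0)%R.

Let cost_ge0 w : (0 <= cost w)%R.
Proof.
rewrite /cost; case: ifPn => //; case: w => [//|s v] rv.
by rewrite oppr_ge0 ln_le0// (transition_le1 mT C0 Hg r0 Hr).
Qed.

(** On words of length j + 1, [- ln g] is P - phi plus the coboundary of b = ln h. As b is bounded
    and mu is invariant, the coboundary integrates to 0. *)
Lemma integral_cost j (I : R) : (r <= j)%N -> \int[mu]_x (phi x)%:E = I%:E ->
  \esum_(w in words S j.+1) (p w * cost w)%:E = (P - I)%:E.
Proof.
move=> rj HI; pose b x : R := ln (h (prefix_word r x)).
have hb x : ((C ^+ 2)^-1 <= h (prefix_word r x) <= C ^+ 2)%R.
  apply: (eigenfunction_bound C0 Hg); first by exists x; exact: cyl_prefix.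
  by rewrite size_prefix_word.
have C2 : (0 < C ^+ 2)%R by rewrite exprn_gt0.
have h0 x : (0 < h (prefix_word r x))%R.
  by have /andP[+ _] := hb x; apply: lt_le_trans; rewrite invr_gt0.
have mb : measurable_fun setT b.
  exact: (measurable_discrete_comp (p := prefix_word r) (measurable_prefix r) (fun w =>
    ln (h w)) measurableT).
have bI : mu.-integrable setT (EFin \o b).
  apply: measurable_bounded_integrable => //.
    by rewrite (le_lt_trans (probability_le1 mu measurableT))// ltry.
  exists (ln (C ^+ 2)); split; first exact: num_real.
  move=> K LK x _ /=; apply: le_trans (ltW LK).
  have /andP[h1 h2] := hb x; rewrite ler_norml; apply/andP; split.
    by rewrite -lnV ?posrE// ler_ln ?posrE ?invr_gt0.
  by rewrite ler_ln ?posrE.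
have costE x : cost (prefix_word j.+1 x) = (P - phi x - b x + b (T x))%R.
  rewrite /cost size_prefix_word ltnS rj.
  have wx := cyl_prefix j.+1 x; rewrite prefix_wordS in wx *.
  rewrite (transitionE C0 Hg r0 Hr (ex_intro _ x wx)) ?size_prefix_word//.
  have -> : h (x 0%N :: prefix_word j (T x)) = h (prefix_word r x).
    by apply: eigenfunction_take; rewrite -prefix_wordS !take_prefix// leqW.
  have -> : h (prefix_word j (T x)) = h (prefix_word r (T x)).
    by apply: eigenfunction_take; rewrite !take_prefix.
  rewrite weight1 (_ : phi _ = phi x); last first.
    apply: Hr; have := cyl_pointP (ex_intro _ x wx).
    rewrite /word_cylinder/= size_prefix_word -prefix_wordS => E.
    by rewrite -(take_prefix _ (leqW rj)) E take_prefix// leqW.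
  by rewrite ln_div ?posrE ?mulr_gt0 ?expR_gt0// lnM ?posrE ?expR_gt0// expRK /b; lra.
have cI (a : R) : mu.-integrable setT (EFin \o cst a) by exact:
  finite_measure_integrable_cst.
have bTI := integrable_iter_shift muT 1 bI.
have bT := integral_iter_shift muT 1 bI.
have bfin : \int[mu]_x (EFin \o b) x \is a fin_num := integrable_fin_num measurableT bI.
rewrite -[LHS](eq_esum (a := fun w => (cost w * p w)%:E)) => [|w _];
  last by rewrite mulrC.
rewrite -integral_words//; under eq_integral do rewrite costE.
transitivity (\int[mu]_x (((EFin \o cst P) x - (EFin \o phi) x - (EFin \o b) x) + (EFin
  \o b) (iter 1 T x))).
  by apply: eq_integral => x _.
rewrite integralD//; last by apply: integrableB => //; exact: integrableB.
rewrite integralB//; last exact: integrableB.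
rewrite integralB// bT integral_probability_cst.
rewrite -[X in _ - X - _ + _]/(\int[mu]_x (phi x)%:E) HI.
by rewrite subeK.
Qed.

(** [divergence_telescope] with -ln p as potential and -ln g as cost; finiteness of the entropies
    allows the common terms to be cancelled. *)
Lemma divergence_entropy j (I : R) : (r <= j)%N -> \int[mu]_x (phi x)%:E = I%:E ->
  word_entropy mu j \is a fin_num -> word_entropy mu j.+1 \is a fin_num ->
  divergence phi m P r mu j + word_entropy mu j.+1 = word_entropy mu j + (P - I)%:E.
Proof.
move=> rj HI Hj Hj1.
have nln_ge0 w : (0 <= - ln (p w))%R by rewrite oppr_ge0 ln_le0// pr_le1.
have := @divergence_telescope _ _ _ _ _ phi m C P C0 Hg r mu j (fun w => - ln (p w))%R
  cost muT rj nln_ge0 cost_ge0.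
rewrite (integral_cost rj HI) -/(word_entropy mu j) -/(word_entropy mu j.+1) => H.
have Eq : \esum_(w in words S j.+1) (g w * p (behead w))%:E = 1.
  under eq_esum do rewrite -[X in X%:E]mulr1.
  rewrite (esum_transition_weight C0 Hg mu rj (F := fun=> 1%R))// -(esum_pr mu j).
  apply: eq_esum => w wk; under eq_esum do rewrite mulr1.
  have [wne|wne] := pselect (cyl w !=set0); last first.
    by rewrite pr_eq0// mul0e.
  by rewrite (esum_transition mT C0 Hg r0 Hr)// ?mule1// wk.
suff : divergence phi m P r mu j + word_entropy mu j.+1 + 1 =
    word_entropy mu j + (P - I)%:E + 1.
  move: Hj Hj1; case: (word_entropy mu j) => [a||]//;
    case: (word_entropy mu j.+1) => [c||]//.
  by case: (divergence _ _ _ _ _ _) => [e||]// _ _ [E]; congr EFin; lra.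
rewrite Eq in H; apply: H => w wj w0.
have rw : (r < size w)%N by rewrite wj.
have wne := pr_gt0 w0; have g0 := transition_word_gt0 C0 Hg wne rw.
have b0 : (0 < p (behead w))%R.
  by apply: lt_le_trans w0 _; case: (w) rw => [//|s v] _;
    exact: (pr_cat_ler muT [:: s] v).
rewrite /cost rw (@ln_div R (g w * p (behead w))%R (p w)) ?posrE ?(mulr_gt0 g0 b0)//.
by rewrite (@lnM R (g w) (p (behead w))) ?posrE//; lra.
Qed.

End entropy_divergence.

(** With k = (n - l)./2, the range from k to n holds at least n / 2 indices, which is the source of
    the factor 2 in the average, and [3 * l <= n] gives l <= k. *)
Lemma half_sub_bounds (l n : nat) : (0 < l)%N -> (3 * l <= n)%N ->
  [/\ (l <= (n - l)./2)%N, ((n - l)./2 < n)%N,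
      (n <= (n - (n - l)./2) * 2)%N, (0 < n)%N & (0 < n - l)%N].
Proof. by move=> l0 ln; split; lia. Qed.

Lemma exists_le_average (R : realType) (D : nat -> R) (k n : nat) (y : R) : (k < n)%N ->
  (\sum_(k <= j < n) D j <= (n - k)%:R * y)%R ->
  exists j, (k <= j < n)%N /\ (D j <= y)%R.
Proof.
move=> kn H; apply: contrapT => noj; move: H; apply/negP; rewrite -ltNge.
have -> : ((n - k)%:R * y = \sum_(k <= j < n) y)%R.
  by rewrite sumr_const_nat mulr_natl.
apply: ltr_sum_nat => // j kjn; rewrite ltNge; apply/negP => Dj.
by apply: noj; exists j.
Qed.

(** * The inequality for locally constant potentials *)

Section second_inequality.
Context (R : realType) (theta : {itv R & `]0, 1[}) (S : countType) (t : rel S)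
  (ne : admissible t !=set0).
Local Notation X := (markov_shift theta ne).
Implicit Types (x y : X) (u v w z : seq S) (n : nat).
Variables (phi : X -> R) (m : probability X R) (C P : R).
Hypothesis Hmix : topologically_mixing theta ne.
Hypothesis mT : shift_invariant m.
Hypothesis C0 : (0 < C)%R.
Hypothesis Hg : gibbs_bounds phi m C P.
Variable r : nat.
Hypothesis r0 : (0 < r)%N.
Hypothesis Hr : forall x y, prefix_word r x = prefix_word r y -> phi x = phi y.
Local Notation E := (weight phi P).
Local Open Scope ring_scope.
Local Notation th := (theta%:num : R).

Lemma second_inequality : exists2 B : R, 0 < B &
  forall (f : X -> R) (L : R), continuous f -> (forall x, `|f x| <= L) ->
    (forall n x y, (0 < n)%N -> prefix_word n x = prefix_word n y ->
      `|f x - f y| <= L * th ^+ n) ->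
  forall mu : probability X R, shift_invariant mu ->
    mu.-integrable setT (EFin \o phi) ->
  forall (l n : nat) (Imu Im Iphi a c : R), (r <= l)%N -> (3 * l <= n)%N ->
    (\int[mu]_x (f x)%:E = Imu%:E)%E -> (\int[m]_x (f x)%:E = Im%:E)%E ->
    (\int[mu]_x (phi x)%:E = Iphi%:E)%E ->
    word_entropy mu 1 = a%:E -> word_entropy mu n = c%:E ->
    `|Im - Imu| <= B * L * (th ^+ (n - l)./2 +
      Num.sqrt (P - (Iphi + n%:R^-1 * c) + l%:R / (n - l)%:R * a)).
Proof.
have [B B0 HB] := effective_uniqueness Hmix mT C0 Hg r0 Hr.
exists (2 * B); first by rewrite mulr_gt0.
move=> f L fc fb fl mu muT phiI l n Imu Im Iphi a c rl ln HImu HIm HIphi Ha Hc.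
have L0 : 0 <= L by exact: le_trans (fb point).
have fin j : (word_entropy mu j)%E \is a fin_num.
  rewrite ge0_fin_numE ?word_entropy_ge0//.
  by rewrite (le_lt_trans (word_entropy_le muT j Ha))// ltry.
pose H j := fine (word_entropy mu j).
have HE j : word_entropy mu j = (H j)%:E by rewrite fineK.
pose D j := fine (divergence phi m P r mu j).
have DE j : (r <= j)%N -> divergence phi m P r mu j = (D j)%:E /\ D j = H j - H j.+1 +
  (P - Iphi).
  move=> rj; have := divergence_entropy mT C0 Hg r0 Hr muT phiI rj HIphi (fin j) (fin
    j.+1).
  by rewrite /D !HE; case: (divergence _ _ _ _ _ _) => [e||]// [E]; split => //=; lra.
have D0 j : (r <= j)%N -> 0 <= D j.
  by move=> rj; apply: fine_ge0; exact: (divergence_ge0 C0 Hg muT rj).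
have Hl : H l <= l%:R * a by rewrite -lee_fin -HE; exact: word_entropy_le.
have a0 : 0 <= a by rewrite -lee_fin -Ha word_entropy_ge0.
(* This is the mean of the nonnegative cost -ln g; its sign allows [n - l] to be replaced by n in
   [sumD]. *)
have PI0 : 0 <= P - Iphi.
  have := integral_cost mT C0 Hg r0 Hr muT phiI (leqnn r) HIphi => E.
  rewrite -lee_fin -E; apply: esum_ge0 => w _; rewrite lee_fin mulr_ge0 ?pr_ge0//.
  case: ifPn => //; case: w => [//|s v] rv.
  by rewrite oppr_ge0 ln_le0// (transition_le1 mT C0 Hg r0 Hr).
set y := P - _ + _; set k := (n - l)./2.
have l0 : (0 < l)%N by exact: leq_trans rl.
have [lk kn nk n_gt0 nl_gt0] := half_sub_bounds l0 ln.
have n0 : 0 < n%:R :> R by rewrite ltr0n.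
have telescope i j : (r <= i)%N -> (i <= j)%N ->
    \sum_(i <= q < j) D q = H i - H j + (j - i)%:R * (P - Iphi).
  move=> ri; elim: j => [|j IH]; first by rewrite leqn0 => /eqP ->;
    rewrite big_geq// subnn mul0r subrr addr0.
  rewrite leq_eqVlt => /predU1P[->|ij]; first by rewrite big_geq// subnn mul0r subrr
    addr0.
  rewrite big_nat_recr//= IH// (DE j (leq_trans ri ij)).2 subSn//.
  by rewrite -natr1 mulrDl mul1r; ring.
have nl0 : 0 < (n - l)%:R :> R by rewrite ltr0n.
have ny : n%:R * y = n%:R * (P - Iphi) - c + n%:R * (l%:R / (n - l)%:R * a).
  rewrite /y; move: (n - l)%:R nl0 => e e0; by field; rewrite !gt_eqF.
(* The correction term of y, multiplied by n, pays for the entropy [H l] left over at the lower end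
   of the telescoping sum. *)
have la : l%:R * a <= n%:R * (l%:R / (n - l)%:R * a).
  rewrite mulrA ler_wpM2r// mulrA ler_pdivlMr// [leRHS]mulrC ler_wpM2l//.
  by rewrite ler_nat leq_subr.
have Hn : H n = c by rewrite /H Hc.
(* The sum is enlarged to start at l, where [H l <= l%:R * a] is available; the added divergences
   are nonnegative. *)
have sumD : \sum_(k <= q < n) D q <= n%:R * y.
  have rk := leq_trans rl lk.
  have s1 := telescope l n rl (ltnW (leq_ltn_trans lk kn)).
  have s2 : \sum_(k <= q < n) D q <= \sum_(l <= q < n) D q.
    rewrite [leRHS](big_cat_nat lk (ltnW kn))/= lerDr big_nat_cond.
    by apply: sumr_ge0 => q /andP[/andP[lq _] _]; exact: D0 (leq_trans rl lq).
  apply: le_trans s2 _; rewrite s1 ny Hn.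
  have : (n - l)%:R * (P - Iphi) <= n%:R * (P - Iphi).
    by rewrite ler_wpM2r// ler_nat leq_subr.
  lra.
have [j [/andP[kj jn] Dj]] : exists j, (k <= j < n)%N /\ D j <= 2 * y.
  apply: exists_le_average => //; apply: le_trans (sumD) _.
  have y0 : 0 <= n%:R * y.
    apply: le_trans (sumD); rewrite big_nat_cond;
      apply: sumr_ge0 => q /andP[/andP[kq _] _].
    exact: D0 (leq_trans rl (leq_trans lk kq)).
  have {}y0 : 0 <= y by move: y0; rewrite pmulr_rge0.
  by rewrite mulrA ler_wpM2r// -natrM ler_nat.
have rj : (r <= j)%N by exact: leq_trans rl (leq_trans lk kj).
apply: le_trans (HB f L fc fb fl mu muT j (D j) Imu Im rj (DE j rj).1 HImu HIm) _.
have t1 : th ^+ j <= th ^+ k by rewrite ler_wiXn2l// ltW.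
have t0 : 0 <= th ^+ k by rewrite exprn_ge0.
have y0 : 0 <= y.
  by have := le_trans (D0 j rj) Dj; rewrite pmulr_rge0.
have s1 : Num.sqrt (D j) <= 2 * Num.sqrt y.
  apply: (@le_trans _ _ (Num.sqrt (2 ^+ 2 * y))).
    by rewrite ler_sqrt ?mulr_ge0// (le_trans Dj)// ler_wpM2r//; lra.
  by rewrite sqrtrM// sqrtr_sqr ger0_norm.
have BL : 0 <= B * L by rewrite mulr_ge0// ltW.
rewrite -mulrA -[leRHS]mulrA [leRHS]mulrCA !mulrA -!mulrA.
apply: (@le_trans _ _ (B * L * (2 * (th ^+ k + Num.sqrt y)))).
  by rewrite mulrA ler_wpM2l//; lra.
by rewrite le_eqVlt; apply/orP; left; apply/eqP; ring.
Qed.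

End second_inequality.

(** * The inequality for general potentials *)

Section first_inequality.
Context (R : realType) (theta : {itv R & `]0, 1[}) (S : countType) (t : rel S)
  (ne : admissible t !=set0).
Local Notation X := (markov_shift theta ne).
Variables (phi : X -> R) (m : probability X R) (C P : R).
Hypothesis Hmix : topologically_mixing theta ne.
Hypothesis mT : shift_invariant m.
Hypothesis C0 : (0 < C)%R.
Hypothesis Hg : gibbs_bounds phi m C P.
Local Open Scope ring_scope.

Lemma integral_bounded (mu : probability X R) (f : X -> R) (L I : R) : continuous f ->
  (forall x, `|f x| <= L) -> (\int[mu]_x (f x)%:E = I%:E)%E -> `|I| <= L.
Proof.
move=> fc fb HI; have fI := bounded_continuous_integrable mu fc fb.
rewrite -lee_fin -[leRHS](integral_probability_cst mu).
have -> : (`|I|%:E = `| \int[mu]_x (EFin \o f) x |)%E.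
  by rewrite (_ : \int[mu]_x (EFin \o f) x = I%:E)%E.
apply: le_trans (le_abse_integral mu measurableT _) _.
  by case/integrableP: fI.
apply: ge0_le_integral => //=; first by apply/measurable_EFinP;
  apply: measurableT_comp => //; exact: continuous_measurable_real.
by move=> x _; rewrite lee_fin.
Qed.

Lemma first_inequality : exists2 b : R, 0 < b &
  forall (f : X -> R) (L : R), continuous f -> (forall x, `|f x| <= L) ->
  forall mu : probability X R, shift_invariant mu -> mu.-integrable setT (EFin \o phi) ->
  forall Imu Im Iphi : R, (\int[mu]_x (f x)%:E = Imu%:E)%E ->
    (\int[m]_x (f x)%:E = Im%:E)%E -> (\int[mu]_x (phi x)%:E = Iphi%:E)%E ->
    `|Im - Imu| <= b * L * Num.sqrt (P - Iphi).
Proof.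
have [xy|single] := pselect (exists x y : X, x <> y); last first.
  exists 1 => // f L fc fb mu muT phiI Imu Im Iphi HImu HIm _.
  have L0 : 0 <= L by exact: le_trans (fb point).
  have fE x : f x = f point.
    by congr f; apply: contrapT => xp; apply: single; exists x, point.
  have E (nu : probability X R) : (\int[nu]_x (f x)%:E = (f point)%:E)%E.
    by under eq_integral do rewrite fE; exact: integral_probability_cst.
  move: HImu HIm; rewrite !E => -[<-] [<-].
  by rewrite subrr normr0 !mulr_ge0// sqrtr_ge0.
have [c c0 Hc] := pressure_gap Hmix mT C0 Hg xy.
have s0 : 0 < Num.sqrt c by rewrite sqrtr_gt0.
(* The trivial bound [2 * L] is absorbed because the root is at least [Num.sqrt c]. *)
exists (2 / Num.sqrt c); first by rewrite divr_gt0.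
move=> f L fc fb mu muT phiI Imu Im Iphi HImu HIm HIphi.
have L0 : 0 <= L by exact: le_trans (fb point).
have := Hc mu muT phiI; rewrite HIphi lee_fin => IP.
apply: (@le_trans _ _ (2 * L)).
  have := integral_bounded fc fb HImu; have := integral_bounded fc fb HIm.
  by have := ler_normB Im Imu; lra.
rewrite (_ : 2 / _ * L * _ = 2 * L * (Num.sqrt (P - Iphi) / Num.sqrt c)); last by ring.
rewrite ler_peMr ?mulr_ge0// ler_pdivlMr// mul1r ler_sqrt; lra.
Qed.

End first_inequality.

(** Leaves y an extended real, so that the series of variations can stay under the root as it is. A
    negative x is harmless, its root being 0. *)
Lemma sqrte_le (R : realType) (x : R) (y : \bar R) : x%:E <= y -> (Num.sqrt x)%:E <=
  sqrte y.
Proof.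
move=> xy; rewrite -[leLHS]/(sqrte x%:E); have [x0|/ltW x0] := leP 0%R x.
  by rewrite lee_sqrt// (le_trans _ xy)// lee_fin.
by rewrite [leLHS]/= ler0_sqrtr// sqrte_ge0.
Qed.

Theorem theorem1p3 (R : realType) (theta : {itv R & `]0, 1[})
    (S : countType) (t : rel S) (ne : admissible t !=set0)
    (Hmix : topologically_mixing theta ne)
    (phi : markov_shift theta ne -> R) (Hphi : locally_Holder phi)
    (m : probability (markov_shift theta ne) R) (Hm : gibbs phi m) :
  exists b : R, (0 < b)%R /\
    forall s : S, (cylinder [tuple s] : set (markov_shift theta ne)) !=set0 ->
    forall mu : probability (markov_shift theta ne) R,
      shift_invariant mu ->
      - (\int[mu]_x (phi x)%:E) < +oo ->
      entropy mu (principal theta ne) < +oo ->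
    forall f : markov_shift theta ne -> R, in_L f ->
    (forall n : nat, (1 <= n)%N ->
      `| \int[m]_x (f x)%:E - \int[mu]_x (f x)%:E | <=
      b%:E * L_norm f *
      ((theta%:num ^+ n)%:E +
       sqrte (2%:E * (theta%:num ^+ n)%:E *
                \sum_(n <= k <oo) cyl_variation phi k
              + pressure phi s
              - (\int[mu]_x (phi x)%:E
                 + cond_entropy mu (principal theta ne)
                     (iterated_join (principal theta ne) n)))))
    /\
    (forall l : nat, (1 <= l)%N -> cyl_variation phi l = 0 ->
     forall n : nat, (3 * l <= n)%N ->
      `| \int[m]_x (f x)%:E - \int[mu]_x (f x)%:E | <=
      b%:E * L_norm f *
      ((theta%:num ^+ (n - l)./2)%:E +
       sqrte (pressure phi s
              - (\int[mu]_x (phi x)%:E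
                 + (n%:R^-1)%:E *
                   entropy mu (iterated_join (principal theta ne) n))
              + (l%:R / (n - l)%:R)%:E * entropy mu (principal theta ne)))).
Proof.
case: Hm => mT [C [P [C0 Hg]]].
have phic := locally_Holder_continuous Hphi.
have [b1 b10 Hb1] := first_inequality Hmix mT C0 Hg.
pose locally_constant r := [/\ (0 < r)%N & cyl_variation phi r = 0].
have [b2 b20 Hb2] : exists2 b2 : R, (0 < b2)%R &
  forall (f : markov_shift theta ne -> R) (L : R), continuous f -> (forall x, (`|f x| <=
    L)%R) ->
    (forall n x y, (0 < n)%N -> prefix_word n x = prefix_word n y ->
      (`|f x - f y| <= L * theta%:num ^+ n)%R) ->
  forall mu : probability (markov_shift theta ne) R, shift_invariant mu ->
    mu.-integrable setT (EFin \o phi) ->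
  forall (l n : nat) (Imu Im Iphi a c : R), locally_constant l -> (3 * l <= n)%N ->
    \int[mu]_x (f x)%:E = Imu%:E -> \int[m]_x (f x)%:E = Im%:E ->
    \int[mu]_x (phi x)%:E = Iphi%:E ->
    word_entropy mu 1 = a%:E -> word_entropy mu n = c%:E ->
    (`|Im - Imu| <= b2 * L * (theta%:num ^+ (n - l)./2 +
      Num.sqrt (P - (Iphi + n%:R^-1 * c) + l%:R / (n - l)%:R * a)))%R.
  have [ex|nex] := pselect (exists r, `[< locally_constant r >]); last first.
    exists 1%R => // f L _ _ _ mu _ _ l n Imu Im Iphi a c lc.
    by exfalso; apply: nex; exists l; apply/asboolP.
  (* The constant has to be fixed before l. The least r with vanishing variation is at most every
     admissible l, so the constant obtained for r serves all of them. *)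
  case: (ex_minnP ex) => r /asboolP[r0 varr] rmin.
  have Hr x y : prefix_word r x = prefix_word r y -> phi x = phi y.
    move=> xy; apply/eqP; rewrite -subr_eq0 -normr_le0.
    by apply: cyl_variation_le xy; rewrite varr.
  have [B B0 HB] := second_inequality Hmix mT C0 Hg r0 Hr.
  exists B => // f L fc fb fl mu muT phiI l n Imu Im Iphi a c /asboolP/rmin rl.
  exact: HB.
exists (b1 + b2)%R; split; first exact: addr_gt0.
move=> s; rewrite cylinderE => sne mu muT phi_lt H_lt f fL.
have fc : continuous f by case: fL.
have [L [-> fb fl]] := in_L_bounds fL.
have L0 : (0 <= L)%R by exact: le_trans (fb point).
have finI (nu : probability (markov_shift theta ne) R) : \int[nu]_x (f x)%:E \is a
  fin_num :=
  integrable_fin_num measurableT (bounded_continuous_integrable nu fc fb).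
have phiI : mu.-integrable setT (EFin \o phi).
  by apply: (upper_bounded_integrable _ (potential_le C0 Hg)) => //;
    exact: continuous_measurable_real.
have phifin : \int[mu]_x (phi x)%:E \is a fin_num := integrable_fin_num measurableT phiI.
have HIm := esym (fineK (finI m)); have HImu := esym (fineK (finI mu)).
have HIphi := esym (fineK phifin).
move: (fine _) HIm (fine _) HImu (fine _) HIphi => Im HIm Imu HImu Iphi HIphi.
rewrite (pressureE Hmix mT C0 Hg sne) HIm HImu HIphi.
split=> [n n0|l l0 lvar n ln].
  rewrite cond_entropy_refine// adde0 -EFinM.
  (* Since the variations are nonnegative, the expression under the root is at least [P - Iphi]. *)
  set z := (X in sqrte X); have zP : (P - Iphi)%:E <= z.
    rewrite /z EFinB leeB// leeDr// mule_ge0//; last first.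
      by apply: nneseries_ge0 => k _ _; exact: cyl_variation_ge0.
  apply: (@le_trans _ _ ((b1 + b2) * L * Num.sqrt (P - Iphi))%:E).
    rewrite lee_fin; apply: le_trans (Hb1 f L fc fb mu muT phiI _ _ _ HImu HIm HIphi) _.
    by rewrite ler_wpM2r ?sqrtr_ge0// ler_wpM2r// lerDl ltW.
  rewrite [leLHS]EFinM; apply: lee_wpmul2l.
    by rewrite lee_fin mulr_ge0// addr_ge0// ltW.
  by apply: le_trans (sqrte_le zP) _; rewrite leeDr// lee_fin exprn_ge0.
have H1E : entropy mu (principal theta ne) = word_entropy mu 1.
  rewrite -entropy_words; congr entropy; apply/seteqP; split.
    by move=> _ [s' _ <-]; exists [:: s'] => //; rewrite cylinderE.
  by move=> _ [[//|s' [|//]] _ <-]; exists s' => //; rewrite cylinderE.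
rewrite iterated_join_words entropy_words H1E in H_lt *.
have H1fin : word_entropy mu 1 \is a fin_num by rewrite ge0_fin_numE// word_entropy_ge0.
have Ha := esym (fineK H1fin).
have Hnfin : word_entropy mu n \is a fin_num.
  rewrite ge0_fin_numE ?word_entropy_ge0//.
  by rewrite (le_lt_trans (word_entropy_le muT n Ha))// ltry.
have Hc := esym (fineK Hnfin).
move: (fine _) Ha (fine _) Hc => a Ha c Hc; rewrite Ha Hc.
suff : (`|Im - Imu| <= (b1 + b2) * L * (theta%:num ^+ (n - l)./2 +
    Num.sqrt (P - (Iphi + n%:R^-1 * c) + l%:R / (n - l)%:R * a)))%R by [].
apply: le_trans (Hb2 f L fc fb fl mu muT phiI l n _ _ _ _ _ (conj l0 lvar) ln HImu HIm
  HIphi Ha Hc) _.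
by rewrite ler_wpM2r ?addr_ge0 ?exprn_ge0 ?sqrtr_ge0// ler_wpM2r// lerDr ltW.
Qed.
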